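(* Let $A\in\mathrm{GL}(n,\mathbb{R})$ with $|\det A|>1$, let $B=A^T$, and let $\Gamma\subset\mathbb{R}^n$ be a full-rank lattice with dual lattice $\Gamma^*$. Let $E\subset\mathbb{R}^n$ be the real subspace associated with the eigenvalues $\lambda$ of $B$ satisfying $|\lambda|\le 1$ (defined in the context). The following assertions are equivalent: (i) $(B,\Gamma^* )$ satisfies the lattice counting estimate; (ii) for any finite collection $\Psi=\{\psi_1,\dots,\psi_L\}\subset L^2(\mathbb{R}^n)$, the local integrability condition $$\sum_{l=1}^L\sum_{j\in\mathbb{Z}}\sum_{k\in\Gamma^*}\int_{\operatorname{supp}\hat f}|\hat f(\xi+B^jk)|^2\,|\hat\psi_l(B^{-j}\xi)|^2\,d\xi<\infty\quad\text{for all } f\in\mathcal{D}_E$$ holds if and only if $\Psi$ satisfies the Calderón integrability condition $$\sum_{l=1}^L\sum_{j\in\mathbb{Z}}|\hat\psi_l(B^{-j}\xi)|^2\in L^1_{\mathrm{loc}}(\mathbb{R}^n\setminus E).$$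
   Context: Fourier transform: $\hat f(\xi)=\int_{\mathbb{R}^n}f(x)e^{-2\pi i\langle\xi,x\rangle}dx$, extended to $L^2(\mathbb{R}^n)$ in the usual way. Dual lattice: $\Gamma^*=\{x\in\mathbb{R}^n:\langle x,y\rangle\in\mathbb{Z}\text{ for all }y\in\Gamma\}$. Lattice counting estimate for $(B,\Gamma^* )$: for $r>0$ there is $C=C(r)$ such that $\#\big(\Gamma^*\cap B^j(\mathbf{B}(0,r))\big)\le C\max(1,|\det B|^j)$ for all $j\in\mathbb{Z}$, where $\mathbf{B}(0,r)$ is the open ball of radius $r$ centered at $0$. The validity of this for some $r>0$ is equivalent to its validity for every $r>0$. The subspace $E$: regard $B$ as a linear map on $\mathbb{C}^n$, let $E^c\subset\mathbb{C}^n$ be the span of the generalized eigenspaces of $B$ corresponding to eigenvalues $\lambda$ with $|\lambda|\le1$, and put $E=E^c\cap\mathbb{R}^n$. Since $|\det B|>1$, $E$ is a proper subspace of $\mathbb{R}^n$. The space $\mathcal{D}_E$: $\mathcal{D}_E=\{f\in L^2(\mathbb{R}^n):\hat f\in L^\infty(\mathbb{R}^n)\text{ and }\overline{\operatorname{supp}\hat f}\subset\mathbb{R}^n\setminus E\text{ is compact}\}$, where $\operatorname{supp}\hat f$ is the set where $\hat f\neq0$. $L^1_{\mathrm{loc}}(\mathbb{R}^n\setminus E)$ denotes functions integrable over every compact subset of $\mathbb{R}^n\setminus E$. The displayed local integrability condition is the one for the wavelet system $\{D_{A^j}T_\gamma\psi_l:j\in\mathbb{Z},\gamma\in\Gamma,l=1,\dots,L\}$,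 where $D_Af(x)=|\det A|^{1/2}f(Ax)$ and $T_\gamma f(x)=f(x-\gamma)$. *)

(* Defs.v *)
From HB Require Import structures.
From mathcomp Require Import all_boot all_order all_algebra.
From mathcomp Require Import all_classical all_reals all_analysis.
From mathcomp Require Import complex.

Set Implicit Arguments.
Unset Strict Implicit.
Unset Printing Implicit Defensive.

Import Order.TTheory GRing.Theory Num.Theory.
Import numFieldNormedType.Exports.
Import ComplexField.Normc.

Local Open Scope classical_set_scope.
Local Open Scope ring_scope.

(* Measurable structure on column vectors: the product (= Borel)
   sigma-algebra, generated by the coordinate maps. *)

Definition cV_display : measure_display. Proof. exact. Qed.

Section measurable_cV.
Variables (R : realType) (n : nat).

Let coors : 'I_n -> 'cV[R]_n -> measurableTypeR R := fun i x => x i ord0.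

Let cV_set0 : g_sigma_preimage coors set0.
Proof. exact: sigma_algebra0. Qed.

Let cV_setC A : g_sigma_preimage coors A -> g_sigma_preimage coors (~` A).
Proof. exact: sigma_algebraC. Qed.

Let cV_bigcup (F : _^nat) : (forall i, g_sigma_preimage coors (F i)) ->
  g_sigma_preimage coors (\bigcup_i (F i)).
Proof. exact: sigma_algebra_bigcup. Qed.

HB.instance Definition _ := @isMeasurable.Build cV_display
  'cV[R]_n (g_sigma_preimage coors) cV_set0 cV_setC cV_bigcup.

Lemma measurable_coord (i : 'I_n) :
  measurable_fun [set: 'cV[R]_n] (fun x : 'cV[R]_n => x i ord0).
Proof.
move=> _ Y mY; rewrite setTI; apply: sub_sigma_algebra => /=.
rewrite -bigcup_seq/=; exists i => /=; first by rewrite mem_index_enum.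
by exists Y => //; rewrite setTI.
Qed.

Lemma measurable_fun_coordP d (T : measurableType d) (f : T -> 'cV[R]_n) :
  (forall i, measurable_fun [set: T] (fun t => f t i ord0)) ->
  measurable_fun [set: T] f.
Proof.
move=> mf; suff H : g_sigma_preimage (fun i => coors i \o f) `<=` measurable.
  rewrite (g_sigma_preimage_comp coors f) in H.
  by move=> _ A mA; apply: H; exists A.
apply: smallest_sub; first exact: sigma_algebra_measurable.
rewrite -bigcup_seq; apply: bigcup_sub => i _ A [B mB <-].
exact: mf.
Qed.

End measurable_cV.

Section lebesgue_cV.
Variable R : realType.

Definition cons_cV n (p : measurableTypeR R * 'cV[R]_n) : 'cV[R]_n.+1 :=
  col_mx (p.1)%:M p.2.

Lemma measurable_cons_cV n : measurable_fun setT (@cons_cV n).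
Proof.
apply: measurable_fun_coordP => i; rewrite /cons_cV.
case: (@split_ordP 1 n i) => j ->.
- under eq_fun do rewrite (@col_mxEu _ 1) (ord1 j) mxE eqxx mulr1n.
  exact: measurable_fst.
- under eq_fun do rewrite (@col_mxEd _ 1).
  apply: (measurableT_comp (measurable_coord j)); exact: measurable_snd.
Qed.

Definition head_cV n (x : 'cV[R]_n.+1) : measurableTypeR R * 'cV[R]_n :=
  (x ord0 ord0, \col_i x (lift ord0 i) ord0).

Lemma measurable_head_cV n : measurable_fun setT (@head_cV n).
Proof.
apply: measurable_fun_pair; first exact: measurable_coord.
apply: measurable_fun_coordP => i.
by under eq_fun do rewrite mxE; exact: measurable_coord.
Qed.

Lemma cons_cVK n : cancel (@cons_cV n) (@head_cV n).
Proof.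
case=> x v; congr (_, _).
  have -> : ord0 = lshift n (ord0 : 'I_1) by exact/val_inj.
  by rewrite (@col_mxEu _ 1) mxE eqxx mulr1n.
apply/colP => i; rewrite mxE.
have -> : lift ord0 i = rshift 1 i by exact/val_inj.
by rewrite (@col_mxEd _ 1).
Qed.

Section step.
Variables (n : nat)
  (nu : {sigma_finite_measure set (measurableTypeR R) -> \bar R})
  (mu : {sigma_finite_measure set 'cV[R]_n -> \bar R}).

Definition cons_measure :=
  pushforward (nu \x mu)%E (@cons_cV n).

Let cons_measure0 : cons_measure set0 = 0%E.
Proof. by rewrite /cons_measure /pushforward preimage_set0 measure0. Qed.

Let cons_measure_ge0 A : (0 <= cons_measure A)%E.
Proof. by rewrite /cons_measure /pushforward measure_ge0. Qed.

Let cons_measure_sigma_additive : semi_sigma_additive cons_measure.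
Proof.
move=> F mF tF mUF; rewrite /cons_measure /pushforward preimage_bigcup.
have mcons A : measurable A -> measurable (@cons_cV n @^-1` A).
  by move=> mA; rewrite -[X in measurable X]setTI; exact: measurable_cons_cV.
apply: measure_semi_sigma_additive.
- by move=> k; exact: mcons.
- apply/trivIsetP => /= i j _ _ ij; rewrite -preimage_setI.
  by move/trivIsetP : tF => /(_ _ _ _ _ ij) ->//; rewrite preimage_set0.
- by rewrite -preimage_bigcup; exact: mcons.
Qed.

HB.instance Definition _ := isMeasure.Build _ _ _ cons_measure
  cons_measure0 cons_measure_ge0 cons_measure_sigma_additive.

Let cons_measure_sigma_finite : sigma_finite setT cons_measure.
Proof.
have /sigma_finiteP[F [TF ndF Foo]] := sigma_finiteT nu.
have /sigma_finiteP[G [TG ndG Goo]] := sigma_finiteT mu.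
exists (fun k => @head_cV n @^-1` (F k `*` G k)).
  rewrite predeqE => v; split=> // _.
  have [i _ Fi] : (\bigcup_i F i) (head_cV v).1 by rewrite -TF.
  have [j _ Gj] : (\bigcup_i G i) (head_cV v).2 by rewrite -TG.
  exists (maxn i j) => //; split.
    by move: Fi; exact/subsetPset/ndF/leq_maxl.
  by move: Gj; exact/subsetPset/ndG/leq_maxr.
move=> k; have [mF F_lt] := Foo k; have [mG G_lt] := Goo k; split.
  rewrite -[X in measurable X]setTI; apply: measurable_head_cV => //.
  exact: measurableX.
rewrite /cons_measure /pushforward -comp_preimage.
rewrite (_ : _ @^-1` _ = F k `*` G k); last first.
  by apply/funext => p; rewrite /preimage/= -[in RHS](cons_cVK p).
by rewrite product_measure1E// lte_mul_pinfty// ge0_fin_numE.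
Qed.

HB.instance Definition _ := Measure_isSigmaFinite.Build _ _ _
  cons_measure cons_measure_sigma_finite.

End step.

(* n-dimensional Lebesgue measure: the n-fold product of the Lebesgue measure
   of the line, transported along R x R^n ~ R^n.+1. *)
Fixpoint lebesgue_cV n : {sigma_finite_measure set 'cV[R]_n -> \bar R} :=
  match n with
  | 0%N => [the {sigma_finite_measure set 'cV[R]_0 -> \bar R} of dirac (0 : 'cV[R]_0)]
  | n'.+1 => [the {sigma_finite_measure set 'cV[R]_n'.+1 -> \bar R} of
              cons_measure lebesgue_measure (lebesgue_cV n')]
  end.

End lebesgue_cV.

Local Open Scope complex_scope.

Section euclidean.
Variables (R : realType) (n : nat).
Implicit Types (x y : 'cV[R]_n) (G : set 'cV[R]_n).

Definition dotp x y : R := \sum_i x i ord0 * y i ord0.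

(* The ball of the norm that the library puts on matrices is a cube. *)
Definition euclidean_ball (r : R) : set 'cV[R]_n :=
  [set x | Num.sqrt (dotp x x) < r].

Definition full_rank_lattice G : Prop :=
  exists2 P : 'M[R]_n, P \in unitmx &
    G = range (fun z : 'cV[int]_n => P *m map_mx intr z).

Definition dual_lattice G : set 'cV[R]_n :=
  [set x | forall y, G y -> dotp x y \is a Num.int].

End euclidean.

Section complex_functions.
Variables (R : realType) (n : nat).
Implicit Types (f g : 'cV[R]_n -> R[i]) (p : \bar R).

Definition cmeasurable f : Prop :=
  measurable_fun setT (fun x => complex.Re (f x)) /\
  measurable_fun setT (fun x => complex.Im (f x)).

Definition cLnorm p f : \bar R :=
  Lnorm (lebesgue_cV R n) p (fun x => (normc (f x))%:E).

Definition inLp p f : Prop := cmeasurable f /\ (cLnorm p f < +oo)%E.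

Definition cintegral f : R[i] :=
  (\int[lebesgue_cV R n]_x complex.Re (f x))%R +i*
  (\int[lebesgue_cV R n]_x complex.Im (f x))%R.

Definition expi (t : R) : R[i] := cos t +i* sin t.

Definition fourierL1 f (xi : 'cV[R]_n) : R[i] :=
  cintegral (fun x => f x * expi (- (2 * pi * dotp xi x))).

(* [is_fourier f g]: the function g represents the Fourier transform of
   f in L^2.  The graph of the transform on L^2 is the closure in L^2 x L^2 of
   the graph of [fourierL1] on L^1 /\ L^2 (Plancherel). *)
Definition is_fourier f g : Prop :=
  [/\ inLp 2%:E f, inLp 2%:E g &
   exists h : nat -> 'cV[R]_n -> R[i],
    [/\ forall k, inLp 1%:E (h k) /\ inLp 2%:E (h k),
        (fun k => cLnorm 2%:E (fun x => h k x - f x)) @ \oo --> 0%E &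
        (fun k => cLnorm 2%:E (fun xi => fourierL1 (h k) xi - g xi))
          @ \oo --> 0%E]].

Definition fsupp f : set 'cV[R]_n := [set x | f x != 0].

End complex_functions.

Section theorem_notions.
Variables (R : realType) (n : nat).
Implicit Types (B : 'M[R]_n.+1) (E G : set 'cV[R]_n.+1).

(* [eigenvalue] and [geigenspace] deal with row vectors: the transposes of the
   column (generalized) eigenvectors of B are those of B^T. *)
Definition central_space B : set 'cV[R]_n.+1 :=
  let BC := map_mx (real_complex R) B in
  [set x | exists2 s : seq R[i],
     forall a, a \in s -> eigenvalue BC^T a /\ `|a| <= 1 &
     ((map_mx (real_complex R) x)^T <= \sum_(a <- s) geigenspace BC^T a)%MS].

Definition lattice_counting_estimate B G : Prop :=
  forall r : R, 0 < r -> exists C : R, forall j : int,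
    (counting (G `&` [set B ^ j *m x | x in euclidean_ball r])
       <= (C * Num.max 1 (`|\det B| ^ j))%:E)%E.

(* [D_space E f fhat]: f belongs to D_E, and fhat is a representative of its
   Fourier transform whose support witnesses it (the closure of the set where
   fhat does not vanish depends on the representative). *)
Definition D_space E (f fhat : 'cV[R]_n.+1 -> R[i]) : Prop :=
  [/\ is_fourier f fhat, inLp +oo%E fhat,
      compact (closure (fsupp fhat)) & closure (fsupp fhat) `<=` ~` E].

Definition local_integrability_condition B G E (L : nat)
    (psihat : 'I_L -> 'cV[R]_n.+1 -> R[i]) : Prop :=
  forall f fhat : 'cV[R]_n.+1 -> R[i], D_space E f fhat ->
  ((\sum_(l < L) \esum_(j in [set: int]) \esum_(k in G)
     \int[lebesgue_cV R n.+1]_(xi in fsupp fhat)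
       (normc (fhat (xi + B ^ j *m k)) ^+ 2 *
        normc (psihat l (B ^ (- j) *m xi)) ^+ 2)%:E)%E < +oo)%E.

Definition loc_integrable E (F : 'cV[R]_n.+1 -> \bar R) : Prop :=
  forall K, compact K -> K `<=` ~` E -> (lebesgue_cV R n.+1).-integrable K F.

Definition calderon_condition B E (L : nat)
    (psihat : 'I_L -> 'cV[R]_n.+1 -> R[i]) : Prop :=
  loc_integrable E (fun xi => \sum_(l < L) \esum_(j in [set: int])
    (normc (psihat l (B ^ (- j) *m xi)) ^+ 2)%:E)%E.

End theorem_notions.

(* Main.v *)
Require Import Defs.
From mathcomp Require Import all_boot all_order all_algebra.
From mathcomp Require Import all_classical all_reals all_analysis.
From mathcomp Require Import complex finmap measurable_realfun ess_sup_inf.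
From mathcomp Require Import fingroup perm ring lra.

(** Off the subspace E spanned by the eigenvalues of modulus at most 1, the
matrix B expands: there are a seminorm q with kernel E and a number lam > 1 such
that lam * q x <= q (B x) for all x ([expanding_seminorm]).  So, for a compact set
K disjoint from E, where q is bounded above and away from 0, the visits of any
B-orbit to K fall within N + 1 consecutive times ([orbit_visits]).  This bounds,
uniformly in x, every sum over j of values of size at most c that vanish unless
B^j x belongs to K ([esum_visits]).

From counting to the equivalence of the two conditions.  The local integrability
condition always implies the Calderon condition ([calderon_of_lic]): if the
transform of f is a tent over a cube, its terms k = 0 dominate the integral of
the Calderon sum over the half cube, and finitely many such cubes cover a compact
set.  Conversely ([lic_of_calderon]), let the transform of f be bounded by M and
vanish off K.  The term (j, k) vanishes unless B^j k lies in K - K, so that at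
scale j the estimate leaves at most C max(1, |det B|^-j) terms, each at most M^2
J_j, where J_j is the integral over K of the square of psihat (B^-j xi).  Now
max(1, t) <= 1 + t; the sum of the J_j is finite by the Calderon condition, and a
change of variables turns |det B|^-j J_j into the integral of |psihat|^2 over the
points eta with B^j eta in K.  By the bound on visits these integrals add up to
at most (N + 1) times the squared norm of psihat ([weighted_energy_lty]).

From the equivalence to counting, by contraposition ([calderon_without_lic]).  If
the estimate fails at radius r, there are scales j_i for which the image of the
ball of radius r under B^j_i contains more than 8^i m_i points of the dual
lattice, where m_i = max(1, |det B|^j_i).  Let tau be a tent on a cube of
half-width r at x0, far from E, and
    psihat (xi) = sum_i b_i tau (B^-j_i xi)   with   b_i^2 = 4^-i / m_i.
This choice of b_i makes the series converge in L2 together with the series of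
the inverse transforms ([dilated_tents]).  By Cauchy-Schwarz |psihat|^2 is at
most 2 sum_i 2^i b_i^2 tau (B^-j_i xi)^2, and the bound on visits turns this into
a uniform bound for the Calderon sum.  But when the transform of f is a tent of
half-width 4 r at x0, the part of the local integrability sum at scale -j_i is at
least a constant times b_i^2 8^i m_i = 2^i, for every i.

The tents have explicit inverse transforms.  On the line, scaling shows that the
integral of (1 - cos (a x)) / x^2 is |a| times a constant; since (1 - cos (a x))
cos (b x) is a combination of functions 1 - cos (c x), the cosine transform of
this kernel is a combination of absolute values, and it is a tent
([Rintegral_tent_kernel_cos]).  Products of such kernels give the tents in higher
dimension ([integrable_product_kernel_trig]), and the linear change of variables,
which LUP decomposition reduces to Fubini's theorem ([unitmx_det_scales]), gives
their dilates. *)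

Set Implicit Arguments.
Unset Strict Implicit.
Unset Printing Implicit Defensive.

Import Order.TTheory GRing.Theory Num.Theory.
Import numFieldNormedType.Exports.
Import ComplexField.Normc.
Local Open Scope classical_set_scope.
Local Open Scope ring_scope.
Local Open Scope complex_scope.

(** * An expanding seminorm with kernel E *)

Section row_norm.
Variables (R : rcfType) (n : nat).
Implicit Types u v : 'rV[R[i]]_n.

Definition row_norm u : R := \sum_i normc (u ord0 i).

Lemma normc_ge0 (z : R[i]) : 0 <= normc z.
Proof. by case: z => a b; exact: sqrtr_ge0. Qed.

Lemma row_norm_ge0 u : 0 <= row_norm u.
Proof. by apply: sumr_ge0 => i _; exact: normc_ge0. Qed.

Lemma row_norm0 : row_norm 0 = 0.
Proof. by apply: big1 => i _; rewrite mxE normc0. Qed.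

Lemma row_norm_eq0 u : row_norm u = 0 -> u = 0.
Proof.
move=> /eqP; rewrite psumr_eq0 => [/allP u0|i _]; last exact: normc_ge0.
apply/rowP => i; rewrite mxE; apply: eq0_normc; apply/eqP.
by apply: (implyP (u0 i _)) => //; rewrite mem_index_enum.
Qed.

Lemma row_normD u v : row_norm (u + v) <= row_norm u + row_norm v.
Proof.
rewrite /row_norm -big_split/=; apply: ler_sum => i _.
by rewrite mxE; exact: le_normcD.
Qed.

Lemma row_normZ a u : row_norm (a *: u) = normc a * row_norm u.
Proof.
by rewrite /row_norm mulr_sumr; apply: eq_bigr => i _; rewrite mxE normcM.
Qed.

End row_norm.

Section adapted_norm.
Variables (R : rcfType) (n : nat) (M : 'M[R[i]]_n.+1) (a : R[i]) (t : R).
Hypothesis t_gt0 : 0 < t.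
Implicit Types u v : 'rV[R[i]]_n.+1.

(** The usual trick that turns the spectral radius into a norm: the weights t^-k
give the nilpotent part M - a of M on a generalized eigenspace a norm at most t. *)
Definition adapted_norm v : R :=
  \sum_(k < n.+1) t ^- k * row_norm (v *m (M - a%:M) ^+ k).

Lemma adapted_norm_ge0 v : 0 <= adapted_norm v.
Proof.
apply: sumr_ge0 => k _; rewrite mulr_ge0 ?row_norm_ge0//.
by rewrite invr_ge0 exprn_ge0// ltW.
Qed.

Lemma adapted_norm_eq0 v : adapted_norm v = 0 -> v = 0.
Proof.
move=> v0; apply: row_norm_eq0; apply/eqP; rewrite eq_le row_norm_ge0 andbT -v0.
rewrite /adapted_norm big_ord_recl/= expr0 invr1 mul1r mulmx1 lerDl.
apply: sumr_ge0 => k _; rewrite mulr_ge0 ?row_norm_ge0//.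
by rewrite invr_ge0 exprn_ge0// ltW.
Qed.

Lemma adapted_norm0 : adapted_norm 0 = 0.
Proof. by apply: big1 => k _; rewrite mul0mx row_norm0 mulr0. Qed.

Lemma adapted_normD u v :
  adapted_norm (u + v) <= adapted_norm u + adapted_norm v.
Proof.
rewrite /adapted_norm -big_split/=; apply: ler_sum => k _.
rewrite mulmxDl -mulrDr ler_wpM2l ?row_normD//.
by rewrite invr_ge0 exprn_ge0// ltW.
Qed.

Lemma adapted_normZ c u : adapted_norm (c *: u) = normc c * adapted_norm u.
Proof.
rewrite /adapted_norm mulr_sumr; apply: eq_bigr => k _.
by rewrite -scalemxAl row_normZ mulrCA.
Qed.

(** On a generalized eigenvector, M is the sum of a and of a map of norm at most t,
because applying that map shifts the sum by one index and costs a factor t. *)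
Lemma adapted_norm_expand v : v *m (M - a%:M) ^+ n.+1 = 0 ->
  (normc a - t) * adapted_norm v <= adapted_norm (v *m M).
Proof.
move=> vN; set N := M - a%:M in vN *.
have nN : adapted_norm (v *m N) <= t * adapted_norm v.
  have -> : adapted_norm (v *m N) =
      t * \sum_(k < n.+1) t ^- k.+1 * row_norm (v *m N ^+ k.+1).
    rewrite mulr_sumr; apply: eq_bigr => k _.
    rewrite -mulmxA -/N mulmxE -exprS mulrA; congr (_ * _).
    by rewrite exprS invfM mulrA divff ?mul1r// gt_eqF.
  rewrite ler_pM2l// /adapted_norm [leRHS]big_ord_recl/= [leLHS]big_ord_recr/=.
  rewrite vN row_norm0 mulr0 addr0 -/N.
  by rewrite expr0 invr1 mul1r mulmx1 lerDr row_norm_ge0.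
have -> : v *m M = a *: v + v *m N.
  by rewrite /N mulmxBr mul_mx_scalar addrC subrK.
have : adapted_norm (a *: v) <= adapted_norm (a *: v + v *m N) + adapted_norm (- (v *m N)).
  by rewrite -{1}[a *: v](addrK (v *m N)) adapted_normD.
rewrite -scaleN1r !adapted_normZ normcN normc1 mul1r => h.
by rewrite mulrBl lerBlDr (le_trans h)// lerD2l.
Qed.

End adapted_norm.

Section expanding_part.
Variables (R : rcfType) (n : nat) (M : 'M[R[i]]_n.+1).

(** The exponent n.+1 bounds the multiplicity of every root of the characteristic
polynomial, so that one exponent serves all eigenvalues. *)
Lemma eigenvalue_seq : exists2 s : seq R[i], uniq s &
  (forall a, (a \in s) = eigenvalue M a) /\
  mxminpoly M %| \prod_(a <- s) ('X - a%:P) ^+ n.+1.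
Proof.
have [rs /=] := closed_field_poly_normal (char_poly M).
rewrite (monicP (char_poly_monic M)) scale1r => prs.
exists (undup rs); first exact: undup_uniq.
split=> [a|].
  by rewrite mem_undup eigenvalue_root_char prs root_prod_XsubC.
apply: (dvdp_trans (mxminpoly_dvd_char M)); rewrite prs.
have -> : \prod_(z <- rs) ('X - z%:P) =
    \prod_(z <- undup rs) ('X - z%:P) ^+ count_mem z rs.
  by rewrite -(@prodr_undup_exp_count _ _ rs predT).
have rsN : size rs = n.+1.
  by apply: eq_add_S; rewrite -(size_char_poly M) prs size_prod_XsubC.
elim/big_ind2 : _ => [|p q p' q' pq pq'|z _]; rewrite ?dvdp_mul//.
by rewrite dvdp_exp2l// -rsN count_size.
Qed.

Variables (s : seq R[i]).
Hypotheses (us : uniq s)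
  (sM : mxminpoly M %| \prod_(a <- s) ('X - a%:P) ^+ n.+1).

(** Multiplying by this polynomial in M kills every generalized eigenspace but the
i-th one, and lands in the i-th one: an unnormalized spectral projector. *)
Definition cofactor_poly (i : 'I_(size s)) : {poly R[i]} :=
  \prod_(j < size s | j != i) ('X - (s`_j)%:P) ^+ n.+1.

Let coprime_nth (i j : 'I_(size s)) : j != i ->
  coprimep (('X - (s`_i)%:P) ^+ n.+1) (('X - (s`_j)%:P) ^+ n.+1).
Proof.
move=> ji; rewrite coprimep_expr// coprimep_expl//.
by rewrite coprimep_XsubC root_XsubC nth_uniq.
Qed.

Lemma cofactor_geigen (i : 'I_(size s)) :
  horner_mx M (cofactor_poly i) * (M - (s`_i)%:M) ^+ n.+1 = 0.
Proof.
have -> : (M - (s`_i)%:M) ^+ n.+1 = horner_mx M (('X - (s`_i)%:P) ^+ n.+1).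
  by rewrite rmorphXn/= rmorphB/= horner_mx_X horner_mx_C.
rewrite -rmorphM/=; apply: mxminpoly_minP; rewrite mulrC.
by move: sM; rewrite (big_nth 0) big_mkord (bigD1 i).
Qed.

Lemma geigenspace_cofactor (i j : 'I_(size s)) (v : 'rV_n.+1) : j != i ->
  (v <= geigenspace M s`_j)%MS -> v *m horner_mx M (cofactor_poly i) = 0.
Proof.
move=> ji /sub_kermxP vj; rewrite /cofactor_poly (bigD1 j)//= rmorphM/=.
by rewrite -mulmxE mulmxA vj mul0mx.
Qed.

(** In the decomposition of v over all generalized eigenspaces, the component at
an expanding eigenvalue is killed both by its own factor and by the cofactor,
which are coprime; so it is zero. *)
Lemma sub_contracting_geigenspaces (v : 'rV[R[i]]_n.+1) :
  (forall i : 'I_(size s), 1 < normc s`_i ->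
     v *m horner_mx M (cofactor_poly i) = 0) ->
  (v <= \sum_(a <- s | (normc a <= 1)%R) geigenspace M a)%MS.
Proof.
move=> v0; rewrite (big_nth 0) big_mkord.
have : (v <= \sum_(i < size s) geigenspace M s`_i)%MS.
  have cp : {in predT &, forall i j : 'I_(size s), j != i ->
      coprimep (('X - (s`_i)%:P) ^+ n.+1) (('X - (s`_j)%:P) ^+ n.+1)}.
    by move=> i j _ _; exact: coprime_nth.
  rewrite -(kermxpoly_prod M cp) kermxpoly_min ?submx1//.
  by move: sM; rewrite (big_nth 0) big_mkord.
move=> /sub_sumsmxP[u vu]; apply/sub_sumsmxP; exists u.
rewrite {1}vu (bigID (fun i : 'I_(size s) => normc s`_i <= 1))/=.
rewrite [X in _ + X]big1 ?addr0// => i; rewrite -ltNge => i1.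
have wi : (u i *m geigenspace M s`_i <= geigenspace M s`_i)%MS by exact: submxMl.
have := v0 i i1; rewrite {1}vu (bigD1 i)//= mulmxDl mulmx_suml.
rewrite [X in _ + X]big1 ?addr0 => [wP|j ji]; last first.
  by apply: geigenspace_cofactor ji _; exact: submxMl.
apply/eqP; rewrite -submx0.
rewrite -(mxdirect_kermxpoly M (p := ('X - (s`_i)%:P) ^+ n.+1) (q := cofactor_poly i)).
  by rewrite sub_capmx wi; apply/sub_kermxP.
rewrite /cofactor_poly (@big_morph _ _ _ true andb) ?coprimep1//; last first.
  by move=> p q; rewrite coprimepMr.
by rewrite big_all_cond; apply/allP => j _; apply/implyP => ji; exact: coprime_nth.
Qed.

Lemma contracting_geigenspaces_cofactor (v : 'rV[R[i]]_n.+1)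
    (i : 'I_(size s)) :
  (v <= \sum_(j < size s | j != i) geigenspace M s`_j)%MS ->
  v *m horner_mx M (cofactor_poly i) = 0.
Proof.
move=> /sub_sumsmxP[u ->]; rewrite mulmx_suml big1// => j ji.
by apply: geigenspace_cofactor ji _; exact: submxMl.
Qed.

(** A polynomial in M acts on an eigenvector by its value at the eigenvalue, and
the cofactor does not vanish at its own eigenvalue. *)
Lemma eigenvector_cofactor (i : 'I_(size s)) (v : 'rV[R[i]]_n.+1) : v != 0 ->
  v *m M = s`_i *: v -> v *m horner_mx M (cofactor_poly i) != 0.
Proof.
move=> v0 vM; suff hM p : v *m horner_mx M p = p.[s`_i] *: v.
  rewrite hM scaler_eq0 (negbTE v0) orbF horner_prod prodf_seq_neq0.
  apply/allP => j _; apply/implyP => ji; rewrite horner_exp expf_neq0//.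
  by rewrite hornerXsubC subr_eq0 nth_uniq// eq_sym.
elim/poly_ind: p => [|p c IH]; first by rewrite rmorph0 mulmx0 horner0 scale0r.
rewrite rmorphD rmorphM/= horner_mx_X horner_mx_C mulmxDr -mulmxE mulmxA IH.
rewrite -scalemxAl vM mul_mx_scalar hornerD hornerM hornerX hornerC.
by rewrite scalerDl scalerA.
Qed.

End expanding_part.

Section expanding_seminorm.
Variables (R : realType) (n : nat) (B : 'M[R]_n.+1).

Lemma normcE_le1 (a : R[i]) : (`|a| <= 1) = (normc a <= 1).
Proof. by rewrite normc_def -[1]/((1 : R)%:C) lecR; case: a. Qed.

(** Up to sign the determinant is the product of the eigenvalues with their
multiplicities. *)
Lemma det_le1_eigenvalues (s : seq R[i]) :
  (forall a, (a \in s) = eigenvalue (map_mx (real_complex R) B)^T a) ->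
  (forall a, a \in s -> normc a <= 1) -> `|\det B| <= 1.
Proof.
move=> sE s1; set M := (map_mx _ _)^T in sE.
have [rs /=] := closed_field_poly_normal (char_poly M).
rewrite (monicP (char_poly_monic M)) scale1r => prs.
have := char_poly_det M; rewrite prs -horner_coef0 horner_prod.
rewrite det_tr det_map_mx/= => /(congr1 (@normc R)).
rewrite normcM (_ : normc ((-1) ^+ n.+1) = 1) ?mul1r; last first.
  elim: (n.+1) => [|m IH]; first by rewrite expr0 normc1.
  by rewrite exprS normcM IH mulr1 normcN normc1.
have -> : normc (\det B)%:C = `|\det B|.
  by rewrite /normc/= expr0n addr0 sqrtr_sqr.
move=> <-.
have : {in rs, forall z, normc z <= 1}.
  by move=> z zrs; apply: s1; rewrite sE eigenvalue_root_char prs root_prod_XsubC.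
elim: (rs) => [_|z r IH h]; first by rewrite big_nil normc1.
rewrite big_cons normcM hornerXsubC sub0r normcN.
rewrite mulr_ile1 ?normc_ge0//; first by apply: h; rewrite mem_head.
by apply: IH => w wr; apply: h; rewrite inE wr orbT.
Qed.

(** The seminorm is the sum, over the eigenvalues of modulus greater than 1, of the
adapted norms of the spectral components of x.  B multiplies each summand
at least by |a| - t >= 1 + t, because t is at most half of every gap |a| - 1. *)
Lemma expanding_seminorm : exists (q : 'cV[R]_n.+1 -> R) (lam : R),
  [/\ [/\ 1 < lam, forall x, 0 <= q x,
      forall x y, q (x + y) <= q x + q y & forall c x, q (c *: x) = `|c| * q x],
      forall x, lam * q x <= q (B *m x),
      forall x, q x = 0 <-> central_space B x &
      1 < `|\det B| -> exists x, 0 < q x].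
Proof.
set M := (map_mx (real_complex R) B)^T.
have [s us [sE sM]] := eigenvalue_seq M.
pose big (i : 'I_(size s)) := 1 < normc s`_i.
pose t : R := \big[Num.min/1]_(i < size s | big i) ((normc s`_i - 1) / 2).
have t0 : 0 < t.
  by apply/lt_bigmin => //i; rewrite /big => i1; rewrite divr_gt0// subr_gt0.
have ti i : big i -> 1 + 2 * t <= normc s`_i.
  move=> bi; have : t <= (normc s`_i - 1) / 2 by exact: bigmin_le_cond.
  by rewrite ler_pdivlMr//; lra.
pose row (x : 'cV[R]_n.+1) := (map_mx (real_complex R) x)^T.
pose comp (i : 'I_(size s)) x := row x *m horner_mx M (cofactor_poly n i).
pose q x := \sum_(i < size s | big i) adapted_norm M s`_i t (comp i x).
have q_ge0 x : 0 <= q x by apply: sumr_ge0 => i _; exact: adapted_norm_ge0.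
have q0P x : q x = 0 <-> forall i, big i -> comp i x = 0.
  split=> [/eqP|c0]; last by apply: big1 => i bi; rewrite c0// adapted_norm0.
  rewrite psumr_eq0 => [/allP qx0 i bi|i _]; last exact: adapted_norm_ge0.
  apply/(@adapted_norm_eq0 _ _ M s`_i _ t0)/eqP.
  by apply: (implyP (qx0 i _)) => //; rewrite mem_index_enum.
exists q, (1 + t); split.
- split => //.
  + by rewrite ltrDl.
  + move=> x y; rewrite /q -big_split/=; apply: ler_sum => i _.
    by rewrite /comp /row map_mxD linearD/= mulmxDl; exact: adapted_normD.
  + move=> c x; rewrite /q mulr_sumr; apply: eq_bigr => i _.
    rewrite /comp /row map_mxZ linearZ/= -scalemxAl adapted_normZ.
    by rewrite /normc/= expr0n addr0 sqrtr_sqr.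
- move=> x; rewrite /q mulr_sumr; apply: ler_sum => i bi.
  have -> : comp i (B *m x) = comp i x *m M.
    rewrite /comp /row map_mxM trmx_mul -!mulmxA; congr (_ *m _).
    by apply: comm_mx_horner; exact: comm_mx_refl.
  apply: le_trans (adapted_norm_expand t0 _); last first.
    by rewrite /comp -mulmxA mulmxE cofactor_geigen// mulmx0.
  rewrite ler_wpM2r ?adapted_norm_ge0//.
  by have := ti i bi; lra.
- move=> x; rewrite q0P; split=> [c0|].
    exists [seq a <- s | normc a <= 1] => [a|].
      by rewrite mem_filter sE -normcE_le1 => /andP[].
    by rewrite big_filter; apply: sub_contracting_geigenspaces.
  move=> [s' s'P xs'] i bi; apply: contracting_geigenspaces_cofactor.
  apply: (submx_trans xs'); rewrite big_seq; elim/big_ind : _ => //.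
  + exact: sub0mx.
  + by move=> U V ? ?; rewrite addsmx_sub; apply/andP.
  move=> a /s'P[eva]; rewrite normcE_le1 => a1.
  have sa : a \in s by rewrite sE.
  have ia : (index a s < size s)%N by rewrite index_mem.
  rewrite (bigD1 (Ordinal ia))/=; last first.
    apply/eqP => ai; move: bi; rewrite /big -ai/= nth_index//.
    by rewrite ltNge a1.
  by rewrite nth_index// addsmxSl.
- move=> detB; have [i bi] : exists i, big i.
    apply/not_existsP => nb; move: detB; rewrite ltNge => /negP; apply.
    apply: det_le1_eigenvalues sE _ => a sa; rewrite leNgt; apply/negP => a1.
    have ia : (index a s < size s)%N by rewrite index_mem.
    by apply: (nb (Ordinal ia)); rewrite /big/= nth_index.
  have /eigenvalueP[v vM v0] : eigenvalue M s`_i by rewrite -sE mem_nth.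
  have := eigenvector_cofactor us v0 vM.
  apply: contraNP => /forallNP nq.
  have Pi0 : horner_mx M (cofactor_poly n i) = 0.
    apply/row_matrixP => k; rewrite row0 rowE.
    have : q (delta_mx k ord0) = 0.
      by apply/eqP; rewrite eq_le q_ge0 andbT leNgt; apply/negP/nq.
    move=> /q0P/(_ i bi); rewrite /comp /row.
    by rewrite map_delta_mx trmx_delta.
  by rewrite Pi0 mulmx0 eqxx.
Qed.

End expanding_seminorm.

(** * Cubes, compact sets and visits of orbits *)

Section cube.
Variables (R : realType) (n : nat).
Implicit Types (a x : 'cV[R]_n.+1) (e : R).

Definition cube a e : set 'cV[R]_n.+1 :=
  [set x | forall i, `|x i ord0 - a i ord0| <= e].

Lemma ball_cVP x e y :
  ball x e y <-> 0 < e /\ forall i, `|x i ord0 - y i ord0| < e.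
Proof.
split=> [[e0 xy]|[e0 xy]]; split=> // i; first exact: xy.
by move=> j; rewrite (ord1 j); exact: xy.
Qed.

(** The transpose is a homeomorphism onto row vectors, where a product of segments
is compact. *)
Lemma compact_cube a e : compact (cube a e).
Proof.
have -> : cube a e = trmx @` [set v : 'rV[R]_n.+1 | forall i,
    [set r : R | `|r - a i ord0| <= e] (v ord0 i)].
  apply/seteqP; split=> [x xa|_ [v va <-] i]; last by rewrite mxE; exact: va.
  by exists x^T; rewrite ?trmxK// => i; rewrite /= mxE; exact: xa.
apply: continuous_compact; last first.
  apply: (@rV_compact R n.+1 (fun i => [set r : R | `|r - a i ord0| <= e])) => i.
  have -> : [set r : R | `|r - a i ord0| <= e] =
      `[a i ord0 - e, a i ord0 + e]%classic.
    by apply/seteqP; split=> r /=; rewrite in_itv/= ler_distl.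
  exact: segment_compact.
apply: continuous_subspaceT => v A /nbhs_ballP[d/= d0 dA].
apply/nbhs_ballP; exists d => //= w [_ vw]; apply: dA; split=> // i j.
by rewrite !mxE; exact: vw.
Qed.

Lemma closed_cube a e : closed (cube a e).
Proof.
exact: compact_closed (@norm_hausdorff _ _) (@compact_cube a e).
Qed.

Lemma nbhs_cube a e : 0 < e -> nbhs a (cube a e).
Proof.
move=> e0; apply/nbhs_ballP; exists e => //= x /ball_cVP[_ ax] i.
by rewrite distrC ltW.
Qed.

Lemma nbhs_cubeP a (A : set 'cV[R]_n.+1) :
  nbhs a A -> exists2 e, 0 < e & cube a e `<=` A.
Proof.
move=> /nbhs_ballP[e/= e0 eA]; exists (e / 2); first by rewrite divr_gt0.
move=> x xa; apply: eA; apply/ball_cVP; split=> // i.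
by rewrite distrC (le_lt_trans (xa i))// ltr_pdivrMr// ltr_pMr// ltr1n.
Qed.

(** Closed cubes rather than open balls: they are the supports of the tents. *)
Lemma compact_cube_cover (K : set 'cV[R]_n.+1) (d : 'cV[R]_n.+1 -> R) :
  compact K -> (forall x, K x -> 0 < d x) ->
  exists2 s : seq 'cV[R]_n.+1, (forall x, x \in s -> K x) &
    K `<=` \big[setU/set0]_(x <- s) cube x (d x).
Proof.
move=> cK d0; pose f (x : 'cV[R]_n.+1) := (cube x (d x))°.
have := cK; rewrite compact_cover => /(_ _ K f)[x Kx|x Kx|D DK KD].
- exact: open_interior.
- by exists x => //; apply: nbhs_cube; exact: d0.
exists (enum_fset D) => [x xD|x Kx].
  by apply/set_mem/DK.
rewrite -bigcup_seq; have [y yD fy] := KD x Kx; exists y => //.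
exact: interior_subset fy.
Qed.

End cube.

Section seminorm.
Variables (R : realType) (n : nat) (q : 'cV[R]_n.+1 -> R).
Hypotheses (q_ge0 : forall x, 0 <= q x)
  (qD : forall x y, q (x + y) <= q x + q y)
  (qZ : forall c x, q (c *: x) = `|c| * q x).

(** A seminorm is controlled by its values on the canonical basis. *)
Lemma seminorm_bound : exists2 C, 0 < C &
  forall (x : 'cV[R]_n.+1) (d : R),
    (forall i, `|x i ord0| <= d) -> q x <= C * d.
Proof.
exists (1 + \sum_i q (delta_mx i ord0)) => [|x d xd].
  by rewrite ltr_wpDr// sumr_ge0.
have d0 : 0 <= d by exact: le_trans (xd ord0).
rewrite mulrDl mul1r ler_wpDl// mulr_suml.
have xE : x = \sum_i x i ord0 *: delta_mx i ord0.
  by rewrite {1}(matrix_sum_delta x); apply: eq_bigr => i _; rewrite big_ord1.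
have q0 : q 0 = 0 by rewrite -(scale0r 0) qZ normr0 mul0r.
have qs (u : 'I_n.+1 -> 'cV[R]_n.+1) : q (\sum_i u i) <= \sum_i q (u i).
  elim/big_ind2 : _ => [|a b c e ab ce|//]; first by rewrite q0.
  by rewrite (le_trans (qD _ _))// lerD.
rewrite {1}xE (le_trans (qs _))//; apply: ler_sum => i _.
by rewrite qZ mulrC ler_wpM2l.
Qed.

Lemma seminorm_continuous : continuous q.
Proof.
have [C C0 qC] := seminorm_bound.
move=> x A /nbhs_ballP[d/= d0 dA]; pose e := d / 2.
have e0 : 0 < e by rewrite divr_gt0.
apply/nbhs_ballP; exists (e / C); rewrite /= ?divr_gt0// => y /ball_cVP[_ xy].
apply: dA; rewrite /ball/=; apply: (@le_lt_trans _ _ e); last first.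
  by rewrite ltr_pdivrMr// ltr_pMr// ltr1n.
have h (u v : 'cV[R]_n.+1) : (forall i, `|u i ord0 - v i ord0| <= e / C) -> q u <= q v + e.
  move=> uv; rewrite -[u](subrK v) addrC (le_trans (qD _ _))// lerD2l.
  have -> : e = C * (e / C) by rewrite mulrC divfK ?gt_eqF.
  by apply: qC => i; rewrite !mxE.
rewrite ler_distl lerBlDr h => [|i]; last by rewrite distrC ltW.
by rewrite h// => i; rewrite ltW.
Qed.

Variables (B : 'M[R]_n.+1) (lam : R).
Hypotheses (lam1 : 1 < lam) (qB : forall x, lam * q x <= q (B *m x)).

(** Along an orbit q grows at least like a geometric sequence, and on K it stays
between two positive bounds.  The minorant 1 + m (lam - 1) of lam^m is enough and
gives an explicit N. *)
Lemma compact_escape (K : set 'cV[R]_n.+1) :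
  compact K -> (forall x, K x -> 0 < q x) ->
  exists N : nat, forall x m, K x -> K (B ^+ m *m x) -> (m <= N)%N.
Proof.
move=> cK Kq; have [->|/set0P K0] := eqVneq K set0; first by exists 0%N.
have wq : {within K, continuous q}.
  exact: continuous_subspaceT seminorm_continuous.
have [a /set_mem Ka aK] := compact_EVT_min K0 cK wq.
have [b _ bK] := compact_EVT_max K0 cK wq.
pose t := lam - 1; have t0 : 0 < t by rewrite subr_gt0.
have qBm m x : (1 + m%:R * t) * q x <= q (B ^+ m *m x).
  elim: m => [|m IH]; first by rewrite mul0r addr0 mul1r mul1mx.
  rewrite exprS -mulmxE -mulmxA (le_trans _ (qB _))//.
  apply: le_trans (ler_wpM2l (ltW (lt_trans ltr01 lam1)) IH).
  rewrite mulrA ler_wpM2r// -natr1 /t.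
  have := mulr_ge0 (ler0n R m) (sqr_ge0 (lam - 1)).
  by nra.
exists (Num.truncn (q b / (q a * t))) => x m Kx Kmx.
rewrite -ltnS -(ltr_nat R); apply: (le_lt_trans _ (truncnS_gt _)).
have qa := Kq _ Ka.
rewrite ler_pdivlMr ?mulr_gt0//.
apply: (@le_trans _ _ ((1 + m%:R * t) * q a)).
  by rewrite mulrDl mul1r mulrAC -mulrA lerDr ltW.
apply: le_trans (bK _ (mem_set Kmx)).
apply: le_trans (qBm m x); rewrite ler_pM2l; first exact: aK (mem_set Kx).
by rewrite ltr_wpDr// mulr_ge0// ltW.
Qed.

(** Two visits are at most N steps apart, so all of them lie in a window of length
2 N around any one of them. *)
Lemma orbit_visits (K : set 'cV[R]_n.+1) : B \in unitmx ->
  compact K -> (forall x, K x -> 0 < q x) ->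
  exists N : nat, forall x, exists j0 : int, forall j : int,
    K (B ^ j *m x) -> (j0 <= j <= j0 + N%:Z)%R.
Proof.
move=> uB cK Kq; have [N NP] := compact_escape cK Kq.
exists (N + N)%N => x.
have NPz (j j' : int) : K (B ^ j *m x) -> K (B ^ j' *m x) -> j' <= j + N%:Z.
  move=> Kj Kj'; have [jj'|] := leP j j'; last first.
    by move=> /ltW/le_trans; apply; rewrite lerDl.
  have : 0 <= j' - j by rewrite subr_ge0.
  case E : (j' - j) => [m|//] _.
  have j'E : j' = m%:Z + j by rewrite -E subrK.
  move: Kj'; rewrite j'E exprzDr// => Km.
  have : (m <= N)%N by apply: (NP _ _ Kj); rewrite mulmxA mulmxE.
  by rewrite addrC lerD2l lez_nat.
have [[j1 Kj1]|nK] := pselect (exists j1 : int, K (B ^ j1 *m x)).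
  exists (j1 - N%:Z) => j Kj; rewrite lerBlDr (NPz _ _ Kj Kj1)/=.
  by rewrite PoszD addrA subrK (NPz _ _ Kj1 Kj).
by exists 0 => j Kj; exfalso; apply: nK; exists j.
Qed.

End seminorm.

(** * Linear change of variables for the Lebesgue measure *)

Section affine_line.
Variable R : realType.
Local Notation mu := (@lebesgue_measure R).

Lemma measurable_affine (a b : R) :
  measurable_fun [set: measurableTypeR R]
    (fun x : measurableTypeR R => a * x + b : measurableTypeR R).
Proof. by apply: measurable_funD => //; exact: measurable_funM. Qed.

(** Both sides are measures of A that agree on half-open intervals; a negative slope
exchanges the two ends. *)
Lemma lebesgue_measure_affine (a b : R) (A : set (measurableTypeR R)) :
  a != 0 -> measurable A ->
  mu ((fun x => a * x + b) @^-1` A) = (`|a|^-1%:E * mu A)%E.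
Proof.
move=> a0 mA.
have na : 0 <= `|a| by [].
pose T (x : measurableTypeR R) : measurableTypeR R := a * x + b.
have mT : measurable_fun setT T by exact: measurable_affine.
have <- : pushforward (mscale (NngNum na) mu) T A = mu A.
  apply/esym/lebesgue_measure_unique => //= _ [[u v]] /= uv <-.
  rewrite /mscale/= /pushforward/=.
  have [a_lt0|a_gt0|] := ltgtP a 0; last by move=> /eqP; rewrite (negbTE a0).
  - have -> : T @^-1` `]u, v] = `[(v - b) / a, (u - b) / a[%classic.
      apply/seteqP; split=> x; rewrite /T /= !in_itv/= => /andP[ux xv].
        by rewrite ler_ndivrMr// ltr_ndivlMr// lerBrDr ltrBlDr mulrC ux xv.
      by move: ux xv; rewrite ler_ndivrMr// ltr_ndivlMr// lerBrDr ltrBlDr mulrC => -> ->.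
    rewrite !lebesgue_measure_itv/= !lte_fin ltr_nM2r ?invr_lt0//.
    rewrite ltrD2r ltr0_norm//; case: ifPn; rewrite ?mule0//.
    rewrite -!EFinD -EFinM => _; congr EFin.
    by field.
  - have -> : T @^-1` `]u, v] = `](u - b) / a, (v - b) / a]%classic.
      apply/seteqP; split=> x; rewrite /T /= !in_itv/= => /andP[ux xv].
        by rewrite ltr_pdivrMr// ler_pdivlMr// ltrBlDr lerBrDr mulrC ux xv.
      by move: ux xv; rewrite ltr_pdivrMr// ler_pdivlMr// ltrBlDr lerBrDr mulrC => -> ->.
    rewrite !lebesgue_measure_itv/= !lte_fin ltr_pM2r ?invr_gt0//.
    rewrite ltrD2r gtr0_norm//; case: ifPn; rewrite ?mule0//.
    rewrite -!EFinD -EFinM => _; congr EFin.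
    by field.
rewrite /pushforward /mscale/= muleA -EFinM mulVf ?mul1e//.
by rewrite normr_eq0.
Qed.

Lemma ge0_integral_affine (a b : R) (f : measurableTypeR R -> \bar R) :
  a != 0 -> measurable_fun setT f -> (forall x, 0 <= f x)%E ->
  (\int[mu]_x f (a * x + b)%R = `|a|^-1%:E * \int[mu]_x f x)%E.
Proof.
move=> a0 mf f0.
have na : 0 <= `|a|^-1 by rewrite invr_ge0.
pose T (x : measurableTypeR R) : measurableTypeR R := a * x + b.
have mT : measurable_fun setT T by exact: measurable_affine.
have := @ge0_integral_pushforward _ _ _ _ _ T mT mu setT f measurableT mf.
rewrite preimage_setT/= => <-; last by move=> x _; exact: f0.
transitivity (\int[mscale (NngNum na) mu]_x f x)%E.
  apply: eq_measure_integral => A mA _; rewrite /pushforward/=.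
  exact: lebesgue_measure_affine.
by rewrite ge0_integral_mscale.
Qed.

End affine_line.

Section cons_integral.
Variables (R : realType) (n : nat).
Local Notation mu := (@lebesgue_measure R).
Local Notation leb := (lebesgue_cV R).
Local Open Scope ereal_scope.

Lemma ge0_integral_cons (f : 'cV[R]_n.+1 -> \bar R) :
  measurable_fun setT f -> (forall x, 0 <= f x) ->
  \int[leb n.+1]_x f x = \int[mu]_x \int[leb n]_v f (cons_cV (x, v)).
Proof.
move=> mf f0.
have mc := @measurable_cons_cV R n.
have := @ge0_integral_pushforward _ _ _ _ _ _ mc (mu \x leb n) setT f measurableT mf.
rewrite preimage_setT/= fubini_tonelli1//; last exact: measurableT_comp.
by move=> <-.
Qed.

Lemma ge0_integral_cons_swap (f : 'cV[R]_n.+1 -> \bar R) :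
  measurable_fun setT f -> (forall x, 0 <= f x) ->
  \int[leb n.+1]_x f x = \int[leb n]_v \int[mu]_x f (cons_cV (x, v)).
Proof.
move=> mf f0.
have mc := @measurable_cons_cV R n.
rewrite ge0_integral_cons// (fubini_tonelli (m1 := mu) (m2 := leb n) (f \o @cons_cV R n))//=.
exact: measurableT_comp.
Qed.

Lemma measurable_integral_tail (f : 'cV[R]_n.+1 -> \bar R) :
  measurable_fun setT f -> (forall x, 0 <= f x) ->
  measurable_fun setT (fun x => \int[leb n]_v f (cons_cV (x, v))).
Proof.
move=> mf f0; have mc := @measurable_cons_cV R n.
apply: (measurable_fun_fubini_tonelli_F (m2 := leb n) (f \o @cons_cV R n)) => //=.
exact: measurableT_comp.
Qed.

Lemma measurable_integral_head (f : 'cV[R]_n.+1 -> \bar R) :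
  measurable_fun setT f -> (forall x, 0 <= f x) ->
  measurable_fun setT (fun v => \int[mu]_x f (cons_cV (x, v))).
Proof.
move=> mf f0; have mc := @measurable_cons_cV R n.
apply: (measurable_fun_fubini_tonelli_G (m1 := mu) (f \o @cons_cV R n)) => //=.
exact: measurableT_comp.
Qed.

End cons_integral.

Section affine_cV.
Variable R : realType.
Local Notation mu := (@lebesgue_measure R).
Local Notation leb := (lebesgue_cV R).

Lemma measurable_mulmxD n m (A : 'M[R]_(m, n)) (b : 'cV[R]_m) :
  measurable_fun [set: 'cV[R]_n] (fun x : 'cV[R]_n => A *m x + b).
Proof.
apply: measurable_fun_coordP => i.
have -> : (fun x : 'cV[R]_n => (A *m x + b) i ord0) =
    (fun x => \sum_j A i j * x j ord0 + b i ord0).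
  by apply/funext => x; rewrite !mxE.
apply: measurable_funD => //; apply: measurable_sum => j.
by apply: measurable_funM => //; exact: measurable_coord.
Qed.

(** The change of variables formula for A, with a translation b so that it can be
proved by induction on the dimension. *)
Definition det_scales n (A : 'M[R]_n) := forall (b : 'cV[R]_n) (f : 'cV[R]_n -> \bar R),
  measurable_fun setT f -> (forall x, 0 <= f x)%E ->
  (\int[leb n]_x f (A *m x + b)%R = `|\det A|^-1%:E * \int[leb n]_x f x)%E.

Lemma det_scalesM n (A B : 'M[R]_n) :
  det_scales A -> det_scales B -> det_scales (A *m B).
Proof.
move=> sA sB b f mf f0.
have mfA : measurable_fun setT (fun x => f (A *m x + b)).
  by apply: (measurableT_comp mf); exact: measurable_mulmxD.
transitivity (\int[leb n]_x f (A *m (B *m x + 0) + b)%R)%E.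
  by apply: eq_integral => x _; rewrite addr0 mulmxA.
rewrite (sB 0 (fun y => f (A *m y + b)))// sA// muleA -EFinM.
by rewrite det_mulmx normrM invfM [in RHS]mulrC.
Qed.

Lemma det_scales_cV0 (A : 'M[R]_0) : det_scales A.
Proof.
move=> b f mf f0; rewrite det_mx00 normr1 invr1 mul1e.
by apply: eq_integral => x _; congr f; apply/colP; case.
Qed.

Lemma mul_block_cons n (A : 'M[R]_(1 + n)) (b : 'cV[R]_(1 + n)) x v :
  A *m (cons_cV (x, v) : 'cV_(1 + n)) + b =
  cons_cV (A ord0 ord0 * x + ((ursubmx A *m v) ord0 ord0 + b ord0 ord0),
    drsubmx A *m v + (x *: dlsubmx A + dsubmx b)).
Proof.
rewrite /cons_cV/= -{1}(submxK A) -{1}(vsubmxK b) mul_block_col add_col_mx.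
congr col_mx.
  apply/rowP => i; rewrite (ord1 i) !mxE eqxx mulr1n !big_ord1 !mxE eqxx mulr1n.
  rewrite addrA; congr (_ * _ + _ + _); first by congr (A _ _); exact/val_inj.
  by congr (b _ _); exact/val_inj.
by rewrite mul_mx_scalar addrA; congr (_ + _); rewrite addrC.
Qed.

(** The head coordinate of A x + b depends on the head of x only: for a fixed head,
the formula in dimension n applies to the tail, which is merely translated. *)
Lemma trig_det_scales n (A : 'M[R]_n) :
  is_trig_mx A -> A \in unitmx -> det_scales A.
Proof.
elim: n A => [A _ _|n IH A tA uA]; first exact: det_scales_cV0.
change 'M[R]_(1 + n) in A.
have ur0 : ursubmx A = 0.
  apply/matrixP => i j; rewrite !mxE; apply: (is_trig_mxP tA).
  by rewrite (ord1 i).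
have tD : is_trig_mx (drsubmx A).
  apply/is_trig_mxP => i j ij; rewrite !mxE.
  by apply: (is_trig_mxP tA); rewrite /= ltn_add2l.
have detA : \det A = A ord0 ord0 * \det (drsubmx A).
  rewrite -{1}(submxK A) ur0 det_lblock det_mx11 !mxE; congr (A _ _ * _); exact/val_inj.
move: uA; rewrite unitmxE detA unitrM !unitfE => /andP[a0 d0] b f mf f0.
have uD : drsubmx A \in unitmx by rewrite unitmxE unitfE.
rewrite ge0_integral_cons//; last first.
  by apply: (measurableT_comp mf); exact: measurable_mulmxD.
under eq_integral => x _ do under eq_integral => v _ do
  rewrite mul_block_cons ur0 mul0mx mxE add0r.
transitivity (\int[mu]_x (`|\det (drsubmx A)|^-1%:E *
    (\int[leb n]_v f (cons_cV ((A ord0 ord0 * x + b ord0 ord0)%R, v)))))%E.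
  apply: eq_integral => x _.
  rewrite (IH _ tD uD _ (fun v => f (cons_cV (A ord0 ord0 * x + b ord0 ord0, v))))//.
  apply: (measurableT_comp mf); apply: (measurableT_comp (@measurable_cons_cV R n)).
  exact: pair1_measurable.
have mI := measurable_integral_tail mf f0.
rewrite ge0_integralZl//; last 2 first.
  exact: (measurableT_comp mI (measurable_affine _ _)).
  by move=> x _; exact: integral_ge0.
rewrite (ge0_integral_affine (b ord0 ord0) a0 mI); last first.
  by move=> x; exact: integral_ge0.
rewrite -ge0_integral_cons// muleA -EFinM detA normrM invfM.
by rewrite [(_^-1 * _)%R]mulrC.
Qed.

(** As for lower triangular matrices, but now the tail of A x + b depends on the
tail of x only, so that the order of integration is exchanged. *)
Lemma trig_tr_det_scales n (A : 'M[R]_n) :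
  is_trig_mx A^T -> A \in unitmx -> det_scales A.
Proof.
elim: n A => [A _ _|n IH A tA uA]; first exact: det_scales_cV0.
change 'M[R]_(1 + n) in A.
have dl0 : dlsubmx A = 0.
  apply/matrixP => i j; rewrite !mxE; have := is_trig_mxP tA.
  move=> /(_ (lshift n j) (rshift 1 i)); rewrite mxE; apply.
  by rewrite (ord1 j).
have tD : is_trig_mx (drsubmx A)^T.
  apply/is_trig_mxP => i j ij; rewrite !mxE.
  have := is_trig_mxP tA => /(_ (rshift 1 i) (rshift 1 j)); rewrite mxE; apply.
  by rewrite /= ltn_add2l.
have detA : \det A = A ord0 ord0 * \det (drsubmx A).
  rewrite -{1}(submxK A) dl0 det_ublock det_mx11 !mxE; congr (A _ _ * _); exact/val_inj.
move: uA; rewrite unitmxE detA unitrM !unitfE => /andP[a0 d0] b f mf f0.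
have uD : drsubmx A \in unitmx by rewrite unitmxE unitfE.
rewrite ge0_integral_cons_swap//; last first.
  by apply: (measurableT_comp mf); exact: measurable_mulmxD.
under eq_integral => x _ do under eq_integral => v _ do
  rewrite mul_block_cons dl0 scaler0 add0r.
transitivity (\int[leb n]_v (`|A ord0 ord0|^-1%:E *
    (\int[mu]_x f (cons_cV (x, (drsubmx A *m v + dsubmx (b : 'cV_(1 + n)))%R)))))%E.
  apply: eq_integral => v _.
  rewrite (@ge0_integral_affine _ _ _
    (fun x => f (cons_cV (x, drsubmx A *m v + dsubmx (b : 'cV_(1 + n))))))//.
  apply: (measurableT_comp mf); apply: (measurableT_comp (@measurable_cons_cV R n)).
  exact: pair2_measurable.
have mI := measurable_integral_head mf f0.
rewrite ge0_integralZl//; last 2 first.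
  exact: (measurableT_comp mI (measurable_mulmxD _ _)).
  by move=> x _; exact: integral_ge0.
rewrite (IH _ tD uD _ _ mI); last first.
  by move=> x; exact: integral_ge0.
by rewrite -ge0_integral_cons_swap// muleA -EFinM detA normrM invfM.
Qed.

Lemma transvection_mulE n m (i j : 'I_n) (c : R) (A : 'M[R]_(n, m)) k l :
  ((1%:M + c *: delta_mx i j) *m A) k l = A k l + (k == i)%:R * (c * A j l).
Proof.
rewrite mulmxDl mul1mx -scalemxAl mxE [in LHS]mxE; congr (_ + _).
rewrite mxE (bigD1 j)//= big1 ?addr0 => [|h hj]; last first.
  by rewrite mxE (negbTE hj) andbF mul0r.
by rewrite mxE eqxx andbT mulrCA.
Qed.

Lemma transvection_det_scales n (i j : 'I_n) (c : R) :
  i != j \/ c != -1 -> det_scales (1%:M + c *: delta_mx i j).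
Proof.
move=> ijc.
have trig (i' j' : 'I_n) : (j' <= i')%N -> is_trig_mx (1%:M + c *: delta_mx i' j').
  move=> ji; apply/is_trig_mxP => k l kl; rewrite !mxE.
  have -> : (k == l) = false by apply/negbTE; rewrite -val_eqE/= ltn_eqF.
  have -> : (k == i') && (l == j') = false.
    apply/negbTE/negP => /andP[/eqP ki /eqP lj].
    by move: kl; rewrite ki lj ltnNge ji.
  by rewrite mulr0 addr0.
have diag k : (1%:M + c *: delta_mx i j) k k = 1 + ((k == i) && (k == j))%:R * c.
  by rewrite !mxE eqxx mulrC.
have nz : \prod_k (1%:M + c *: delta_mx i j) k k != 0 :> R.
  rewrite prodf_seq_neq0; apply/allP => k _ /=; rewrite diag.
  have [/andP[/eqP ki /eqP kj]|_] := boolP ((k == i) && (k == j)); last first.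
    by rewrite mul0r addr0 oner_eq0.
  case: ijc; first by rewrite -ki kj eqxx.
  by rewrite mul1r addrC addr_eq0.
have [ji|/ltnW ij] := leqP j i.
  apply: trig_det_scales; first exact: trig.
  by rewrite unitmxE (det_trig (trig _ _ ji)) unitfE.
have trT : (1%:M + c *: delta_mx i j)^T = 1%:M + c *: delta_mx j i :> 'M[R]_n.
  by rewrite linearD/= linearZ/= trmx1 trmx_delta.
apply: trig_tr_det_scales; rewrite ?trT; first exact: trig.
rewrite -unitmx_tr unitmxE trT (det_trig (trig _ _ ij)) unitfE.
by rewrite -trT; under eq_bigr do rewrite mxE.
Qed.

(** A transposition is not triangular, but it is a product of transvections and of
the change of sign of one coordinate. *)
Lemma tperm_det_scales n (i j : 'I_n) : det_scales (tperm_mx i j : 'M[R]_n).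
Proof.
have [->|ij] := eqVneq i j.
  rewrite /tperm_mx tperm1 perm_mx1; apply: trig_det_scales; last exact: unitmx1.
  exact: scalar_mx_is_trig.
(* on the plane of coordinates i and j,
   (0 1; 1 0) = (1 1; 0 1)(1 0; -1 1)(1 1; 0 1)(-1 0; 0 1) *)
pose T k l c : 'M[R]_n := 1%:M + c *: delta_mx k l.
have -> : tperm_mx i j = T i j 1 *m (T j i (-1) *m (T i j 1 *m (T i i (-2) *m 1%:M))).
  apply/matrixP => k l; rewrite /T !transvection_mulE !mxE.
  have ji : j != i by rewrite eq_sym.
  rewrite !eqxx (negbTE ji).
  case: tpermP => [->|->|/eqP/negbTE -> /eqP/negbTE ->];
    rewrite ?eqxx ?(negbTE ij) ?(negbTE ji) /=; ring.
have ji : j != i by rewrite eq_sym.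
do 3 (apply: det_scalesM; first by apply: transvection_det_scales; left).
apply: det_scalesM; first apply: transvection_det_scales.
  by right; rewrite eqr_opp -subr_eq0 [X in X - 1](_ : 2 = 1 + 1)// addrK oner_eq0.
apply: trig_det_scales; last exact: unitmx1.
exact: scalar_mx_is_trig.
Qed.

Lemma perm_det_scales n (s : 'S_n) : det_scales (perm_mx s : 'M[R]_n).
Proof.
have [ts -> _] := prod_tpermP s; elim: ts => [|t ts IH].
  rewrite big_nil perm_mx1; apply: trig_det_scales; last exact: unitmx1.
  exact: scalar_mx_is_trig.
by rewrite big_cons perm_mxM; apply: det_scalesM IH; exact: tperm_det_scales.
Qed.

(** The formula is multiplicative in A, and A is the product of a permutation
matrix, a lower and an upper triangular matrix. *)
Lemma unitmx_det_scales n (A : 'M[R]_n.+1) : A \in unitmx -> det_scales A.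
Proof.
move=> uA; have := cormen_lup_correct A; have := cormen_lup_perm A.
have := cormen_lup_detL A; have := cormen_lup_lower A; have := cormen_lup_upper A.
case: (cormen_lup A) => -[P L] U /= Uup Llow detL /is_perm_mxP[s ->] PA.
have uL : L \in unitmx by rewrite unitmxE detL unitr1.
have uU : U \in unitmx.
  have : perm_mx s * A \in unitmx by rewrite -mulmxE unitmx_mul unitmx_perm uA.
  by rewrite PA -mulmxE unitmx_mul => /andP[].
have -> : A = perm_mx (s^-1)%g *m (L *m U).
  by rewrite mulmxE -PA -mulmxE mulmxA -perm_mxM mulVg perm_mx1 mul1mx.
apply: det_scalesM; first exact: perm_det_scales.
apply: det_scalesM.
  apply: trig_det_scales uL; apply/is_trig_mxP => i j ij.
  by rewrite Llow ?(ltnW ij)// -val_eqE/= ltn_eqF.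
apply: trig_tr_det_scales uU; apply/is_trig_mxP => i j ij.
by rewrite mxE Uup.
Qed.

End affine_cV.

(** * Lebesgue measure of compact sets and products *)

Section compact_measure.
Variable R : realType.
Local Notation leb := (lebesgue_cV R).

Lemma measurable_box n (a : 'cV[R]_n) (e : R) :
  measurable [set x : 'cV[R]_n | forall i, `|x i ord0 - a i ord0| <= e].
Proof.
have -> : [set x : 'cV[R]_n | forall i, `|x i ord0 - a i ord0| <= e] =
    \big[setI/setT]_i ((fun x : 'cV[R]_n => x i ord0) @^-1`
       `[a i ord0 - e, a i ord0 + e]).
  rewrite -bigcap_seq; apply/seteqP; split=> x /=.
    by move=> xa i _; rewrite /= in_itv/= -ler_distl.
  move=> xa i; have := xa i; rewrite /= mem_index_enum in_itv/= -ler_distl.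
  exact.
apply: bigsetI_measurable => i _; rewrite -[X in measurable X]setTI.
exact: measurable_coord.
Qed.

Lemma lebesgue_box n (a : 'cV[R]_n) (e : R) : 0 < e ->
  (leb n [set x : 'cV[R]_n | forall i, (`|x i ord0 - a i ord0| <= e)%R] =
    ((2 * e) ^+ n)%:E)%E.
Proof.
move=> e0; elim: n a => [a|n IH a] /=.
  by rewrite diracE mem_set ?expr0//; case.
rewrite /cons_measure /pushforward.
pose b : 'cV[R]_n := (head_cV a).2.
rewrite (_ : _ @^-1` _ = `[a ord0 ord0 - e, a ord0 ord0 + e]%classic `*`
    [set x : 'cV[R]_n | forall i, `|x i ord0 - b i ord0| <= e]); last first.
  have h0 (p : measurableTypeR R * 'cV[R]_n) : cons_cV p ord0 ord0 = p.1.
    by rewrite -[in RHS](cons_cVK p).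
  have hS (p : measurableTypeR R * 'cV[R]_n) i : cons_cV p (lift ord0 i) ord0 = p.2 i ord0.
    by rewrite -[in RHS](cons_cVK p) /= mxE.
  apply/seteqP; split=> p /=.
    move=> pa; split; first by rewrite in_itv/= -ler_distl -h0.
    by move=> i; rewrite /b mxE -hS.
  rewrite in_itv/= -ler_distl => -[p1 p2] i.
  case: (unliftP ord0 i) => [j|] ->; last by rewrite h0.
  by rewrite hS; have := p2 j; rewrite /b mxE.
rewrite product_measure1E//; last exact: measurable_box.
rewrite IH /= lebesgue_measure_itv/= lte_fin ltrD2l gtrN// exprS EFinM.
by congr (_ * _)%E; rewrite -EFinD; congr EFin; ring.
Qed.

(** The sigma-algebra is generated by the coordinates, so compact sets have to
be built from cubes: K is the intersection of its covers by finitely many cubes of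
half-width 1 / (m + 1). *)
Lemma compact_measurable_cV n (K : set 'cV[R]_n.+1) : compact K -> measurable K.
Proof.
move=> cK; pose e (m : nat) : R := m.+1%:R^-1.
have e0 m : 0 < e m by rewrite invr_gt0 ltr0n.
have /choice[s sP] : forall m, exists s : seq 'cV[R]_n.+1,
    (forall x, x \in s -> K x) /\ K `<=` \big[setU/set0]_(x <- s) cube x (e m).
  by move=> m; have [s] := compact_cube_cover cK (fun x _ => e0 m); exists s.
have -> : K = \bigcap_m \big[setU/set0]_(x <- s m) cube x (e m).
  apply/seteqP; split=> [x Kx m _|x xs]; first exact: (sP m).2.
  apply: contrapT => nKx.
  have cl : closed K by exact: compact_closed (@norm_hausdorff _ _) cK.
  have : nbhs x (~` K) by apply: open_nbhs_nbhs; split => //; exact: closed_openC.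
  move=> /nbhs_cubeP[d d0 dK].
  have [m _ /(_ m (leqnn m)) md] := near_infty_natSinv_lt (PosNum d0).
  have := xs m Logic.I; rewrite -bigcup_seq => -[y /= ys yx].
  apply: (dK y) ((sP m).1 _ ys) => i.
  by rewrite distrC (le_trans (yx i))// ltW.
apply: bigcap_measurableType => m _; apply: bigsetU_measurable => x _.
exact: measurable_box.
Qed.

Lemma compact_lebesgue_lty n (K : set 'cV[R]_n.+1) :
  compact K -> (leb n.+1 K < +oo)%E.
Proof.
move=> cK; have [s _ Ks] := compact_cube_cover cK (fun x _ => @ltr01 R).
have mc x : measurable (cube x 1 : set 'cV[R]_n.+1) by exact: measurable_box.
apply: (@le_lt_trans _ _ (\sum_(x <- s) leb n.+1 (cube x 1))%E).
  apply: (@le_trans _ _ (leb n.+1 (\big[setU/set0]_(x <- s) cube x 1))).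
    apply: le_measure => //; apply/mem_set; first exact: compact_measurable_cV.
    by apply: bigsetU_measurable => x _.
  elim: {Ks}s => [|x s IH]; first by rewrite !big_nil measure0.
  have ms : measurable (\big[setU/set0]_(x <- s) cube x 1 : set 'cV[R]_n.+1).
    by apply: bigsetU_measurable => y _.
  by rewrite !big_cons (le_trans (measureU2 _ (mc _) ms))// leeD2l.
elim: {Ks}s => [|x s IH]; first by rewrite big_nil ltry.
by rewrite big_cons lte_add_pinfty// lebesgue_box// ltry.
Qed.

Lemma lebesgue_preimage n (A : 'M[R]_n.+1) (b : 'cV[R]_n.+1) (S : set 'cV[R]_n.+1) :
  A \in unitmx -> measurable S ->
  leb n.+1 ((fun x => A *m x + b) @^-1` S) = (`|\det A|^-1%:E * leb n.+1 S)%E.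
Proof.
move=> uA mS; have mi : measurable_fun setT (EFin \o \1_S : 'cV[R]_n.+1 -> \bar R).
  by apply/measurable_EFinP; exact: measurable_indic.
have i0 (x : 'cV[R]_n.+1) : (0 <= (\1_S x : R)%:E)%E.
  by rewrite lee_fin.
have := unitmx_det_scales uA b mi i0.
rewrite [X in _ = (_ * X)%E]integral_indic// setIT => <-.
rewrite -[in LHS](setIT (_ @^-1` _)) -integral_indic//.
rewrite -[X in measurable X]setTI; exact: measurable_mulmxD.
Qed.

Lemma ae_translate n (b : 'cV[R]_n.+1) (P : 'cV[R]_n.+1 -> Prop) :
  {ae leb n.+1, forall x, P x} -> {ae leb n.+1, forall x, P (x + b)}.
Proof.
move=> [N [mN N0 PN]].
exists ((fun x => 1%:M *m x + b) @^-1` N); split.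
- by rewrite -[X in measurable X]setTI; exact: measurable_mulmxD.
- by rewrite lebesgue_preimage ?unitmx1// N0 mule0.
- by move=> x /= nP; rewrite mul1mx; apply: PN.
Qed.

End compact_measure.

Section product_integral.
Variables (R : realType) (n : nat).
Local Notation mu := (@lebesgue_measure R).
Local Notation leb := (lebesgue_cV R).

Variables (u : R -> R) (F : 'cV[R]_n -> R).
Hypotheses (iu : mu.-integrable setT (EFin \o u))
  (iF : (leb n).-integrable setT (EFin \o F)).

Let f (x : 'cV[R]_n.+1) := u (x ord0 ord0) * F (head_cV x).2.

Let mu_ : measurable_fun [set: measurableTypeR R] u.
Proof. by apply/measurable_EFinP; case/integrableP : iu. Qed.

Let mF : measurable_fun setT F.
Proof. by apply/measurable_EFinP; case/integrableP : iF. Qed.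

Let mf : measurable_fun setT f.
Proof.
apply: measurable_funM; first exact: (measurableT_comp mu_ (measurable_coord _)).
apply: (measurableT_comp mF); apply: (measurableT_comp measurable_snd).
exact: measurable_head_cV.
Qed.

Let fE p : f (cons_cV p) = u p.1 * F p.2.
Proof. by rewrite /f -[in RHS](cons_cVK p). Qed.

Let iprod : (mu \x leb n)%E.-integrable setT (EFin \o f \o @cons_cV R n).
Proof.
have mfc : measurable_fun setT (EFin \o f \o @cons_cV R n).
  apply: measurableT_comp (@measurable_cons_cV R n).
  exact/measurable_EFinP.
apply: (integrable12ltyP mu (leb n) mfc).2 => /=.
under eq_integral => x _ do under eq_integral => v _ do rewrite fE/= normrM EFinM.
have iabs : (\int[mu]_x (`|u x|%:E) < +oo)%E by case/integrableP : iu.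
have iabsF : (\int[leb n]_v (`|F v|%:E) < +oo)%E by case/integrableP : iF.
have mau : measurable_fun [set: measurableTypeR R] (fun x => `|u x|%:E).
  by apply/measurable_EFinP; exact: measurableT_comp.
have maF : measurable_fun setT (fun v => `|F v|%:E).
  by apply/measurable_EFinP; exact: measurableT_comp.
under eq_integral => x _ do rewrite ge0_integralZl//.
rewrite ge0_integralZr//; last exact: integral_ge0.
rewrite lte_mul_pinfty// ?integral_ge0//.
by rewrite ge0_fin_numE ?integral_ge0.
Qed.

Lemma integrable_cons : (leb n.+1).-integrable setT (EFin \o f).
Proof.
apply/integrableP; split; first exact/measurable_EFinP.
rewrite ge0_integral_cons//=.
  have := (integrable12ltyP mu (leb n) _).1 iprod; apply.
  apply: measurableT_comp (@measurable_cons_cV R n); exact/measurable_EFinP.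
by apply/measurable_EFinP; exact: measurableT_comp.
Qed.

Lemma Rintegral_cons :
  \int[leb n.+1]_x f x = (\int[mu]_x u x) * (\int[leb n]_v F v).
Proof.
rewrite /Rintegral.
have -> : (\int[leb n.+1]_x (f x)%:E = \int[mu \x leb n]_p (f (cons_cV p))%:E)%E.
  have := @integral_pushforward _ _ _ _ _ _ (@measurable_cons_cV R n) (mu \x leb n)%E
    setT (EFin \o f) _ _ measurableT.
  rewrite preimage_setT => <- //; exact/measurable_EFinP.
rewrite -(integral12_prod_meas1 iprod) /fubini_F.
have Ff : (\int[leb n]_v (F v)%:E)%E \is a fin_num by exact: integrable_fin_num.
have uf : (\int[mu]_v (u v)%:E)%E \is a fin_num by exact: integrable_fin_num.
set I : R := fine (\int[leb n]_v (F v)%:E)%E.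
have -> : (\int[mu]_x \int[leb n]_v ((EFin \o f \o @cons_cV R n) (x, v)) =
    \int[mu]_x (I%:E * (u x)%:E))%E.
  apply: eq_integral => x _ /=.
  under eq_integral do rewrite fE/= EFinM.
  by rewrite integralZl// muleC /I fineK.
by rewrite integralZl// -[X in (_ * X)%E]fineK//= mulrC.
Qed.

End product_integral.

(** * The tent as a Fourier transform on the line *)

Section bump.
Variable R : realType.
Local Notation mu := (@lebesgue_measure R).
Implicit Types a b d x : R.

Definition bump a x : R := (1 - cos (a * x)) / x ^+ 2.

Lemma bump_ge0 a x : 0 <= bump a x.
Proof. by rewrite divr_ge0 ?sqr_ge0// subr_ge0 cos_le1. Qed.

Lemma bump0 x : bump 0 x = 0.
Proof. by rewrite /bump mul0r cos0 subrr mul0r. Qed.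

(** This scaling is what makes the integral of the bump proportional to |a|. *)
Lemma bumpZ a x : bump a x = a ^+ 2 * bump 1 (a * x).
Proof.
have [->|a0] := eqVneq a 0; first by rewrite bump0 expr0n mul0r.
rewrite /bump mul1r exprMn [(a ^+ 2 * _)^-1]invfM [RHS]mulrCA.
by rewrite mulVKf// expf_neq0.
Qed.

Lemma sin_sqr_le x : sin x ^+ 2 <= x ^+ 2.
Proof.
wlog x0 : x / 0 <= x.
  move=> h; have [/h//|/ltW x0] := leP 0 x.
  by have := h (- x); rewrite sinN !sqrrN oppr_ge0; exact.
have [|c _] := @MVT_segment R sin cos 0 x x0.
  by apply: continuous_subspaceT; exact: continuous_sin.
by rewrite sin0 !subr0 => ->; rewrite exprMn ler_piMl ?sqr_ge0//.
Qed.

(** From 1 - cos x = 2 sin^2 (x / 2), the bump is at most 2 / x^2 and at most 1 / 2;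
a multiple of the derivative of the arctangent dominates it. *)
Lemma bump_le_oneDsqr x : bump 1 x <= 4 * (oneDsqr x)^-1.
Proof.
have o0 : 0 < oneDsqr x by rewrite (lt_le_trans ltr01)// oneDsqr_ge1.
have [->|x0] := eqVneq x 0.
  by rewrite /bump expr0n invr0 mulr0 mulr_ge0// invr_ge0 ltW.
rewrite ler_pdivlMr// /bump mul1r mulrAC ler_pdivrMr ?exprn_even_gt0//.
have c2 : 1 - cos x = 2 * sin (x / 2) ^+ 2.
  have {1}-> : x = (x / 2) *+ 2 by rewrite -mulr_natr divfK.
  by rewrite cos_mulr2n -mulr_natl; have := cos2Dsin2 (x / 2); lra.
have s1 : sin (x / 2) ^+ 2 <= 1.
  by have := cos2Dsin2 (x / 2); have := sqr_ge0 (cos (x / 2)); lra.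
have s2 := sin_sqr_le (x / 2).
rewrite c2 /oneDsqr.
have := mulr_ge0 (sqr_ge0 x) (sqr_ge0 (sin (x / 2))).
have : 0 <= (1 - sin (x / 2) ^+ 2) * x ^+ 2 by rewrite mulr_ge0 ?sqr_ge0// subr_ge0.
move: s2; rewrite exprMn exprVn.
set s := sin _ ^+ 2; set y := x ^+ 2; lra.
Qed.

Lemma measurable_bump a : measurable_fun [set: measurableTypeR R] (bump a).
Proof.
have -> : bump a = (fun x => (1 - cos (a * x)) * powR (x ^+ 2) (-1)).
  by apply/funext => x; rewrite /bump powR_inv1// sqr_ge0.
apply: measurable_funM.
  apply: measurable_funB => //.
  apply: (@measurableT_comp _ _ _ _ _ _ (@cos R)).
    by apply: continuous_measurable_fun; exact: continuous_cos.
  exact: measurable_funM.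
apply: (@measurableT_comp _ _ _ _ _ _ (fun y : R => y `^ (-1))).
  exact: measurable_powR.
exact: exprn_measurable.
Qed.

Lemma integral_oneDsqr : (\int[mu]_x ((oneDsqr x)^-1)%:E = pi%:E)%E.
Proof.
rewrite ge0_symfun_integralT.
- have -> : [set x : R | 0 <= x] = `[0, +oo[%classic by rewrite set_itvE.
  by rewrite integral0y_oneDsqr -EFinM mulrC divfK.
- by move=> x; rewrite invr_ge0 (le_trans ler01)// oneDsqr_ge1.
- exact: continuous_oneDsqrV.
- by move=> x; rewrite /= /oneDsqr sqrrN.
Qed.

Lemma integrable_bump1 : mu.-integrable setT (EFin \o bump 1).
Proof.
have mo : measurable_fun [set: measurableTypeR R] (fun x => (oneDsqr x)^-1 : R).
  by apply: continuous_measurable_fun; exact: continuous_oneDsqrV.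
have o0 x : 0 <= (oneDsqr x)^-1 :> R.
  by rewrite invr_ge0 (le_trans ler01)// oneDsqr_ge1.
apply: (@le_integrable _ _ _ mu setT measurableT _ (fun x => (4 * (oneDsqr x)^-1)%:E)).
- by apply/measurable_EFinP; exact: measurable_bump.
- move=> x _ /=; rewrite lee_fin (ger0_norm (bump_ge0 _ _)) ger0_norm ?mulr_ge0//.
  exact: bump_le_oneDsqr.
under eq_fun do rewrite EFinM.
apply: integrableZl => //; apply/integrableP; split.
  exact/measurable_EFinP.
under eq_integral do rewrite gee0_abs ?lee_fin//.
by rewrite integral_oneDsqr ltry.
Qed.

(** The constant (in fact, pi) by which the kernel of the tent is normalized. *)
Definition bump_mass : R := \int[mu]_x bump 1 x.

(** Between pi / 2 and pi the cosine is nonpositive, so the bump is at least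
pi^-2 there. *)
Lemma bump_mass_gt0 : 0 < bump_mass.
Proof.
have pi0 := pi_gt0 R.
have I : (0 < \int[mu]_x (bump 1 x)%:E)%E.
  apply: (@lt_le_trans _ _ (\int[mu]_(x in `[(pi / 2)%R, pi]) ((pi ^- 2)%:E))%E).
    rewrite integral_cst//= lebesgue_measure_itv/= lte_fin.
    have -> : (pi / 2 < pi :> R) by rewrite ltr_pdivrMr// ltr_pMr// ltr1n.
    rewrite -EFinD mule_gt0// lte_fin ?invr_gt0 ?exprn_gt0//.
    by rewrite subr_gt0 ltr_pdivrMr// ltr_pMr// ltr1n.
  apply: (@le_trans _ _ (\int[mu]_(x in `[(pi / 2)%R, pi]) (bump 1 x)%:E)%E).
    apply: ge0_le_integral => //=.
    - by move=> x _; rewrite lee_fin invr_ge0 exprn_ge0// ltW.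
    - by apply/measurable_EFinP; apply: measurable_funTS; exact: measurable_bump.
    - move=> x; rewrite in_itv/= => /andP[x1 x2]; rewrite lee_fin /bump mul1r.
      have x0 : 0 < x by rewrite (lt_le_trans _ x1)// divr_gt0.
      have cx : cos x <= 0.
        rewrite -[x](subrK (pi / 2)) cosDpihalf oppr_le0 sin_ge0_pi//.
        by rewrite subr_ge0 x1/= lerBlDr (le_trans x2)// lerDl divr_ge0// ltW.
      rewrite ler_pdivlMr ?exprn_gt0// mulrC ler_pdivrMr ?exprn_gt0//.
      apply: (@le_trans _ _ (1 * pi ^+ 2)).
        by rewrite mul1r lerXn2r// nnegrE ltW.
      by rewrite ler_wpM2r ?sqr_ge0// lerBrDr gerDl.
  apply: ge0_subset_integral => //=.
  - by apply/measurable_EFinP; exact: measurable_bump.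
  - by move=> x _; rewrite lee_fin bump_ge0.
rewrite /bump_mass /Rintegral fine_gt0// I/=.
have /integrableP[_] := integrable_bump1.
by under eq_integral do rewrite gee0_abs ?lee_fin ?bump_ge0//.
Qed.

Lemma ge0_integral_bump a :
  (\int[mu]_x (bump a x)%:E = (`|a| * bump_mass)%:E)%E.
Proof.
have [->|a0] := eqVneq a 0.
  by under eq_integral do rewrite bump0; rewrite integral0 normr0 mul0r.
under eq_integral do rewrite bumpZ EFinM -(addr0 (a * _)).
have mb : measurable_fun [set: measurableTypeR R] (EFin \o bump 1).
  by apply/measurable_EFinP; exact: measurable_bump.
rewrite ge0_integralZl//; last 3 first.
- exact: (measurableT_comp mb (measurable_affine _ _)).
- by move=> x _; rewrite lee_fin bump_ge0.
- by rewrite lee_fin sqr_ge0.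
rewrite (ge0_integral_affine 0 a0 mb) => [|x]; last by rewrite lee_fin bump_ge0.
rewrite muleA -EFinM -[a ^+ 2]real_normK ?num_real// expr2 mulfK ?normr_eq0//.
rewrite EFinM; congr (_ * _)%E; rewrite /bump_mass /Rintegral fineK//.
by apply: integrable_fin_num => //; exact: integrable_bump1.
Qed.

Lemma integrable_bump a : mu.-integrable setT (EFin \o bump a).
Proof.
apply/integrableP; split; first by apply/measurable_EFinP; exact: measurable_bump.
under eq_integral do rewrite gee0_abs ?lee_fin ?bump_ge0//.
by rewrite ge0_integral_bump ltry.
Qed.

Lemma Rintegral_bump a : \int[mu]_x bump a x = `|a| * bump_mass.
Proof. by rewrite /Rintegral ge0_integral_bump. Qed.

(** The product formula for cosines.  It expresses the cosine transform of a bump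
by integrals of bumps. *)
Lemma bumpM_cos a b x : bump a x * cos (b * x) =
  2^-1 * (bump (a + b) x + bump (a - b) x) - bump b x.
Proof.
rewrite /bump (mulrDl a b x) (mulrBl x a b) !cosD cosN sinN.
by set v := (x ^+ 2)^-1; field.
Qed.

Lemma Rintegral_odd (f : R -> R) : mu.-integrable setT (EFin \o f) ->
  (forall x, f (- x) = - f x) -> \int[mu]_x f x = 0.
Proof.
move=> fi fodd; rewrite /Rintegral integralE.
have mf : measurable_fun [set: measurableTypeR R] (EFin \o f).
  by have /integrableP[] := fi.
have -> : (\int[mu]_x (EFin \o f)^\- x = \int[mu]_x (EFin \o f)^\+ x)%E.
  transitivity (\int[mu]_x (EFin \o f)^\+ (-1 * x + 0)%R)%E.
    apply: eq_integral => x _; rewrite addr0 mulN1r.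
    by rewrite funeposE funenegE /= fodd.
  rewrite (ge0_integral_affine 0 _ (measurable_funepos mf)).
  - by rewrite normrN1 invr1 mul1e.
  - by rewrite oppr_eq0 oner_eq0.
  - by move=> x; exact: funepos_ge0.
rewrite subee// integrable_pos_fin_num//.
Qed.

End bump.

Lemma integrableM_bounded1 (R : realType) d (T : measurableType d)
    (m : {measure set T -> \bar R}) (f g : T -> R) :
  m.-integrable setT (EFin \o f) -> measurable_fun setT g ->
  (forall x, `|g x| <= 1) -> m.-integrable setT (fun x => (f x * g x)%:E).
Proof.
move=> fi mg g1.
have mf : measurable_fun setT f by apply/measurable_EFinP; case/integrableP : fi.
apply: le_integrable fi => //.
  by apply/measurable_EFinP; exact: measurable_funM.
by move=> x _ /=; rewrite lee_fin normrM ler_piMr.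
Qed.

Section tent_kernel.
Variable R : realType.
Local Notation mu := (@lebesgue_measure R).
Implicit Types a b d x : R.

Definition tent d b : R := Num.max 0 (d - `|b|).

Definition tent_kernel d x : R := bump (2 * pi * d) x / (2 * pi * bump_mass R).

Let c_gt0 : 0 < 2 * pi * bump_mass R.
Proof. by rewrite !mulr_gt0 ?pi_gt0 ?bump_mass_gt0. Qed.

Lemma tent_ge0 d b : 0 <= tent d b.
Proof. by rewrite le_max lexx. Qed.

Lemma tent_le d b : 0 <= d -> tent d b <= d.
Proof. by move=> d0; rewrite ge_max d0 lerBlDr lerDl normr_ge0. Qed.

Lemma tent_eq0 d b : d <= `|b| -> tent d b = 0.
Proof. by move=> db; apply/max_idPl; rewrite subr_le0. Qed.

Lemma le_tent d b : d - `|b| <= tent d b.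
Proof. by rewrite le_max lexx orbT. Qed.

Lemma tent_kernel_ge0 d x : 0 <= tent_kernel d x.
Proof. by rewrite divr_ge0 ?bump_ge0 ?ltW. Qed.

Lemma tent_kernel_bounded d : exists2 C, 0 < C & forall x, tent_kernel d x <= C.
Proof.
exists (1 + (2 * pi * d) ^+ 2 * 4 / (2 * pi * bump_mass R)) => [|x].
  by rewrite ltr_wpDr// divr_ge0 ?(ltW c_gt0)// mulr_ge0 ?sqr_ge0.
rewrite ler_wpDl// ler_pM2r ?invr_gt0// bumpZ ler_wpM2l ?sqr_ge0//.
rewrite (le_trans (bump_le_oneDsqr _))// ler_piMr//.
exact: oneDsqrV_le1.
Qed.

Lemma measurable_tent_kernel d :
  measurable_fun [set: measurableTypeR R] (tent_kernel d).
Proof. by apply: measurable_funM => //; exact: measurable_bump. Qed.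

Lemma integrable_tent_kernel d : mu.-integrable setT (EFin \o tent_kernel d).
Proof.
have -> : EFin \o tent_kernel d =
    fun x => ((2 * pi * bump_mass R)^-1%:E * (bump (2 * pi * d) x)%:E)%E.
  by apply/funext => x; rewrite -EFinM mulrC.
exact: integrableZl (integrable_bump _).
Qed.

Lemma measurable_cosM b : measurable_fun [set: measurableTypeR R] (fun x => cos (b * x)).
Proof.
apply: (@measurableT_comp _ _ _ _ _ _ (@cos R)); last exact: measurable_funM.
by apply: continuous_measurable_fun; exact: continuous_cos.
Qed.

Lemma measurable_sinM b : measurable_fun [set: measurableTypeR R] (fun x => sin (b * x)).
Proof.
apply: (@measurableT_comp _ _ _ _ _ _ (@sin R)); last exact: measurable_funM.
by apply: continuous_measurable_fun; exact: continuous_sin.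
Qed.

Lemma norm_cos_le1 x : `|cos x| <= 1.
Proof. by rewrite ler_norml cos_geN1 cos_le1. Qed.

Lemma norm_sin_le1 x : `|sin x| <= 1.
Proof. by rewrite ler_norml sin_geN1 sin_le1. Qed.

Lemma integrable_tent_kernel_cos d b :
  mu.-integrable setT (fun x => (tent_kernel d x * cos (b * x))%:E).
Proof.
apply: integrableM_bounded1 => [||x]; [exact: integrable_tent_kernel| |].
  exact: measurable_cosM.
exact: norm_cos_le1.
Qed.

Lemma integrable_tent_kernel_sin d b :
  mu.-integrable setT (fun x => (tent_kernel d x * sin (b * x))%:E).
Proof.
apply: integrableM_bounded1 => [||x]; [exact: integrable_tent_kernel| |].
  exact: measurable_sinM.
exact: norm_sin_le1.
Qed.

(** By the product formula and the scaling of the bump integral, the transform is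
(|d + b| + |d - b|) / 2 - |b|, which is a tent. *)
Lemma Rintegral_tent_kernel_cos d b : 0 <= d ->
  \int[mu]_x (tent_kernel d x * cos (2 * pi * b * x)) = tent d b.
Proof.
move=> d0; set al := 2 * pi * d; set be := 2 * pi * b; set c := 2 * pi * bump_mass R.
have bI a : mu.-integrable setT (EFin \o bump a) by exact: integrable_bump.
have bDI : mu.-integrable setT
    (EFin \o (fun x => bump (al + be) x + bump (al - be) x)).
  by rewrite (_ : _ \o _ = (EFin \o bump (al + be)) \+ (EFin \o bump (al - be)))%E//;
    apply: integrableD.
transitivity (\int[mu]_x (c^-1 * (2^-1 * (bump (al + be) x + bump (al - be) x) - bump be x))).
  by apply: eq_Rintegral => x _; rewrite -bumpM_cos /tent_kernel -/c mulrAC mulrC.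
have bDI2 : mu.-integrable setT
    (EFin \o (fun x => 2^-1 * (bump (al + be) x + bump (al - be) x))).
  by rewrite (_ : _ \o _ = fun x => (2^-1%:E * (bump (al + be) x + bump (al - be) x)%:E))%E//;
    apply: integrableZl.
rewrite RintegralZl//; last first.
  by have := integrableB measurableT bDI2 (bI be).
rewrite RintegralB// RintegralZl// RintegralD// !Rintegral_bump.
rewrite -mulrDl mulrA -mulrBl mulrCA mulrA.
have -> : 2^-1 * (`|al + be| + `|al - be|) - `|be| =
    2 * pi * (2^-1 * (`|d + b| + `|d - b|) - `|b|).
  have p0 : 0 <= 2 * pi :> R by rewrite mulr_ge0// pi_ge0.
  have np (y : R) : `|2 * pi * y| = 2 * pi * `|y| by rewrite normrM ger0_norm.
  rewrite /al /be -mulrDr -mulrBr !np.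
  by ring.
have -> y : 2 * pi * y / c * bump_mass R = y.
  have m0 : bump_mass R != 0 by rewrite gt_eqF ?bump_mass_gt0.
  have pi0 : pi != 0 :> R by rewrite gt_eqF ?pi_gt0.
  rewrite /c; move: (bump_mass R) (pi : R) m0 pi0 => m p m0 p0.
  by field; rewrite m0 p0.
rewrite /tent; have [db|bd] := leP d `|b|.
  rewrite (max_idPl _) ?subr_le0//.
  have [b0|b0] := ger0P b; move: db.
    by rewrite ger0_norm// => db; rewrite ger0_norm ?addr_ge0// ler0_norm ?subr_le0//; field.
  by rewrite ltr0_norm// => db; rewrite ler0_norm ?ger0_norm; [field|lra|lra].
rewrite (max_idPr _) ?subr_ge0 ?(ltW bd)//.
move: bd; rewrite ltr_norml => /andP[b1 b2].
have h1 : 0 <= d + b by lra.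
have h2 : 0 <= d - b by lra.
by rewrite (ger0_norm h1) (ger0_norm h2); field.
Qed.

Lemma Rintegral_tent_kernel_sin d b :
  \int[mu]_x (tent_kernel d x * sin (b * x)) = 0.
Proof.
apply: Rintegral_odd; first exact: integrable_tent_kernel_sin.
by move=> x; rewrite mulrN sinN mulrN /tent_kernel /bump mulrN cosN sqrrN.
Qed.

End tent_kernel.

(** * Norms of complex functions and transforms of dilates *)

Section complex_Lp.
Variables (R : realType) (n : nat).
Local Notation leb := (lebesgue_cV R n).
Implicit Types f g : 'cV[R]_n -> R[i].

Lemma normc_sqr (z : R[i]) :
  normc z ^+ 2 = complex.Re z ^+ 2 + complex.Im z ^+ 2.
Proof. by case: z => a b; rewrite /normc sqr_sqrtr// addr_ge0 ?sqr_ge0. Qed.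

Lemma measurable_normc f : cmeasurable f ->
  measurable_fun setT (fun x => normc (f x)).
Proof.
move=> [mre mim].
have -> : (fun x => normc (f x)) =
    Num.sqrt \o (fun x => complex.Re (f x) ^+ 2 + complex.Im (f x) ^+ 2).
  by apply/funext => x /=; case: (f x).
apply: measurableT_comp; last first.
  by apply: measurable_funD; exact: measurable_funX.
by apply: continuous_measurable_fun; exact: sqrt_continuous.
Qed.

Lemma measurable_normc_sqr f : cmeasurable f ->
  measurable_fun setT (fun x => (normc (f x) ^+ 2)%:E).
Proof.
move=> mf; apply/measurable_EFinP; apply: measurable_funX.
exact: measurable_normc.
Qed.

Lemma cLnorm2E f :
  cLnorm 2%:E f = sqrte (\int[leb]_x (normc (f x) ^+ 2)%:E)%E.
Proof.
rewrite /cLnorm unlock poweR12_sqrt; last by apply: integral_ge0 => x _; exact: poweR_ge0.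
congr sqrte; apply: eq_integral => x _.
by rewrite /= ger0_norm ?normc_ge0// powR_mulrn ?normc_ge0.
Qed.

Lemma inL2P f : cmeasurable f ->
  inLp 2%:E f <-> (\int[leb]_x (normc (f x) ^+ 2)%:E < +oo)%E.
Proof.
move=> mf; have i0 : (0 <= \int[leb]_x (normc (f x) ^+ 2)%:E)%E.
  by apply: integral_ge0 => x _; rewrite lee_fin sqr_ge0.
rewrite /inLp cLnorm2E; split=> [[_]|fi].
  by case: (\int[leb]_x _)%E i0 => [r| |]//= _; rewrite ?ltry.
by split=> //; move: fi i0; case: (\int[leb]_x _)%E => [r| |]//= _; rewrite ?ltry.
Qed.

Lemma inL1P f : cmeasurable f ->
  inLp 1%:E f <-> (\int[leb]_x (normc (f x))%:E < +oo)%E.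
Proof.
move=> mf; rewrite /inLp /cLnorm Lnorm1.
under eq_integral do rewrite gee0_abs ?lee_fin ?normc_ge0//.
by split=> [[]|].
Qed.

Lemma inLpy_bounded f C : cmeasurable f -> (forall x, normc (f x) <= C) ->
  inLp +oo%E f.
Proof.
move=> mf fC; split=> //; rewrite /cLnorm unlock; case: ifP => _; last by rewrite ltry.
apply: (@le_lt_trans _ _ C%:E); last by rewrite ltry.
apply/ess_supP; apply/nearW => x /=.
by rewrite lee_fin ger0_norm ?normc_ge0.
Qed.

Lemma inLpy_ae_bounded f : inLp +oo%E f ->
  exists2 C, 0 <= C & {ae leb, forall x, normc (f x) <= C}.
Proof.
move=> [mf]; rewrite /cLnorm unlock; case: ifPn => [mu0 fy|mu0 _]; last first.
  exists 0 => //; exists setT; split=> //.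
  by apply/eqP; rewrite eq_le measure_ge0 andbT leNgt.
have := ess_sup_ge leb (abse \o (fun x => (normc (f x))%:E)).
case: (ess_sup _ _) fy => [r| |]//= _ fr; last first.
  by exists 0 => //; apply: filterS fr => x; rewrite leeNy_eq.
exists (Num.max 0 r); first by rewrite le_max lexx.
by apply: filterS fr => x; rewrite lee_fin ger0_norm ?normc_ge0// le_max orbC => ->.
Qed.

Lemma cLnorm2_cvg0 (g : nat -> 'cV[R]_n -> R[i]) (c : R) : 0 <= c ->
  (forall k, \int[leb]_x (normc (g k x) ^+ 2)%:E <= (c / 2 ^+ k)%:E)%E ->
  (fun k => cLnorm 2%:E (g k)) @ \oo --> 0%E.
Proof.
move=> c0 gc.
have cvs : (fun k => (Num.sqrt (c / 2 ^+ k))%:E : \bar R) @ \oo --> 0%E.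
  rewrite -[0%E]/(EFin 0); apply: cvg_EFin; first exact: nearW.
  rewrite -[in X in _ --> X](@sqrtr0 R).
  apply: (@continuous_cvg _ _ _ _ _ _ Num.sqrt); first exact: sqrt_continuous.
  rewrite -(mulr0 c); apply: cvgMr.
  under eq_fun do rewrite -exprVn.
  by apply: cvg_expr; rewrite ger0_norm ?invr_ge0// invf_lt1// ltr1n.
apply: (@squeeze_cvge _ _ _ _ (cst 0%E) _
  (fun k => (Num.sqrt (c / 2 ^+ k))%:E : \bar R)) => //; last exact: cvg_cst.
apply: nearW => k /=; rewrite /cLnorm Lnorm_ge0/= -/(cLnorm _ _) cLnorm2E.
have i0 : (0 <= \int[leb]_x (normc (g k x) ^+ 2)%:E)%E.
  by apply: integral_ge0 => x _; rewrite lee_fin sqr_ge0.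
move: (gc k) i0; case: (\int[leb]_x _)%E => [r| |]//=.
by rewrite !lee_fin => rc r0; rewrite ler_sqrt// (le_trans r0).
Qed.

End complex_Lp.

Section fourier_dilation.
Variables (R : realType) (n : nat).
Local Notation leb := (lebesgue_cV R n.+1).
Implicit Types (A : 'M[R]_n.+1) (f : 'cV[R]_n.+1 -> R[i]).

Lemma Rintegral_linear A (g : 'cV[R]_n.+1 -> R) : A \in unitmx ->
  measurable_fun setT g -> leb.-integrable setT (EFin \o g) ->
  \int[leb]_x g (A *m x) = `|\det A|^-1 * \int[leb]_x g x.
Proof.
move=> uA mg gi; rewrite /Rintegral.
have meg : measurable_fun setT (EFin \o g) by exact/measurable_EFinP.
have pI : (\int[leb]_x (EFin \o g)^\+ x)%E \is a fin_num.
  exact: integrable_pos_fin_num.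
have nI : (\int[leb]_x (EFin \o g)^\- x)%E \is a fin_num.
  exact: integrable_neg_fin_num.
rewrite [in LHS]integralE [in RHS]integralE.
have ip : (\int[leb]_x (fun x => (g (A *m x))%:E)^\+ x =
   `|\det A|^-1%:E * \int[leb]_x (EFin \o g)^\+ x)%E.
  rewrite -(unitmx_det_scales uA 0 (measurable_funepos meg)); last first.
    by move=> x; exact: funepos_ge0.
  by apply: eq_integral => x _; rewrite addr0 !funeposE.
have im : (\int[leb]_x (fun x => (g (A *m x))%:E)^\- x =
   `|\det A|^-1%:E * \int[leb]_x (EFin \o g)^\- x)%E.
  rewrite -(unitmx_det_scales uA 0 (measurable_funeneg meg)); last first.
    by move=> x; exact: funeneg_ge0.
  by apply: eq_integral => x _; rewrite addr0 !funenegE.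
rewrite ip im -muleBr//; last by rewrite fin_num_adde_defr.
by rewrite fineM// fin_numB pI nI.
Qed.

Lemma dotp_mulmx A (x y : 'cV[R]_n.+1) : dotp x (A *m y) = dotp (A^T *m x) y.
Proof.
have dE u v : dotp u v = (u^T *m v) ord0 ord0 :> R.
  by rewrite mxE; apply: eq_bigr => i _; rewrite mxE.
by rewrite !dE trmx_mul trmxK mulmxA.
Qed.

Lemma dotpDl (x y z : 'cV[R]_n.+1) : dotp (x + y) z = dotp x z + dotp y z.
Proof. by rewrite /dotp -big_split; apply: eq_bigr => i _; rewrite mxE mulrDl. Qed.

Lemma dotpNl (x z : 'cV[R]_n.+1) : dotp (- x) z = - dotp x z.
Proof. by rewrite /dotp -sumrN; apply: eq_bigr => i _; rewrite mxE mulNr. Qed.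

Lemma measurable_dotp (x : 'cV[R]_n.+1) : measurable_fun setT (dotp x).
Proof.
apply: measurable_sum => i; apply: measurable_funM => //.
exact: measurable_coord.
Qed.

Lemma measurable_cos_dotp (x : 'cV[R]_n.+1) (c : R) :
  measurable_fun setT (fun y => cos (c * dotp x y)).
Proof.
exact: (measurableT_comp (measurable_cosM c) (measurable_dotp x)).
Qed.

Lemma measurable_sin_dotp (x : 'cV[R]_n.+1) (c : R) :
  measurable_fun setT (fun y => sin (c * dotp x y)).
Proof.
exact: (measurableT_comp (measurable_sinM c) (measurable_dotp x)).
Qed.

Lemma complex_ReM (z w : R[i]) : complex.Re (z * w) =
  complex.Re z * complex.Re w - complex.Im z * complex.Im w.
Proof. by case: z w => a b [c d]. Qed.

Lemma complex_ImM (z w : R[i]) : complex.Im (z * w) =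
  complex.Re z * complex.Im w + complex.Im z * complex.Re w.
Proof. by case: z w => a b [c d]. Qed.

Lemma expiD (s t : R) : expi (s + t) = expi s * expi t.
Proof.
rewrite /expi cosD sinD; apply/eqP; rewrite eq_complex complex_ReM complex_ImM /= eqxx.
by rewrite addrC eqxx.
Qed.

Lemma normc_expi (t : R) : normc (expi t) = 1.
Proof. by rewrite /expi /normc cos2Dsin2 sqrtr1. Qed.

Lemma Re_le_normc (z : R[i]) : `|complex.Re z| <= normc z.
Proof.
case: z => a b /=; rewrite -sqrtr_sqr ler_sqrt ?lerDl ?sqr_ge0//.
by rewrite addr_ge0 ?sqr_ge0.
Qed.

Lemma Im_le_normc (z : R[i]) : `|complex.Im z| <= normc z.
Proof.
case: z => a b /=; rewrite -sqrtr_sqr ler_sqrt ?lerDr ?sqr_ge0//.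
by rewrite addr_ge0 ?sqr_ge0.
Qed.

Lemma cmeasurableM_expi f (xi : 'cV[R]_n.+1) : cmeasurable f ->
  cmeasurable (fun x => f x * expi (- (2 * pi * dotp xi x))).
Proof.
move=> [mre mim].
have mc := measurable_cos_dotp xi (- (2 * pi)).
have ms := measurable_sin_dotp xi (- (2 * pi)).
split.
  under eq_fun do rewrite complex_ReM/= -mulNr.
  by apply: measurable_funB; apply: measurable_funM.
under eq_fun do rewrite complex_ImM/= -mulNr.
by apply: measurable_funD; apply: measurable_funM.
Qed.

Lemma integrable_Re_Im f : inLp 1%:E f ->
  leb.-integrable setT (EFin \o (fun x => complex.Re (f x))) /\
  leb.-integrable setT (EFin \o (fun x => complex.Im (f x))).
Proof.
move=> /[dup] -[mf _] /(inL1P mf) fi.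
have ni : leb.-integrable setT (fun x => (normc (f x))%:E).
  apply/integrableP; split; first by apply/measurable_EFinP; exact: measurable_normc.
  by under eq_integral do rewrite gee0_abs ?lee_fin ?normc_ge0//.
case: (mf) => mre mim; split; apply: le_integrable ni => //.
- exact/measurable_EFinP.
- by move=> x _ /=; rewrite lee_fin (ger0_norm (normc_ge0 _)) Re_le_normc.
- exact/measurable_EFinP.
- by move=> x _ /=; rewrite lee_fin (ger0_norm (normc_ge0 _)) Im_le_normc.
Qed.

(** The transform of x |-> |det A| f (A^T x) is the transform of f composed with the
inverse of A, without any factor. *)
Definition dilate A f (x : 'cV[R]_n.+1) : R[i] := `|\det A|%:C * f (A^T *m x).

Lemma cmeasurable_linear A f : cmeasurable f ->
  cmeasurable (fun x => f (A *m x)).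
Proof.
have mA : measurable_fun setT (fun x : 'cV[R]_n.+1 => A *m x).
  by have := measurable_mulmxD A 0; under eq_fun do rewrite addr0.
move=> [mre mim]; split; first exact: (measurableT_comp mre mA).
exact: (measurableT_comp mim mA).
Qed.

Lemma cmeasurableZ (r : R) f : cmeasurable f -> cmeasurable (fun x => r%:C * f x).
Proof.
move=> [mre mim]; split.
  by under eq_fun do rewrite complex_ReM/= mul0r subr0; exact: measurable_funM.
by under eq_fun do rewrite complex_ImM/= mul0r addr0; exact: measurable_funM.
Qed.

Lemma cmeasurable_dilate A f : cmeasurable f -> cmeasurable (dilate A f).
Proof. by move=> mf; apply: cmeasurableZ; exact: cmeasurable_linear. Qed.

Lemma normc_real (r : R) : normc r%:C = `|r|.
Proof. by rewrite /normc/= expr0n addr0 sqrtr_sqr. Qed.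

Lemma ge0_integral_linear A (g : 'cV[R]_n.+1 -> \bar R) : A \in unitmx ->
  measurable_fun setT g -> (forall x, 0 <= g x)%E ->
  (\int[leb]_x g (A *m x) = `|\det A|^-1%:E * \int[leb]_x g x)%E.
Proof.
move=> uA mg g0; rewrite -(unitmx_det_scales uA 0 mg g0).
by apply: eq_integral => x _; rewrite addr0.
Qed.

Lemma fourierL1_dilate A f xi : A \in unitmx -> inLp 1%:E f ->
  fourierL1 (dilate A f) xi = fourierL1 f (invmx A *m xi).
Proof.
move=> uA f1; set eta := invmx A *m xi.
pose g x := f x * expi (- (2 * pi * dotp eta x)).
have gE x : dilate A f x * expi (- (2 * pi * dotp xi x)) =
    `|\det A|%:C * g (A^T *m x).
  rewrite /dilate /g dotp_mulmx trmxK /eta mulmxA mulmxV// mul1mx.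
  by rewrite mulrA.
have mg : cmeasurable g by apply: cmeasurableM_expi; case: f1.
have g1 : inLp 1%:E g.
  apply/(inL1P mg); have [mf _] := f1; have /(inL1P mf) := f1.
  by under [X in _ -> (X < _)%E]eq_integral do rewrite normcM normc_expi mulr1.
have [gre gim] := integrable_Re_Im g1.
have uAT : A^T \in unitmx by rewrite unitmx_tr.
have d0 : `|\det A| != 0 by rewrite normr_eq0 -unitfE -unitmxE.
have aux (h : 'cV[R]_n.+1 -> R) : measurable_fun setT h ->
    leb.-integrable setT (EFin \o h) ->
    \int[leb]_x (`|\det A| * h (A^T *m x)) = \int[leb]_x h x.
  move=> mh hi; rewrite RintegralZl//; last first.
    apply/integrableP; split.
      apply/measurable_EFinP; apply: (measurableT_comp mh).
      by have := measurable_mulmxD A^T 0; under eq_fun do rewrite addr0.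
    have mah : measurable_fun setT (abse \o (EFin \o h)).
      by apply: measurableT_comp => //; exact/measurable_EFinP.
    rewrite [X in (X < _)%E](ge0_integral_linear uAT mah) => [|x]; last first.
      exact: abse_ge0.
    rewrite lte_mul_pinfty ?lee_fin ?invr_ge0//.
    by case/integrableP : hi.
  by rewrite (Rintegral_linear uAT)// det_tr mulrA divff// mul1r.
rewrite /fourierL1 /cintegral; congr (_ +i* _).
- rewrite -/(g _) -(aux (fun x => complex.Re (g x)))//; last by case: mg.
  by apply: eq_Rintegral => x _; rewrite gE complex_ReM/= mul0r subr0.
- rewrite -/(g _) -(aux (fun x => complex.Im (g x)))//; last by case: mg.
  by apply: eq_Rintegral => x _; rewrite gE complex_ImM/= mul0r addr0.
Qed.

Lemma integral_dilate_sqr A f : A \in unitmx -> cmeasurable f ->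
  (\int[leb]_x (normc (dilate A f x) ^+ 2)%:E =
   `|\det A|%:E * \int[leb]_x (normc (f x) ^+ 2)%:E)%E.
Proof.
move=> uA mf; have uAT : A^T \in unitmx by rewrite unitmx_tr.
under eq_integral do rewrite normcM exprMn normc_real normr_id EFinM.
have m2 := measurable_normc_sqr mf.
have mA2 := measurable_normc_sqr (cmeasurable_linear A^T mf).
rewrite ge0_integralZl//; last by move=> x _; rewrite lee_fin sqr_ge0.
rewrite (ge0_integral_linear uAT m2); last by move=> x; rewrite lee_fin sqr_ge0.
have d0 : `|\det A| != 0 by rewrite normr_eq0 -unitfE -unitmxE.
by rewrite det_tr muleA -EFinM expr2 mulfK.
Qed.

Lemma inL1_dilate A f : A \in unitmx -> inLp 1%:E f -> inLp 1%:E (dilate A f).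
Proof.
move=> uA f1; have [mf _] := f1; have uAT : A^T \in unitmx by rewrite unitmx_tr.
apply/(inL1P (cmeasurable_dilate A mf)).
under eq_integral do rewrite normcM normc_real normr_id EFinM.
have m1 : measurable_fun setT (fun x => (normc (f x))%:E).
  by apply/measurable_EFinP; exact: measurable_normc.
have mA1 : measurable_fun setT (fun x => (normc (f (A^T *m x)))%:E).
  by apply/measurable_EFinP; exact: measurable_normc (cmeasurable_linear _ mf).
rewrite ge0_integralZl//; last by move=> x _; rewrite lee_fin normc_ge0.
rewrite (ge0_integral_linear uAT m1); last by move=> x; rewrite lee_fin normc_ge0.
have /(inL1P mf) fi := f1.
rewrite lte_mul_pinfty ?lee_fin// lte_mul_pinfty ?lee_fin ?invr_ge0//.
Qed.

End fourier_dilation.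

(** * Tents in several dimensions *)

Section product_tent.
Variable R : realType.
Local Notation leb := (lebesgue_cV R).
Implicit Types d : R.

Definition product_kernel n d (x : 'cV[R]_n) : R :=
  \prod_i tent_kernel d (x i ord0).

Definition product_tent n d (b : 'cV[R]_n) : R := \prod_i tent d (b i ord0).

Lemma product_kernel_ge0 n d (x : 'cV[R]_n) : 0 <= product_kernel d x.
Proof. by apply: prodr_ge0 => i _; exact: tent_kernel_ge0. Qed.

Lemma product_tent_ge0 n d (b : 'cV[R]_n) : 0 <= product_tent d b.
Proof. by apply: prodr_ge0 => i _; exact: tent_ge0. Qed.

Lemma product_kernelS n d (x : 'cV[R]_n.+1) : product_kernel d x =
  tent_kernel d (x ord0 ord0) * product_kernel d (head_cV x).2.
Proof.
rewrite /product_kernel big_ord_recl; congr (_ * _).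
by apply: eq_bigr => i _; rewrite mxE.
Qed.

Lemma dotpS n (b x : 'cV[R]_n.+1) : dotp b x =
  b ord0 ord0 * x ord0 ord0 + dotp (head_cV b).2 (head_cV x).2.
Proof.
rewrite /dotp big_ord_recl; congr (_ + _).
by apply: eq_bigr => i _; rewrite !mxE.
Qed.

Lemma integral_lebesgue_cV0 (f : 'cV[R]_0 -> \bar R) :
  (\int[leb 0]_x f x = f 0%R)%E.
Proof.
have -> : f = cst (f 0).
  by apply/funext => x; congr f; apply/colP; case.
by rewrite integral_cst//= diracE in_setT mule1.
Qed.

(** The cosine and the sine transforms are treated together because the addition
formulas mix them when a coordinate is added. *)
Lemma integrable_product_kernel_trig n d (b : 'cV[R]_n) : 0 <= d ->
  [/\ (leb n).-integrable setT
        (EFin \o (fun x => product_kernel d x * cos (2 * pi * dotp b x))),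
      (leb n).-integrable setT
        (EFin \o (fun x => product_kernel d x * sin (2 * pi * dotp b x))),
      \int[leb n]_x (product_kernel d x * cos (2 * pi * dotp b x)) =
        product_tent d b &
      \int[leb n]_x (product_kernel d x * sin (2 * pi * dotp b x)) = 0].
Proof.
move=> d0; elim: n b => [b|n IH b].
  have E0 (f : 'cV[R]_0 -> R) : (leb 0).-integrable setT (EFin \o f).
    apply/integrableP; split.
      have -> : f = cst (f 0) by apply/funext => x; congr f; apply/colP; case.
      exact/measurable_EFinP/measurable_cst.
    by rewrite integral_lebesgue_cV0 ltry.
  split; [exact: E0|exact: E0| |]; rewrite /Rintegral integral_lebesgue_cV0/=.
    by rewrite /product_kernel /product_tent /dotp !big_ord0 mulr0 cos0 mulr1.
  by rewrite /product_kernel /dotp !big_ord0 mulr0 sin0 mulr0.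
have [ic is_ Ic Is] := IH (head_cV b).2.
set b0 := b ord0 ord0.
pose c x := tent_kernel d x * cos (2 * pi * b0 * x).
pose s x := tent_kernel d x * sin (2 * pi * b0 * x).
pose C (x : 'cV[R]_n) := product_kernel d x * cos (2 * pi * dotp (head_cV b).2 x).
pose S (x : 'cV[R]_n) := product_kernel d x * sin (2 * pi * dotp (head_cV b).2 x).
have cE : (fun x => product_kernel d x * cos (2 * pi * dotp b x)) =
    (fun x : 'cV[R]_n.+1 => c (x ord0 ord0) * C (head_cV x).2 -
       s (x ord0 ord0) * S (head_cV x).2).
  apply/funext => x; rewrite product_kernelS dotpS mulrDr cosD mulrA -/b0.
  by rewrite /c /s /C /S; ring.
have sE : (fun x => product_kernel d x * sin (2 * pi * dotp b x)) =
    (fun x : 'cV[R]_n.+1 => s (x ord0 ord0) * C (head_cV x).2 +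
       c (x ord0 ord0) * S (head_cV x).2).
  apply/funext => x; rewrite product_kernelS dotpS mulrDr sinD mulrA -/b0.
  by rewrite /c /s /C /S; ring.
have i_c := integrable_tent_kernel_cos d (2 * pi * b0).
have i_s := integrable_tent_kernel_sin d (2 * pi * b0).
have icC := integrable_cons i_c ic.
have isS := integrable_cons i_s is_.
have isC := integrable_cons i_s ic.
have icS := integrable_cons i_c is_.
rewrite cE sE; split.
- exact: (integrableB measurableT icC isS).
- exact: (integrableD measurableT isC icS).
- rewrite RintegralB// (Rintegral_cons i_c ic) (Rintegral_cons i_s is_).
  rewrite Ic Is mulr0 subr0 Rintegral_tent_kernel_cos//.
  rewrite /product_tent big_ord_recl; congr (_ * _).
  by apply: eq_bigr => i _; rewrite mxE.
- rewrite RintegralD// (Rintegral_cons i_s ic) (Rintegral_cons i_c is_).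
  by rewrite Is mulr0 addr0 Rintegral_tent_kernel_sin mul0r.
Qed.

Lemma integrable_product_kernel n d : 0 <= d ->
  (leb n).-integrable setT (EFin \o (@product_kernel n d)).
Proof.
move=> d0; have [+ _ _ _] := integrable_product_kernel_trig (0 : 'cV[R]_n) d0.
congr (integrable _ _ _); apply/funext => x /=; congr EFin.
rewrite /dotp big1 ?mulr0 ?cos0 ?mulr1// => i _.
by rewrite mxE mul0r.
Qed.

Lemma product_kernel_bounded n d :
  exists2 C, 0 < C & forall x : 'cV[R]_n, product_kernel d x <= C.
Proof.
have [C C0 kC] := tent_kernel_bounded d.
exists (C ^+ n) => [|x]; first by rewrite exprn_gt0.
rewrite -[n in C ^+ n]card_ord -prodr_const.
by apply: ler_prod => i _; rewrite tent_kernel_ge0 kC.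
Qed.

Lemma measurable_product_kernel n d :
  measurable_fun [set: 'cV[R]_n] (@product_kernel n d).
Proof.
apply: measurable_prod => i _.
exact: (measurableT_comp (measurable_tent_kernel d) (measurable_coord i)).
Qed.

Lemma measurable_product_tent n d :
  measurable_fun [set: 'cV[R]_n] (@product_tent n d).
Proof.
apply: measurable_prod => i _.
apply: (@measurableT_comp _ _ _ _ _ _ (tent d)); last exact: measurable_coord.
apply: measurable_maxr => //; apply: measurable_funB => //.
Qed.

Lemma product_tentN n d (b : 'cV[R]_n) : product_tent d (- b) = product_tent d b.
Proof. by apply: eq_bigr => i _; rewrite mxE /tent normrN. Qed.

Lemma product_tent_le n d (b : 'cV[R]_n) : 0 <= d -> product_tent d b <= d ^+ n.
Proof.
move=> d0; rewrite -[n in d ^+ n]card_ord -prodr_const.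
by apply: ler_prod => i _; rewrite tent_ge0 tent_le.
Qed.

Lemma product_tent_neq0 n d (b : 'cV[R]_n) :
  product_tent d b != 0 -> forall i, `|b i ord0| < d.
Proof.
move=> b0 i; rewrite ltNge; apply: contraNN b0 => di.
by rewrite /product_tent (bigD1 i)//= tent_eq0// mul0r.
Qed.

Lemma le_product_tent n d e (b : 'cV[R]_n) : 0 <= e ->
  (forall i, `|b i ord0| <= d - e) -> e ^+ n <= product_tent d b.
Proof.
move=> e0 be; rewrite -[n in e ^+ n]card_ord -prodr_const.
apply: ler_prod => i _; rewrite e0/= (le_trans _ (le_tent _ _))//.
by rewrite lerBrDr addrC -lerBrDr.
Qed.

End product_tent.

Section tent_fourier_pair.
Variables (R : realType) (n : nat) (d : R) (a : 'cV[R]_n.+1).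
Hypothesis d_gt0 : 0 < d.
Local Notation leb := (lebesgue_cV R n.+1).

Definition tent_at (xi : 'cV[R]_n.+1) : R[i] := (product_tent d (xi - a))%:C.

(** Modulating the kernel translates its transform to a. *)
Definition tent_inv (x : 'cV[R]_n.+1) : R[i] :=
  (product_kernel d x)%:C * expi (2 * pi * dotp a x).

Lemma cmeasurable_tent_at : cmeasurable tent_at.
Proof.
split=> /=; last exact: measurable_cst.
apply: (measurableT_comp (@measurable_product_tent R n.+1 d)).
by have := measurable_mulmxD 1%:M (- a); under eq_fun do rewrite mul1mx.
Qed.

Lemma cmeasurable_tent_inv : cmeasurable tent_inv.
Proof.
have mk := @measurable_product_kernel R n.+1 d.
split.
  under eq_fun do rewrite /tent_inv complex_ReM/= mul0r subr0.
  by apply: measurable_funM => //; exact: measurable_cos_dotp.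
under eq_fun do rewrite /tent_inv complex_ImM/= mul0r addr0.
by apply: measurable_funM => //; exact: measurable_sin_dotp.
Qed.

Lemma normc_tent_at xi : normc (tent_at xi) = product_tent d (xi - a).
Proof. by rewrite normc_real ger0_norm// product_tent_ge0. Qed.

Lemma normc_tent_inv x : normc (tent_inv x) = product_kernel d x.
Proof.
by rewrite normcM normc_real normc_expi mulr1 ger0_norm// product_kernel_ge0.
Qed.

Lemma tent_inv_L1 : inLp 1%:E tent_inv.
Proof.
apply/(inL1P cmeasurable_tent_inv).
under eq_integral do rewrite normc_tent_inv.
have /integrableP[_] := @integrable_product_kernel R n.+1 d (ltW d_gt0).
by under [X in (X < _)%E -> _]eq_integral do
  rewrite /= ger0_norm ?product_kernel_ge0//.
Qed.

Lemma tent_inv_L2 : inLp 2%:E tent_inv.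
Proof.
apply/(inL2P cmeasurable_tent_inv).
have [C C0 kC] := @product_kernel_bounded R n.+1 d.
have mk : measurable_fun setT (fun x : 'cV[R]_n.+1 => (product_kernel d x)%:E).
  by apply/measurable_EFinP; exact: measurable_product_kernel.
apply: (@le_lt_trans _ _ (\int[leb]_x (C%:E * (product_kernel d x)%:E))%E).
  apply: (ge0_le_integral _ measurableT).
  - by move=> x _; rewrite lee_fin sqr_ge0.
  - by apply: measurable_normc_sqr; exact: cmeasurable_tent_inv.
  - by apply: measurable_funeM.
  - move=> x _; rewrite -EFinM lee_fin normc_tent_inv expr2.
    by rewrite ler_wpM2r ?product_kernel_ge0.
rewrite ge0_integralZl//; last 2 first.
- by move=> x _; rewrite lee_fin product_kernel_ge0.
- by rewrite lee_fin ltW.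
rewrite lte_mul_pinfty ?lee_fin ?(ltW C0)//.
have /integrableP[_] := @integrable_product_kernel R n.+1 d (ltW d_gt0).
by under [X in (X < _)%E -> _]eq_integral do
  rewrite /= ger0_norm ?product_kernel_ge0//.
Qed.

Lemma fourierL1_tent_inv xi : fourierL1 tent_inv xi = tent_at xi.
Proof.
have hE x : tent_inv x * expi (- (2 * pi * dotp xi x)) =
    (product_kernel d x)%:C * expi (2 * pi * dotp (a - xi) x).
  by rewrite /tent_inv -mulrA -expiD dotpDl dotpNl [in RHS]mulrBr.
have [_ _ Ic Is] := integrable_product_kernel_trig (a - xi) (ltW d_gt0).
rewrite /fourierL1 /cintegral /tent_at.
under eq_Rintegral do rewrite hE complex_ReM/= mul0r subr0.
under [X in _ +i* X]eq_Rintegral do rewrite hE complex_ImM/= mul0r addr0.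
by rewrite Ic Is -opprB product_tentN.
Qed.

Lemma tent_at_neq0 xi : tent_at xi != 0 -> cube a d xi.
Proof.
move=> xi0 i; have := @product_tent_neq0 _ _ d (xi - a) _ i; rewrite !mxE => h.
apply/ltW/h; apply: contraNneq xi0 => h0.
by rewrite /tent_at h0.
Qed.

Lemma tent_at_support : closure (fsupp tent_at) `<=` cube a d.
Proof.
rewrite [X in _ `<=` X](closure_id _).1; last exact: closed_cube.
by apply: closure_subset; exact: tent_at_neq0.
Qed.

Lemma tent_at_L2 : inLp 2%:E tent_at.
Proof.
apply/(inL2P cmeasurable_tent_at).
have mc : measurable (cube a d) by exact: measurable_box.
apply: (@le_lt_trans _ _ (\int[leb]_(x in cube a d) ((d ^+ n.+1 ^+ 2)%:E))%E).
  rewrite [leRHS]integral_mkcond; apply: (ge0_le_integral _ measurableT).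
  - by move=> x _; rewrite lee_fin sqr_ge0.
  - by apply: measurable_normc_sqr; exact: cmeasurable_tent_at.
  - apply/(measurable_restrictT _ _).1 => //.
  - move=> x _; rewrite patchE; case: ifPn => [_|xc].
      rewrite lee_fin lerXn2r ?nnegrE ?normc_ge0 ?exprn_ge0 ?(ltW d_gt0)//.
      by rewrite normc_tent_at product_tent_le ?ltW.
    have [->|t0] := eqVneq (tent_at x) 0; first by rewrite normc0 expr0n.
    by move: xc; rewrite mem_set//; exact: tent_at_neq0.
rewrite integral_cst// lte_mul_pinfty ?lee_fin ?sqr_ge0//.
by rewrite [X in (X < _)%E](lebesgue_box a d_gt0) ltry.
Qed.

Lemma is_fourier_tent : is_fourier tent_inv tent_at.
Proof.
split; [exact: tent_inv_L2|exact: tent_at_L2|exists (fun=> tent_inv)].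
have z0 (f : nat -> 'cV[R]_n.+1 -> R[i]) : (forall k x, f k x = 0) ->
    (fun k => cLnorm 2%:E (f k)) @ \oo --> 0%E.
  move=> f0; apply: (@cLnorm2_cvg0 _ _ _ 0) => // k.
  by under eq_integral do rewrite f0 normc0 expr0n/=; rewrite integral0 mul0r.
split=> [k||]; first by split; [exact: tent_inv_L1|exact: tent_inv_L2].
  by apply: z0 => k x; rewrite subrr.
by apply: z0 => k x; rewrite fourierL1_tent_inv subrr.
Qed.

Lemma tent_at_bounded : inLp +oo%E tent_at.
Proof.
apply: (@inLpy_bounded _ _ _ (d ^+ n.+1)); first exact: cmeasurable_tent_at.
by move=> x; rewrite normc_tent_at product_tent_le ?ltW.
Qed.

Lemma D_space_tent (E : set 'cV[R]_n.+1) :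
  cube a d `<=` ~` E -> D_space E tent_inv tent_at.
Proof.
move=> aE; split; [exact: is_fourier_tent|exact: tent_at_bounded| |].
  apply: subclosed_compact (@compact_cube _ _ a d) tent_at_support.
  exact: closed_closure.
exact: subset_trans tent_at_support aE.
Qed.

(** Inside the cube of half-width d - e each factor of the tent is at least e. *)
Lemma le_normc_tent_at e xi : 0 <= e -> cube a (d - e) xi ->
  e ^+ n.+1 <= normc (tent_at xi).
Proof.
move=> e0 xie; rewrite normc_tent_at; apply: le_product_tent => // i.
by rewrite !mxE.
Qed.

End tent_fourier_pair.

(** * Square-summable series of functions *)

Section weighted_square_series.
Variable R : realType.

Lemma sum_half_le (Q : R) k : 0 <= Q ->
  \sum_(0 <= i < k) Q / 2 ^+ i <= 2 * Q.
Proof.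
move=> Q0; suff -> : \sum_(0 <= i < k) Q / 2 ^+ i = 2 * Q - 2 * Q / 2 ^+ k.
  by rewrite gerBl divr_ge0// ?mulr_ge0// exprn_ge0.
elim: k => [|k IH]; first by rewrite big_nil expr0 divr1 subrr.
have k0 : 2 ^+ k != 0 :> R by rewrite expf_neq0.
by rewrite big_nat_recr//= IH exprS; field.
Qed.

Lemma nneseries_le_bound (u : nat -> \bar R) (b : \bar R) :
  (forall i, 0 <= u i)%E -> (forall k, \sum_(0 <= i < k) u i <= b)%E ->
  (\sum_(i <oo) u i <= b)%E.
Proof.
move=> u0 ub; apply: lime_le; last exact: nearW.
exact: is_cvg_nneseries.
Qed.

(** Iterating (x + s)^2 <= 2 x^2 + 2 s^2 along the sum trades Cauchy-Schwarz for
geometric weights. *)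
Lemma sqr_sum_le (u : nat -> R) k m :
  (\sum_(i < k) u (m + i)%N) ^+ 2 <= \sum_(i < k) 2 ^+ i.+1 * u (m + i)%N ^+ 2.
Proof.
elim: k m => [|k IH] m; first by rewrite !big_ord0 expr0n.
rewrite !big_ord_recl expr1.
set x := u _; set s := \sum_(i < k) u _.
have sE : s = \sum_(i < k) u (m.+1 + i)%N.
  by apply: eq_bigr => i _; rewrite lift0 addSnnS.
apply: (@le_trans _ _ (2 * x ^+ 2 + 2 * s ^+ 2)).
  by have := sqr_ge0 (x - s); rewrite sqrrB sqrrD; lra.
rewrite lerD2l sE (le_trans (ler_wpM2l _ (IH m.+1)))// mulr_sumr.
by apply: ler_sum => i _; rewrite lift0 mulrA -exprS addSnnS.
Qed.

Variables (u : nat -> R) (t : R).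
Hypothesis ut : forall k, \sum_(0 <= i < k) 2 ^+ i * u i ^+ 2 <= t.

Let w_ge0 i : 0 <= 2 ^+ i * u i ^+ 2.
Proof. by rewrite mulr_ge0 ?sqr_ge0 ?exprn_ge0. Qed.

(** The terms are absolutely summable since |u_i| <= 2^-i + 2^i u_i^2. *)
Lemma weighted_sqr_cvg : cvgn (series u).
Proof.
apply: normed_cvg; apply: nondecreasing_is_cvgn.
  by apply: nondecreasing_series => k _ _ /=.
exists (2 + t) => _ [k _ <-].
apply: (@le_trans _ _ (\sum_(0 <= i < k) (1 / 2 ^+ i + 2 ^+ i * u i ^+ 2))).
  apply: ler_sum => i _; set p : R := 2 ^+ i; have p0 : 0 < p by exact: exprn_gt0.
  rewrite -(ler_pM2l p0) mulrDr mulrCA divff ?gt_eqF// mulr1 mulrA -expr2.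
  have -> : p ^+ 2 * u i ^+ 2 = (p * `|u i|) ^+ 2 by rewrite exprMn real_normK ?num_real.
  set y := p * _; have := sqr_ge0 (y - 1); have := sqr_ge0 y.
  by rewrite sqrrB expr1n mulr1; lra.
by rewrite big_split/= lerD// (le_trans (sum_half_le _ _))// mulr1.
Qed.

(** The weighted inequality is passed to the limit along the partial sums that start
at m; from m on, the weights of the hypothesis exceed those of the inequality
by the factor 2^m / 2. *)
Lemma weighted_sqr_tail m : (limn (series u) - series u m) ^+ 2 <= 2 / 2 ^+ m * t.
Proof.
have cu : (fun k => series u (m + k)%N) @ \oo --> limn (series u).
  have := weighted_sqr_cvg; rewrite -(cvg_shiftn m) => h.
  by under eq_fun do rewrite addnC.
have c2 : (fun k => (series u (m + k)%N - series u m) ^+ 2) @ \oo -->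
    (limn (series u) - series u m) ^+ 2.
  rewrite expr2; under eq_fun do rewrite expr2.
  by apply: cvgM; apply: cvgB => //; exact: cvg_cst.
apply: (ler_cvg_to c2 (cvg_cst _)); apply: nearW => k.
have shift (F : nat -> R) :
    \sum_(m <= i < m + k) F i = \sum_(i < k) F (m + i)%N.
  rewrite -{1}[m]add0n big_addn addnC addnK big_mkord.
  by apply: eq_bigr => i _; rewrite addnC.
have -> : series u (m + k)%N - series u m = \sum_(i < k) u (m + i)%N.
  rewrite /series/= (big_cat_nat (leq0n m) (leq_addr k m))/= [X in X - _]addrC.
  by rewrite addrK shift.
apply: (le_trans (sqr_sum_le _ _ _)).
have p0 : 0 < 2 ^+ m :> R by rewrite exprn_gt0.
rewrite -mulrA -ler_pdivrMl// mulr_sumr.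
apply: (@le_trans _ _ ((2 ^+ m)^-1 * \sum_(0 <= i < m + k) 2 ^+ i * u i ^+ 2)); last first.
  by rewrite ler_pM2l ?invr_gt0.
rewrite (big_cat_nat (leq0n m) (leq_addr k m))/= mulrDr ler_wpDl//.
  by rewrite mulr_ge0 ?invr_ge0 ?(ltW p0)//; apply: sumr_ge0 => i _.
rewrite shift mulr_sumr; apply: ler_sum => i _.
by rewrite exprD exprS -!mulrA !mulKf ?gt_eqF.
Qed.

End weighted_square_series.

Section L2_series.
Variables (R : realType) (d : measure_display) (T : measurableType d).
Local Open Scope ereal_scope.

(** The limit is taken where the weighted sum of squares is finite and is 0
elsewhere, which keeps it measurable; where the sum is infinite the error bound
is trivial. *)
Lemma measurable_L2_series (u : nat -> T -> R) :
  (forall i, measurable_fun setT (u i)) ->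
  exists U : T -> R, [/\ measurable_fun setT U,
    forall x, \sum_(i <oo) (2 ^+ i * u i x ^+ 2)%:E < +oo ->
      series (u ^~ x) @ \oo --> U x &
    forall x m, ((U x - series (u ^~ x) m) ^+ 2)%:E <=
      (2 / 2 ^+ m)%:E * \sum_(i <oo) (2 ^+ i * u i x ^+ 2)%:E].
Proof.
move=> mu; pose W x := \sum_(i <oo) (2 ^+ i * u i x ^+ 2)%:E.
have w0 i x : 0 <= (2 ^+ i * u i x ^+ 2)%:E.
  by rewrite lee_fin mulr_ge0 ?sqr_ge0 ?exprn_ge0.
have W0 x : 0 <= W x by exact: nneseries_ge0.
have mW : measurable_fun setT W.
  apply: ge0_emeasurable_sum => // i _; apply/measurable_EFinP.
  by apply: measurable_funM => //; exact: measurable_funX.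
pose D := [set x | W x < +oo].
have mD : measurable D.
  by rewrite -[D]setTI; exact: emeasurable_fun_infty_o.
have Wt x : D x -> forall k, (\sum_(0 <= i < k) 2 ^+ i * u i x ^+ 2 <= fine (W x))%R.
  move=> Dx k; rewrite -lee_fin fineK; last by rewrite ge0_fin_numE.
  by rewrite -sumEFin; apply: nneseries_lim_ge => i _ _; exact: w0.
have cvgD x : D x -> cvgn (series (u ^~ x)).
  by move=> Dx; exact: weighted_sqr_cvg (Wt _ Dx).
pose v i x := (u i x * \1_D x)%R.
have vE x : D x -> v ^~ x = u ^~ x.
  by move=> Dx; apply/funext => i; rewrite /v indicE mem_set// mulr1.
have v0 x : ~ D x -> v ^~ x = (fun=> 0%R).
  by move=> Dx; apply/funext => i; rewrite /v indicE memNset// mulr0.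
have cvgv x : cvgn (series (v ^~ x)).
  have [Dx|Dx] := pselect (D x); first by rewrite vE//; exact: cvgD.
  rewrite v0// (_ : series _ = cst 0%R); first exact: is_cvg_cst.
  by apply/funext => k; rewrite /series/= big1.
exists (fun x => limn (series (v ^~ x))); split.
- apply: (@measurable_fun_cvg _ _ _ _ (fun m x => series (v ^~ x) m)) => [m|x _].
    by apply: measurable_sum => i; apply: measurable_funM.
  exact: cvgv.
- by move=> x Dx; rewrite vE//; exact: cvgD.
- move=> x m; have [Dx|Dx] := pselect (D x).
    rewrite vE// -/(W x) -(@fineK _ (W x)); last by rewrite ge0_fin_numE.
    by rewrite -EFinM lee_fin; exact: weighted_sqr_tail (Wt _ Dx) _.
  have -> : \sum_(i <oo) (2 ^+ i * u i x ^+ 2)%:E = +oo.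
    by apply/eqP; rewrite -leye_eq leNgt; apply/negP.
  by rewrite gt0_muley ?leey// lte_fin divr_gt0// exprn_gt0.
Qed.

End L2_series.

Section complex_L2_series.
Variables (R : realType) (n : nat).
Local Notation leb := (lebesgue_cV R n).

Lemma Re_sum (I : Type) (s : seq I) (P : pred I) (F : I -> R[i]) :
  complex.Re (\sum_(i <- s | P i) F i) = \sum_(i <- s | P i) complex.Re (F i).
Proof. by elim/big_rec2 : _ => // i x y _ <-; case: (F i) y => ? ? []. Qed.

Lemma Im_sum (I : Type) (s : seq I) (P : pred I) (F : I -> R[i]) :
  complex.Im (\sum_(i <- s | P i) F i) = \sum_(i <- s | P i) complex.Im (F i).
Proof. by elim/big_rec2 : _ => // i x y _ <-; case: (F i) y => ? ? []. Qed.

(** Integrals of size 4^-i leave a factor 2^-i after the weights 2^i are put in,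
so the weighted sum of squares is integrable and bounds the error in L2. *)
Lemma complex_L2_series (f : nat -> 'cV[R]_n -> R[i]) (Q : R) : 0 <= Q ->
  (forall i, cmeasurable (f i)) ->
  (forall i, \int[leb]_x (normc (f i x) ^+ 2)%:E <= (Q / 4 ^+ i)%:E)%E ->
  exists F : 'cV[R]_n -> R[i], [/\ cmeasurable F,
    forall k, (\int[leb]_x (normc (\sum_(0 <= i < k) f i x - F x) ^+ 2)%:E <=
      (4 * Q / 2 ^+ k)%:E)%E,
    forall x, (normc (F x) ^+ 2)%:E <=
      2%:E * \sum_(i <oo) (2 ^+ i * normc (f i x) ^+ 2)%:E &
    forall x, \sum_(i <oo) (2 ^+ i * normc (f i x) ^+ 2)%:E < +oo ->
      series (fun i => complex.Re (f i x)) @ \oo --> complex.Re (F x)]%E.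
Proof.
move=> Q0 mf fQ.
have [U [mU cU tU]] := measurable_L2_series (fun i => (mf i).1).
have [V [mV cV tV]] := measurable_L2_series (fun i => (mf i).2).
pose W x := (\sum_(i <oo) (2 ^+ i * normc (f i x) ^+ 2)%:E)%E.
have p0 k : 0 < 2 ^+ k :> R by rewrite exprn_gt0.
have w0 i x : (0 <= (2 ^+ i * normc (f i x) ^+ 2)%:E)%E.
  by rewrite lee_fin mulr_ge0 ?sqr_ge0 ?ltW.
have re0 i x : (0 <= (2 ^+ i * complex.Re (f i x) ^+ 2)%:E)%E.
  by rewrite lee_fin mulr_ge0 ?sqr_ge0 ?ltW.
have im0 i x : (0 <= (2 ^+ i * complex.Im (f i x) ^+ 2)%:E)%E.
  by rewrite lee_fin mulr_ge0 ?sqr_ge0 ?ltW.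
have WE x : W x = (\sum_(i <oo) (2 ^+ i * complex.Re (f i x) ^+ 2)%:E +
    \sum_(i <oo) (2 ^+ i * complex.Im (f i x) ^+ 2)%:E)%E.
  rewrite -nneseriesD//; apply: eq_eseriesr => i _.
  by rewrite -EFinD -mulrDr -normc_sqr.
have tail k x : ((normc (\sum_(0 <= i < k) f i x - (U x +i* V x)) ^+ 2)%:E <=
    (2 / 2 ^+ k)%:E * W x)%E.
  rewrite normc_sqr WE ge0_muleDr ?nneseries_ge0// EFinD.
  rewrite !raddfB/= Re_sum Im_sum; apply: leeD.
    by rewrite -sqrrN opprB; exact: tU.
  by rewrite -sqrrN opprB; exact: tV.
have mW : measurable_fun setT W.
  apply: ge0_emeasurable_sum => // i _; apply/measurable_EFinP.
  by apply: measurable_funM => //; apply: measurable_funX; exact: measurable_normc.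
have intW : (\int[leb]_x W x <= (2 * Q)%:E)%E.
  rewrite integral_nneseries//; last first.
    move=> i; apply/measurable_EFinP.
    by apply: measurable_funM => //; apply: measurable_funX; exact: measurable_normc.
  apply: nneseries_le_bound => [i|k]; first exact: integral_ge0.
  apply: (@le_trans _ _ (\sum_(0 <= i < k) (Q / 2 ^+ i)%:E)%E); last first.
    by rewrite sumEFin lee_fin sum_half_le.
  apply: lee_sum => i _; under eq_integral do rewrite EFinM.
  have msq := measurable_normc_sqr (mf i).
  rewrite ge0_integralZl//; last by move=> x _; rewrite lee_fin sqr_ge0.
  rewrite (le_trans (lee_wpmul2l _ (fQ i))) ?lee_fin ?(ltW (p0 i))//.
  have -> : 4 ^+ i = 2 ^+ i * 2 ^+ i :> R by rewrite -exprMn -natrM.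
  by rewrite invfM mulrCA mulVKf ?gt_eqF.
exists (fun x => U x +i* V x); split.
- by split.
- move=> k.
  apply: (@le_trans _ _ (\int[leb]_x ((2 / 2 ^+ k)%:E * W x))%E).
    apply: (ge0_le_integral _ measurableT).
    + by move=> x _; rewrite lee_fin sqr_ge0.
    + apply: measurable_normc_sqr; split.
        under eq_fun do rewrite raddfB/= Re_sum.
        apply: measurable_funB => //; apply: measurable_sum => i; exact: (mf i).1.
      under eq_fun do rewrite raddfB/= Im_sum.
      apply: measurable_funB => //; apply: measurable_sum => i; exact: (mf i).2.
    + exact: measurable_funeM.
    + by move=> x _; exact: tail.
  rewrite ge0_integralZl//; last by move=> x _; exact: nneseries_ge0.
  rewrite (le_trans (lee_wpmul2l _ intW)) ?lee_fin ?divr_ge0 ?(ltW (p0 k))//.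
  have -> : 4 * Q / 2 ^+ k = 2 / 2 ^+ k * (2 * Q) :> R.
    by field; rewrite gt_eqF.
  exact: lexx.
- move=> x; have := tail 0 x; rewrite big_nil sub0r normcN expr0 divr1.
  exact.
- move=> x Wx; apply: cU; apply: le_lt_trans Wx.
  by rewrite -/(W x) WE leeDl// nneseries_ge0.
Qed.

End complex_L2_series.

(** * Sums over arbitrary index sets *)

Section esum_tools.
Variable R : realType.
Local Open Scope ereal_scope.

Lemma esum_swap (S T : choiceType) (I : set S) (J : set T) (a : S -> T -> \bar R) :
  (forall i j, 0 <= a i j) ->
  \esum_(i in I) \esum_(j in J) a i j = \esum_(j in J) \esum_(i in I) a i j.
Proof.
move=> a0; rewrite !esum_esum//.
rewrite (reindex_esum (J `*` I) _ (fun x => (x.2, x.1)))//; split=> //=.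
- by move=> [j i] [].
- by move=> [j i] [j' i'] _ _ [-> ->].
- by move=> [i j] [Ii Jj]; exists (j, i).
Qed.

Lemma esum_ge1 (T : choiceType) (I : set T) (a : T -> \bar R) i : I i ->
  a i <= \esum_(j in I) a j.
Proof.
move=> Ii; apply: esum_ge; exists [set i]; last by rewrite fsbig_set1.
by split=> [|_ ->]; [exact: finite_set1|].
Qed.

Lemma esum_subset (T : choiceType) (I J : set T) (a : T -> \bar R) :
  (forall i, 0 <= a i) -> I `<=` J -> \esum_(i in I) a i <= \esum_(i in J) a i.
Proof.
move=> a0 IJ; rewrite esum_mkcond [leRHS]esum_mkcond; apply: le_esum => i _.
case: ifPn => [/set_mem/IJ/mem_set ->//|_]; by case: ifP.
Qed.

Lemma esumZl (T : choiceType) (I : set T) (a : T -> \bar R) (c : R) :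
  (0 <= c)%R -> (forall i, 0 <= a i) ->
  \esum_(i in I) (c%:E * a i) = c%:E * \esum_(i in I) a i.
Proof.
move=> c0 a0.
have le (b : T -> \bar R) (e : R) : (0 <= e)%R -> (forall i, 0 <= b i) ->
    \esum_(i in I) (e%:E * b i) <= e%:E * \esum_(i in I) b i.
  move=> e0 b0; apply: ge_ereal_sup => _ [X [finX XI] <-].
  rewrite -ge0_mule_fsumr//; apply: lee_wpmul2l; first by rewrite lee_fin.
  by apply: ereal_sup_ubound; exists X.
have [->|cn0] := eqVneq c 0%R.
  by rewrite mul0e esum1// => i _; rewrite mul0e.
have cp : (0 < c)%R by rewrite lt_neqAle eq_sym cn0.
apply/eqP; rewrite eq_le le//=.
rewrite muleC -lee_pdivlMr// muleC.
have ci : (0 <= c^-1)%R by rewrite invr_ge0.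
have ca i : 0 <= c%:E * a i by rewrite mule_ge0.
apply: le_trans (le _ _ ci ca).
apply: le_esum => i _.
by rewrite muleA -EFinM mulVf// mul1e.
Qed.

Lemma esum_cst (T : choiceType) (S : set T) (c : R) : (0 <= c)%R ->
  \esum_(i in S) c%:E = c%:E * counting S.
Proof.
move=> c0; rewrite /counting; case: asboolP => [fS|iS].
  rewrite esum_fset//.
  rewrite fsbig_finite//= sumEFin -EFinM; congr EFin.
  by rewrite big_const_seq count_predT iter_addr_0 mulr_natr.
have [->|cn0] := eqVneq c 0%R; first by rewrite mul0e esum1.
have cp : (0 < c)%R by rewrite lt_neqAle eq_sym cn0.
rewrite gt0_muley ?lte_fin//; apply/eqyP => A A0.
have [X XS XA] := infinite_set_fset (Num.truncn (A / c)).+1 iS.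
apply: esum_ge; exists [set` X]; first by split.
rewrite fsbig_finite//= set_fsetK sumEFin lee_fin.
rewrite big_const_seq count_predT iter_addr_0 -[leRHS]mulr_natr -ler_pdivrMl//.
rewrite mulrC (le_trans (ltW (truncnS_gt _)))// ler_nat.
exact: XA.
Qed.

Lemma esum_window (a : int -> \bar R) (c : R) (j0 : int) (N : nat) :
  (0 <= c)%R -> (forall j, 0 <= a j <= c%:E) ->
  (forall j, a j != 0 -> (j0 <= j <= j0 + N%:Z)%R) ->
  \esum_(j in [set: int]) a j <= (c * N.+1%:R)%:E.
Proof.
move=> c0 ac aN; pose W := (fun i : nat => (j0 + i%:Z)%R) @` `I_N.+1.
have -> : \esum_(j in [set: int]) a j = \esum_(j in W) a j.
  rewrite [RHS]esum_mkcond; apply: eq_esum => j _; case: ifPn => // /negP jW.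
  apply/eqP; apply/negPn/negP => /aN /andP[j1 j2]; apply: jW; apply/mem_set.
  have : (0 <= j - j0)%R by rewrite subr_ge0.
  case E : (j - j0)%R => [m|//] _.
  have jE : j = (j0 + m%:Z)%R by rewrite -E addrC subrK.
  by exists m => //=; move: j2; rewrite jE lerD2l lez_nat ltnS.
rewrite esum_image; last by move=> i i' _ _ /addrI [].
rewrite esum_fset; [|exact: finite_II|by move=> i _; have /andP[] := ac (j0 + i%:Z)%R].
rewrite -(fsbig_ord _ _ (fun i : nat => a (j0 + i%:Z)%R)).
apply: (@le_trans _ _ (\sum_(i < N.+1) c%:E)).
  by apply: lee_sum => i _; have /andP[] := ac (j0 + i%:Z)%R.
by rewrite sumEFin sumr_const card_ord mulr_natr.
Qed.

Lemma esum_int (a : int -> \bar R) : (forall j, 0 <= a j) ->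
  \esum_(j in [set: int]) a j =
  \sum_(k <oo) a (Posz k) + \sum_(k <oo) a (Negz k).
Proof.
move=> a0; rewrite (esumID (range Posz))//; congr (_ + _).
  rewrite setTI esum_image//; last by move=> i i' _ _ [].
  by rewrite nneseries_esumT.
have -> : [set: int] `&` ~` range Posz = range Negz.
  apply/seteqP; split=> [[m|m] [_ jm]|_ [m _ <-]].
  - by exfalso; apply: jm; exists m.
  - by exists m.
  - by split => // -[k _].
rewrite esum_image//; last by move=> i i' _ _ [].
by rewrite nneseries_esumT.
Qed.

Lemma emeasurable_esum_int d (T : measurableType d) (D : set T)
    (f : int -> T -> \bar R) :
  (forall j x, 0 <= f j x) -> (forall j, measurable_fun D (f j)) ->
  measurable_fun D (fun x => \esum_(j in [set: int]) f j x).
Proof.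
move=> f0 mf; under eq_fun do rewrite esum_int//.
by apply: emeasurable_funD; apply: ge0_emeasurable_sum.
Qed.

Lemma ge0_integral_esum_int d (T : measurableType d)
    (mu : {measure set T -> \bar R}) (D : set T) (f : int -> T -> \bar R) :
  measurable D -> (forall j x, 0 <= f j x) ->
  (forall j, measurable_fun D (f j)) ->
  \int[mu]_(x in D) (\esum_(j in [set: int]) f j x) =
  \esum_(j in [set: int]) \int[mu]_(x in D) f j x.
Proof.
move=> mD f0 mf; under eq_integral do rewrite esum_int//.
rewrite esum_int; last by move=> j; exact: integral_ge0.
rewrite ge0_integralD//.
- by rewrite !integral_nneseries.
- by move=> x _; exact: nneseries_ge0.
- exact: ge0_emeasurable_sum.
- by move=> x _; exact: nneseries_ge0.
- exact: ge0_emeasurable_sum.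
Qed.

Lemma ge0_integral_setU_le d (T : measurableType d)
    (mu : {measure set T -> \bar R}) (A B : set T) (f : T -> \bar R) :
  measurable A -> measurable B -> measurable_fun setT f ->
  (forall x, 0 <= f x) ->
  \int[mu]_(x in A `|` B) f x <= \int[mu]_(x in A) f x + \int[mu]_(x in B) f x.
Proof.
move=> mA mB mf f0.
have -> : A `|` B = A `|` (B `\` A).
  apply/seteqP; split=> x [Ax|]; [by left| |by left|by case; right].
  by move=> Bx; have [Ax|nAx] := pselect (A x); [left|right].
have mBA : measurable (B `\` A) by exact: measurableD.
rewrite ge0_integral_setU//.
- rewrite leeD2l//; apply: ge0_subset_integral => //.
  exact: measurable_funTS.
- exact: measurable_funTS.
- by apply/disj_set2P/seteqP; split=> // x [Ax [_]].
Qed.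

Lemma ge0_integral_bigsetU_le d (T : measurableType d) (I : Type)
    (mu : {measure set T -> \bar R}) (s : seq I) (F : I -> set T) (f : T -> \bar R) :
  (forall i, measurable (F i)) -> measurable_fun setT f -> (forall x, 0 <= f x) ->
  \int[mu]_(x in \big[setU/set0]_(i <- s) F i) f x <=
  \sum_(i <- s) \int[mu]_(x in F i) f x.
Proof.
move=> mF mf f0; elim: s => [|i s IH]; first by rewrite !big_nil integral_set0.
rewrite !big_cons (le_trans (ge0_integral_setU_le _ _ _ _ _))//.
  exact: bigsetU_measurable.
by rewrite leeD2l.
Qed.

End esum_tools.

(** * Transforms of series *)

Section fourier_linear.
Variables (R : realType) (n : nat).
Local Notation leb := (lebesgue_cV R n.+1).
Implicit Types f g : 'cV[R]_n.+1 -> R[i].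

Lemma cmeasurable0 : cmeasurable (fun _ : 'cV[R]_n.+1 => 0 : R[i]).
Proof. by split; exact: measurable_cst. Qed.

Lemma cmeasurableD f g : cmeasurable f -> cmeasurable g ->
  cmeasurable (fun x => f x + g x).
Proof.
move=> [fre fim] [gre gim]; split.
  by under eq_fun do rewrite raddfD/=; exact: measurable_funD.
by under eq_fun do rewrite raddfD/=; exact: measurable_funD.
Qed.

Lemma inL1_0 : inLp 1%:E (fun _ : 'cV[R]_n.+1 => 0 : R[i]).
Proof.
apply/(inL1P cmeasurable0).
by under eq_integral do rewrite normc0; rewrite integral0 ltry.
Qed.

Lemma inL1D f g : inLp 1%:E f -> inLp 1%:E g -> inLp 1%:E (fun x => f x + g x).
Proof.
move=> f1 g1; have [mf _] := f1; have [mg _] := g1.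
have /(inL1P mf) fi := f1; have /(inL1P mg) gi := g1.
have mnf : measurable_fun setT (fun x => (normc (f x))%:E).
  by apply/measurable_EFinP; exact: measurable_normc.
have mng : measurable_fun setT (fun x => (normc (g x))%:E).
  by apply/measurable_EFinP; exact: measurable_normc.
apply/(inL1P (cmeasurableD mf mg)).
apply: (@le_lt_trans _ _ (\int[leb]_x ((normc (f x))%:E + (normc (g x))%:E))%E).
  apply: (ge0_le_integral _ measurableT).
  - by move=> x _; rewrite lee_fin normc_ge0.
  - by apply/measurable_EFinP; apply: measurable_normc; exact: cmeasurableD.
  - exact: emeasurable_funD.
  - by move=> x _; rewrite -EFinD lee_fin le_normcD.
rewrite ge0_integralD//; [|by move=> x _; rewrite lee_fin normc_ge0..].
exact: lte_add_pinfty.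
Qed.

Lemma inL2_0 : inLp 2%:E (fun _ : 'cV[R]_n.+1 => 0 : R[i]).
Proof.
apply/(inL2P cmeasurable0).
by under eq_integral do rewrite normc0 expr0n; rewrite integral0 ltry.
Qed.

Lemma inL2D f g : inLp 2%:E f -> inLp 2%:E g -> inLp 2%:E (fun x => f x + g x).
Proof.
move=> f2 g2; have [mf _] := f2; have [mg _] := g2.
have /(inL2P mf) fi := f2; have /(inL2P mg) gi := g2.
have m2f := measurable_normc_sqr mf; have m2g := measurable_normc_sqr mg.
have f0 x : (0 <= 2%:E * (normc (f x) ^+ 2)%:E)%E.
  by rewrite -EFinM lee_fin mulr_ge0 ?sqr_ge0.
have g0 x : (0 <= 2%:E * (normc (g x) ^+ 2)%:E)%E.
  by rewrite -EFinM lee_fin mulr_ge0 ?sqr_ge0.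
apply/(inL2P (cmeasurableD mf mg)).
apply: (@le_lt_trans _ _ (\int[leb]_x
    (2%:E * (normc (f x) ^+ 2)%:E + 2%:E * (normc (g x) ^+ 2)%:E))%E).
  apply: (ge0_le_integral _ measurableT).
  - by move=> x _; rewrite lee_fin sqr_ge0.
  - by apply: measurable_normc_sqr; exact: cmeasurableD.
  - by apply: emeasurable_funD; exact: measurable_funeM.
  - move=> x _; rewrite -!EFinM -EFinD lee_fin.
    apply: (@le_trans _ _ ((normc (f x) + normc (g x)) ^+ 2)).
      by rewrite lerXn2r ?nnegrE ?addr_ge0 ?normc_ge0// le_normcD.
    by have := sqr_ge0 (normc (f x) - normc (g x)); rewrite sqrrB sqrrD; lra.
rewrite ge0_integralD//; [|exact: measurable_funeM..].
rewrite !ge0_integralZl//; [|by move=> x _; rewrite lee_fin sqr_ge0..].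
by rewrite lte_add_pinfty// lte_mul_pinfty ?lee_fin.
Qed.

Lemma inL1_sum (F : nat -> 'cV[R]_n.+1 -> R[i]) k : (forall i, inLp 1%:E (F i)) ->
  inLp 1%:E (fun x => \sum_(0 <= i < k) F i x).
Proof.
move=> F1; elim: k => [|k IH].
  by under eq_fun do rewrite big_nil; exact: inL1_0.
by under eq_fun do rewrite big_nat_recr//=; exact: inL1D.
Qed.

Lemma inL2_sum (F : nat -> 'cV[R]_n.+1 -> R[i]) k : (forall i, inLp 2%:E (F i)) ->
  inLp 2%:E (fun x => \sum_(0 <= i < k) F i x).
Proof.
move=> F1; elim: k => [|k IH].
  by under eq_fun do rewrite big_nil; exact: inL2_0.
by under eq_fun do rewrite big_nat_recr//=; exact: inL2D.
Qed.

Lemma inL1Z (r : R) f : inLp 1%:E f -> inLp 1%:E (fun x => r%:C * f x).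
Proof.
move=> f1; have [mf _] := f1; have /(inL1P mf) fi := f1.
apply/(inL1P (cmeasurableZ r mf)).
under eq_integral do rewrite normcM normc_real EFinM.
rewrite ge0_integralZl//; last 2 first.
- by apply/measurable_EFinP; exact: measurable_normc.
- by move=> x _; rewrite lee_fin normc_ge0.
by rewrite lte_mul_pinfty ?lee_fin.
Qed.

Lemma inL1M_expi f (xi : 'cV[R]_n.+1) : inLp 1%:E f ->
  inLp 1%:E (fun x => f x * expi (- (2 * pi * dotp xi x))).
Proof.
move=> f1; have [mf _] := f1; have /(inL1P mf) fi := f1.
apply/(inL1P (cmeasurableM_expi xi mf)).
by under eq_integral do rewrite normcM normc_expi mulr1.
Qed.

Lemma cintegralD f g : inLp 1%:E f -> inLp 1%:E g ->
  cintegral (fun x => f x + g x) = cintegral f + cintegral g.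
Proof.
move=> /integrable_Re_Im[fre fim] /integrable_Re_Im[gre gim].
rewrite /cintegral; apply/eqP; rewrite eq_complex/=.
under eq_Rintegral do rewrite raddfD/=.
under [X in _ && (X == _)]eq_Rintegral do rewrite raddfD/=.
by rewrite !RintegralD// !eqxx.
Qed.

Lemma cintegralZ (r : R) f : inLp 1%:E f ->
  cintegral (fun x => r%:C * f x) = r%:C * cintegral f.
Proof.
move=> /integrable_Re_Im[fre fim].
rewrite /cintegral; apply/eqP; rewrite eq_complex complex_ReM complex_ImM/=.
under eq_Rintegral do rewrite complex_ReM/= mul0r subr0.
under [X in _ && (X == _)]eq_Rintegral do rewrite complex_ImM/= mul0r addr0.
by rewrite !RintegralZl// !mul0r subr0 addr0 !eqxx.
Qed.

Lemma fourierL1D f g xi : inLp 1%:E f -> inLp 1%:E g ->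
  fourierL1 (fun x => f x + g x) xi = fourierL1 f xi + fourierL1 g xi.
Proof.
move=> f1 g1; rewrite /fourierL1 -cintegralD; [|exact: inL1M_expi..].
by congr cintegral; apply/funext => x; rewrite mulrDl.
Qed.

Lemma fourierL1Z (r : R) f xi : inLp 1%:E f ->
  fourierL1 (fun x => r%:C * f x) xi = r%:C * fourierL1 f xi.
Proof.
move=> f1; rewrite /fourierL1 -cintegralZ; last exact: inL1M_expi.
by congr cintegral; apply/funext => x; rewrite mulrA.
Qed.

Lemma fourierL1_0 (xi : 'cV[R]_n.+1) : fourierL1 (fun=> 0) xi = 0 :> R[i].
Proof.
have -> : (fun=> 0) = (fun _ : 'cV[R]_n.+1 => 0%:C * (0 : R[i])).
  by apply/funext => x; rewrite mulr0.
by rewrite fourierL1Z ?rmorph0 ?mul0r//; exact: inL1_0.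
Qed.

Lemma fourierL1_sum (F : nat -> 'cV[R]_n.+1 -> R[i]) k xi :
  (forall i, inLp 1%:E (F i)) ->
  fourierL1 (fun x => \sum_(0 <= i < k) F i x) xi =
  \sum_(0 <= i < k) fourierL1 (F i) xi.
Proof.
move=> F1; elim: k => [|k IH].
  rewrite big_nil -[RHS](fourierL1_0 xi); congr fourierL1.
  by apply/funext => x; rewrite big_nil.
rewrite big_nat_recr//= -IH -fourierL1D//; last exact: inL1_sum.
by congr fourierL1; apply/funext => x; rewrite big_nat_recr.
Qed.

(** The partial sums lie in L1 and in L2, and they converge to psi in L2 while their
transforms converge to psihat in L2: this is the graph closure that defines the
transform. *)
Lemma is_fourier_series (f g : nat -> 'cV[R]_n.+1 -> R[i]) (Q : R) : 0 <= Q ->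
  (forall i, inLp 1%:E (f i)) -> (forall i, cmeasurable (g i)) ->
  (forall i xi, fourierL1 (f i) xi = g i xi) ->
  (forall i, \int[leb]_x (normc (f i x) ^+ 2)%:E <= (Q / 4 ^+ i)%:E)%E ->
  (forall i, \int[leb]_x (normc (g i x) ^+ 2)%:E <= (Q / 4 ^+ i)%:E)%E ->
  exists psi psihat : 'cV[R]_n.+1 -> R[i], [/\ is_fourier psi psihat,
    forall xi, ((normc (psihat xi) ^+ 2)%:E <=
      2%:E * \sum_(i <oo) (2 ^+ i * normc (g i xi) ^+ 2)%:E)%E &
    forall xi, (\sum_(i <oo) (2 ^+ i * normc (g i xi) ^+ 2)%:E < +oo)%E ->
      series (fun i => complex.Re (g i xi)) @ \oo --> complex.Re (psihat xi)].
Proof.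
move=> Q0 f1 mg fg fQ gQ.
have mf i : cmeasurable (f i) by have [] := f1 i.
have [F [mF tF _ _]] := complex_L2_series Q0 mf fQ.
have [G [mG tG uG cG]] := complex_L2_series Q0 mg gQ.
exists F, G; split => //.
have L2 (H : nat -> 'cV[R]_n.+1 -> R[i]) (U : 'cV[R]_n.+1 -> R[i]) : cmeasurable U ->
    (forall k, (\int[leb]_x (normc (\sum_(0 <= i < k) H i x - U x) ^+ 2)%:E <=
      (4 * Q / 2 ^+ k)%:E)%E) -> inLp 2%:E U.
  move=> mU tU; apply/(inL2P mU); apply: le_lt_trans (le_trans _ (tU 0)) (ltry _).
  by under [leRHS]eq_integral do rewrite big_nil sub0r normcN.
split; [exact: L2 tF|exact: L2 tG|].
exists (fun k x => \sum_(0 <= i < k) f i x); split=> [k||].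
- split; first exact: inL1_sum.
  apply: inL2_sum => i; apply/(inL2P (mf i)).
  exact: le_lt_trans (fQ i) (ltry _).
- by apply: cLnorm2_cvg0 tF; rewrite mulr_ge0.
- apply: (@cLnorm2_cvg0 _ _ _ (4 * Q)) => [|k]; first by rewrite mulr_ge0.
  under eq_integral do rewrite fourierL1_sum//.
  under eq_integral do under eq_bigr do rewrite fg.
  exact: tG.
Qed.

End fourier_linear.

Section dilated_tents.
Variables (R : realType) (n : nat) (d : R) (a : 'cV[R]_n.+1).
Variables (T : nat -> 'M[R]_n.+1) (b : nat -> R).
Hypotheses (d_gt0 : 0 < d) (uT : forall i, T i \in unitmx)
  (b_ge0 : forall i, 0 <= b i) (b1 : forall i, b i ^+ 2 <= 4 ^- i)
  (bT : forall i, b i ^+ 2 * `|\det (T i)| <= 4 ^- i).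
Local Notation leb := (lebesgue_cV R n.+1).

Let g i xi : R[i] := (b i)%:C * tent_at d a (invmx (T i) *m xi).

Let normc_g i xi : normc (g i xi) = b i * product_tent d (invmx (T i) *m xi - a).
Proof. by rewrite normcM normc_real (ger0_norm (b_ge0 i)) normc_tent_at. Qed.

Lemma dilated_tents_weighted_sum xi (t : R) :
  (forall i, product_tent d (invmx (T i) *m xi - a) ^+ 2 <= t) ->
  (\sum_(i <oo) (2 ^+ i * normc (g i xi) ^+ 2)%:E <= (2 * t)%:E)%E.
Proof.
move=> ht; have t0 : 0 <= t by exact: le_trans (sqr_ge0 _) (ht 0).
apply: nneseries_le_bound => [i|k].
  by rewrite lee_fin mulr_ge0 ?sqr_ge0 ?exprn_ge0.
rewrite sumEFin lee_fin (le_trans _ (sum_half_le k t0))//.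
apply: ler_sum => i _; rewrite normc_g exprMn mulrA.
have p0 : 0 < 2 ^+ i :> R by rewrite exprn_gt0.
have h : 2 ^+ i * b i ^+ 2 <= (2 ^+ i)^-1.
  rewrite -ler_pdivlMl// (le_trans (b1 i))//.
  have -> : 4 ^+ i = 2 ^+ i * 2 ^+ i :> R by rewrite -exprMn -natrM.
  by rewrite invfM.
rewrite [leRHS]mulrC; apply: ler_pM => //; last exact: sqr_ge0.
by rewrite mulr_ge0 ?sqr_ge0 ?ltW.
Qed.

(** The two bounds on b are the sizes of the i-th terms of the two series in L2, on
the frequency side and on the space side, up to a constant.  The lower bound
comes from the positivity of the terms. *)
Lemma dilated_tents : exists psi psihat : 'cV[R]_n.+1 -> R[i],
  [/\ is_fourier psi psihat,
    forall xi, ((normc (psihat xi) ^+ 2)%:E <=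
      2%:E * \sum_(i <oo) (2 ^+ i * (b i ^+ 2 *
        product_tent d (invmx (T i) *m xi - a) ^+ 2))%:E)%E &
    forall i xi, b i * product_tent d (invmx (T i) *m xi - a) <= normc (psihat xi)].
Proof.
pose f i x : R[i] := (b i)%:C * dilate (T i) (tent_inv d a) x.
pose I1 : \bar R := (\int[leb]_x (normc (tent_inv d a x) ^+ 2)%:E)%E.
pose I2 : \bar R := (\int[leb]_x (normc (tent_at d a x) ^+ 2)%:E)%E.
have m1 := cmeasurable_tent_inv d a; have m2 := cmeasurable_tent_at d a.
have I1_0 : (0 <= I1)%E by apply: integral_ge0 => x _; rewrite lee_fin sqr_ge0.
have I2_0 : (0 <= I2)%E by apply: integral_ge0 => x _; rewrite lee_fin sqr_ge0.
have I1y : (I1 < +oo)%E by apply/(inL2P m1); exact: tent_inv_L2.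
have I2y : (I2 < +oo)%E by apply/(inL2P m2); exact: tent_at_L2.
pose Q := fine I1 + fine I2.
have Q0 : 0 <= Q by rewrite addr_ge0 ?fine_ge0.
have I1Q : (I1 <= Q%:E)%E.
  by rewrite -[I1]fineK ?ge0_fin_numE// lee_fin /Q lerDl fine_ge0.
have I2Q : (I2 <= Q%:E)%E.
  by rewrite -[I2]fineK ?ge0_fin_numE// lee_fin /Q lerDr fine_ge0.
have p4 i : 0 <= 4 ^- i :> R by rewrite invr_ge0 exprn_ge0.
have bound i (I : \bar R) : (I <= Q%:E)%E -> (0 <= I)%E ->
    ((b i ^+ 2)%:E * (`|\det (T i)|%:E * I) <= (Q / 4 ^+ i)%:E)%E.
  move=> IQ I0; rewrite muleA -EFinM [Q / _]mulrC [X in (_ <= X)%E]EFinM.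
  by apply: lee_pmul => //; rewrite lee_fin// mulr_ge0 ?sqr_ge0.
have mg i : cmeasurable (g i).
  by apply: cmeasurableZ; exact: cmeasurable_linear.
have f1 i : inLp 1%:E (f i).
  by apply: inL1Z; apply: inL1_dilate => //; exact: tent_inv_L1.
have fg i xi : fourierL1 (f i) xi = g i xi.
  rewrite fourierL1Z; last by apply: inL1_dilate => //; exact: tent_inv_L1.
  rewrite fourierL1_dilate//; last exact: tent_inv_L1.
  by rewrite fourierL1_tent_inv.
have fQ i : (\int[leb]_x (normc (f i x) ^+ 2)%:E <= (Q / 4 ^+ i)%:E)%E.
  under eq_integral do rewrite normcM exprMn normc_real (ger0_norm (b_ge0 i)) EFinM.
  have md := measurable_normc_sqr (cmeasurable_dilate (T i) m1).
  rewrite ge0_integralZl//; last 2 first.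
  - by move=> x _; rewrite lee_fin sqr_ge0.
  - by rewrite lee_fin sqr_ge0.
  by rewrite integral_dilate_sqr//; exact: bound.
have gQ i : (\int[leb]_x (normc (g i x) ^+ 2)%:E <= (Q / 4 ^+ i)%:E)%E.
  under eq_integral do rewrite normcM exprMn normc_real (ger0_norm (b_ge0 i)) EFinM.
  have md := measurable_normc_sqr (cmeasurable_linear (invmx (T i)) m2).
  rewrite ge0_integralZl//; last 2 first.
  - by move=> x _; rewrite lee_fin sqr_ge0.
  - by rewrite lee_fin sqr_ge0.
  rewrite (ge0_integral_linear (A := invmx (T i))
    (g := fun x => (normc (tent_at d a x) ^+ 2)%:E)).
  - by rewrite det_inv normfV invrK; exact: bound.
  - by rewrite unitmx_inv.
  - exact: measurable_normc_sqr.
  - by move=> x; rewrite lee_fin sqr_ge0.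
have [psi [psihat [pp up cv]]] := is_fourier_series Q0 f1 mg fg fQ gQ.
exists psi, psihat; split=> // [xi|i xi].
  apply: (le_trans (up xi)); rewrite le_eqVlt; apply/orP; left; apply/eqP.
  congr (_ * _)%E; apply: eq_eseriesr => i _.
  by rewrite normc_g exprMn.
have tle m : product_tent d (invmx (T m) *m xi - a) ^+ 2 <= (d ^+ n.+1) ^+ 2.
  rewrite lerXn2r ?nnegrE ?product_tent_ge0 ?exprn_ge0 ?(ltW d_gt0)//.
  by rewrite product_tent_le ?ltW.
have := cv xi (le_lt_trans (dilated_tents_weighted_sum tle) (ltry _)).
have -> : (fun m => complex.Re (g m xi)) =
    (fun m => b m * product_tent d (invmx (T m) *m xi - a)).
  by apply/funext => m; rewrite /g complex_ReM/= mul0r subr0.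
move=> cvg_re; apply: le_trans (le_trans (ler_norm _) (Re_le_normc _)).
have g0 m : 0 <= b m * product_tent d (invmx (T m) *m xi - a).
  by rewrite mulr_ge0 ?product_tent_ge0.
apply: (ler_cvg_to (cvg_cst _) cvg_re); near=> m.
rewrite /series/= (big_cat_nat (n := i.+1))//=; last by near: m; exists i.+1.
rewrite big_nat_recr//= -addrA addrCA lerDl addr_ge0//.
  by apply: sumr_ge0 => k _.
by apply: sumr_ge0 => k _.
Unshelve. all: by end_near. Qed.

End dilated_tents.

(** * Integer powers and the Euclidean ball *)

Section integer_powers.
Variables (R : realType) (n : nat) (B : 'M[R]_n.+1).
Hypothesis uB : B \in unitmx.

Lemma unitmx_exprz j : B ^ j \in unitmx.
Proof.
case: j => m; first exact: (@unitrX _ B m uB).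
rewrite -[B ^ _]/(invmx (B ^+ m.+1)) unitmx_inv.
exact: (@unitrX _ B m.+1 uB).
Qed.

Lemma det_exprn m : \det (B ^+ m) = \det B ^+ m.
Proof.
elim: m => [|m IH]; first by rewrite det1.
by rewrite !exprS -mulmxE det_mulmx IH.
Qed.

Lemma norm_det_exprz j : `|\det (B ^ j)| = `|\det B| ^ j.
Proof.
case: j => m; first by rewrite -[B ^ _]/(B ^+ m) det_exprn normrX.
rewrite -[B ^ _]/(B ^- m.+1) -[_ ^ Negz m]/(_ ^- m.+1).
by rewrite -[B ^- m.+1]/(invmx (B ^+ m.+1)) det_inv normfV det_exprn normrX.
Qed.

Lemma invmx_exprz j : invmx (B ^ j) = B ^ (- j).
Proof. exact: invr_expz. Qed.

Lemma exprzD_mulmx i j (x : 'cV[R]_n.+1) : B ^ i *m (B ^ j *m x) = B ^ (i + j) *m x.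
Proof. by rewrite mulmxA mulmxE -exprzDr. Qed.

Lemma exprzNK j (x : 'cV[R]_n.+1) : B ^ (- j) *m (B ^ j *m x) = x.
Proof. by rewrite exprzD_mulmx addNr expr0z mul1mx. Qed.

End integer_powers.

Section euclidean.
Variables (R : realType) (n : nat).
Implicit Types (x : 'cV[R]_n.+1) (K : set 'cV[R]_n.+1).

Lemma euclidean_ball_entry (r : R) x i : euclidean_ball r x -> `|x i ord0| <= r.
Proof.
rewrite /euclidean_ball/= => xr; apply: le_trans (ltW xr).
rewrite -sqrtr_sqr ler_sqrt; last by apply: sumr_ge0 => k _; rewrite -expr2 sqr_ge0.
rewrite /dotp (bigD1 i)//= -expr2 lerDl.
by apply: sumr_ge0 => k _; rewrite -expr2 sqr_ge0.
Qed.

(** The factor n.+1 is a crude substitute for its square root, and adding 1 makes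
the inequality strict even when s = 0. *)
Lemma euclidean_ball_box (s : R) x : (forall i, `|x i ord0| <= s) ->
  euclidean_ball (s * n.+1%:R + 1) x.
Proof.
move=> xs; have s0 : 0 <= s by exact: le_trans (xs ord0).
have sn0 : 0 <= s * n.+1%:R by rewrite mulr_ge0.
rewrite /euclidean_ball/= (@le_lt_trans _ _ (s * n.+1%:R)) ?ltrDl//.
rewrite -[leRHS]ger0_norm// -sqrtr_sqr ler_sqrt ?sqr_ge0//.
apply: (@le_trans _ _ (\sum_(i < n.+1) s ^+ 2)).
  apply: ler_sum => i _; rewrite -expr2 -[leLHS]real_normK ?num_real//.
  by rewrite lerXn2r ?nnegrE.
rewrite sumr_const card_ord -[leLHS]mulr_natr exprMn ler_wpM2l ?sqr_ge0//.
by rewrite expr2 ler_peMr// ler1n.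
Qed.

Lemma compact_sub_cube K : compact K -> exists2 s, 0 < s & K `<=` cube 0 s.
Proof.
move=> /compact_bounded/ex_strict_bound_gt0[s s0 sK]; exists s => // x Kx i.
have : ball 0 s x by rewrite mx_norm_ball /ball_/= sub0r normrN sK.
by move=> /ball_cVP[_ /(_ i)]; rewrite distrC => /ltW.
Qed.

End euclidean.

(** * The two integrability conditions *)

Section conditions.
Variables (R : realType) (n : nat) (B : 'M[R]_n.+1).
Local Notation leb := (lebesgue_cV R n.+1).
Implicit Types (g fhat : 'cV[R]_n.+1 -> R[i]) (K : set 'cV[R]_n.+1) (j : int).

Lemma sum_ltyP (L : nat) (a : 'I_L -> \bar R) : (forall l, 0 <= a l)%E ->
  (\sum_(l < L) a l < +oo)%E <-> (forall l, a l < +oo)%E.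
Proof.
move=> a0; split=> [sa l|al].
  apply: le_lt_trans sa; rewrite (bigD1 l)//= leeDl//.
  by apply: sume_ge0 => i _.
by apply: lte_sum_pinfty => l _.
Qed.

Lemma measurable_fsupp g : cmeasurable g -> measurable (fsupp g).
Proof.
move=> /measurable_normc mg.
have -> : fsupp g = (fun x => normc (g x)) @^-1` `]0, +oo[.
  apply/seteqP; split=> x /=; rewrite in_itv/= andbT.
    move=> gx; rewrite lt_neqAle normc_ge0 andbT eq_sym.
    by apply: contraNneq gx => /eq0_normc ->.
  by rewrite /fsupp/= => gx; apply: contraTneq gx => ->; rewrite normc0 ltxx.
by rewrite -[X in measurable X]setTI; exact: mg.
Qed.

(** The share of the scale j in the Calderon sum over K. *)
Definition orbit_energy g K j : \bar R :=
  (\int[leb]_(xi in K) (normc (g (B ^ (- j) *m xi)) ^+ 2)%:E)%E.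

Lemma orbit_energy_ge0 g K j : (0 <= orbit_energy g K j)%E.
Proof. by apply: integral_ge0 => x _; rewrite lee_fin sqr_ge0. Qed.

Lemma measurable_orbit_sqr g j (D : set 'cV[R]_n.+1) : cmeasurable g ->
  measurable_fun D (fun xi => (normc (g (B ^ (- j) *m xi)) ^+ 2)%:E).
Proof.
move=> mg; apply: (@measurable_funS _ _ _ _ setT) => //.
exact: measurable_normc_sqr (cmeasurable_linear _ mg).
Qed.

Lemma integral_orbit_sum g K : cmeasurable g -> measurable K ->
  (\int[leb]_(xi in K) (\esum_(j in [set: int]) (normc (g (B ^ (- j) *m xi)) ^+ 2)%:E) =
   \esum_(j in [set: int]) orbit_energy g K j)%E.
Proof.
move=> mg mK; rewrite ge0_integral_esum_int// => j *.
  by rewrite lee_fin sqr_ge0.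
exact: measurable_orbit_sqr.
Qed.

(** Everything is nonnegative, so integrability means that the integral is finite,
and the integral commutes with the sums. *)
Lemma calderonP (E : set 'cV[R]_n.+1) (L : nat) (psihat : 'I_L -> 'cV[R]_n.+1 -> R[i]) :
  (forall l, cmeasurable (psihat l)) ->
  calderon_condition B E psihat <->
  forall K, compact K -> K `<=` ~` E -> forall l,
    (\esum_(j in [set: int]) orbit_energy (psihat l) K j < +oo)%E.
Proof.
move=> mp; pose F l xi : \bar R :=
  \esum_(j in [set: int]) (normc (psihat l (B ^ (- j) *m xi)) ^+ 2)%:E.
have F0 l xi : (0 <= F l xi)%E by apply: esum_ge0 => j _; rewrite lee_fin sqr_ge0.
have mF l D : measurable_fun D (F l).
  apply: emeasurable_esum_int => [j x|j]; first by rewrite lee_fin sqr_ge0.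
  exact: measurable_orbit_sqr.
suff KP K : compact K -> leb.-integrable K (fun xi => \sum_(l < L) F l xi)%E <->
    forall l, (\esum_(j in [set: int]) orbit_energy (psihat l) K j < +oo)%E.
  by split=> h K cK KE; apply/(KP K cK); exact: h.
move=> cK; have mK := compact_measurable_cV cK.
have IE : (\int[leb]_(xi in K) (\sum_(l < L) F l xi) =
    \sum_(l < L) \esum_(j in [set: int]) orbit_energy (psihat l) K j)%E.
  rewrite ge0_integral_sum//.
  by apply: eq_bigr => l _; rewrite integral_orbit_sum.
have e0 l : (0 <= \esum_(j in [set: int]) orbit_energy (psihat l) K j)%E.
  by apply: esum_ge0 => j _; exact: orbit_energy_ge0.
rewrite -(sum_ltyP e0) -IE; split=> [/integrableP[_]|].
  by under eq_integral do rewrite gee0_abs ?sume_ge0//.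
move=> Iy; apply/integrableP; split; last first.
  by under eq_integral do rewrite gee0_abs ?sume_ge0//.
by apply: emeasurable_sum => l; exact: mF.
Qed.

Definition lic_term g fhat j (k : 'cV[R]_n.+1) : \bar R :=
  (\int[leb]_(xi in fsupp fhat)
     (normc (fhat (xi + B ^ j *m k)) ^+ 2 * normc (g (B ^ (- j) *m xi)) ^+ 2)%:E)%E.

Lemma lic_term_ge0 g fhat j k : (0 <= lic_term g fhat j k)%E.
Proof. by apply: integral_ge0 => x _; rewrite lee_fin mulr_ge0 ?sqr_ge0. Qed.

Lemma licP (E G : set 'cV[R]_n.+1) (L : nat) (psihat : 'I_L -> 'cV[R]_n.+1 -> R[i]) :
  local_integrability_condition B G E psihat <->
  forall f fhat, D_space E f fhat -> forall l,
    (\esum_(j in [set: int]) \esum_(k in G) lic_term (psihat l) fhat j k < +oo)%E.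
Proof.
have e0 fhat l : (0 <= \esum_(j in [set: int]) \esum_(k in G) lic_term (psihat l) fhat j k)%E.
  by apply: esum_ge0 => j _; apply: esum_ge0 => k _; exact: lic_term_ge0.
split=> h f fhat Df; first exact/(sum_ltyP (e0 fhat))/(h f).
exact/(sum_ltyP (e0 fhat))/(h f).
Qed.

Lemma cmeasurable_translate g (b : 'cV[R]_n.+1) :
  cmeasurable g -> cmeasurable (fun x => g (x + b)).
Proof.
have mb : measurable_fun setT (fun x : 'cV[R]_n.+1 => x + b).
  by have := measurable_mulmxD 1%:M b; under eq_fun do rewrite mul1mx.
move=> [mre mim]; split; first exact: (measurableT_comp mre mb).
exact: (measurableT_comp mim mb).
Qed.

Lemma measurable_lic_integrand g fhat j k (D : set 'cV[R]_n.+1) :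
  cmeasurable g -> cmeasurable fhat ->
  measurable_fun D (fun xi => (normc (fhat (xi + B ^ j *m k)) ^+ 2 *
    normc (g (B ^ (- j) *m xi)) ^+ 2)%:E).
Proof.
move=> mg mf; apply: (@measurable_funS _ _ _ _ setT) => //.
apply/measurable_EFinP; apply: measurable_funM; apply: measurable_funX; apply: measurable_normc.
  exact: cmeasurable_translate.
exact: cmeasurable_linear.
Qed.

Lemma lic_term_lower g fhat j k (Q : set 'cV[R]_n.+1) (c : R) :
  cmeasurable g -> cmeasurable fhat -> measurable Q -> Q `<=` fsupp fhat ->
  0 <= c -> (forall xi, Q xi -> c <= normc (fhat (xi + B ^ j *m k)) ^+ 2) ->
  (c%:E * orbit_energy g Q j <= lic_term g fhat j k)%E.
Proof.
move=> mg mf mQ Qf c0 cQ.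
rewrite /orbit_energy -ge0_integralZl//; last 2 first.
- exact: measurable_orbit_sqr.
- by move=> x _; rewrite lee_fin sqr_ge0.
apply: (@le_trans _ _ (\int[leb]_(xi in Q) (normc (fhat (xi + B ^ j *m k)) ^+ 2 *
    normc (g (B ^ (- j) *m xi)) ^+ 2)%:E)%E).
  apply: ge0_le_integral => //.
  - by move=> x _; rewrite mule_ge0 ?lee_fin ?sqr_ge0.
  - by apply: measurable_funeM; exact: measurable_orbit_sqr.
  - exact: measurable_lic_integrand.
  - by move=> x Qx; rewrite -EFinM lee_fin ler_wpM2r ?sqr_ge0 ?cQ.
apply: ge0_subset_integral => //.
- exact: measurable_fsupp.
- exact: measurable_lic_integrand.
- by move=> x _; rewrite lee_fin mulr_ge0 ?sqr_ge0.
Qed.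

(** The bound on fhat holds almost everywhere only; it survives the translation by
B^j k because translations preserve null sets. *)
Lemma lic_term_upper g fhat j k K (M : R) :
  cmeasurable g -> cmeasurable fhat -> measurable K -> fsupp fhat `<=` K ->
  0 <= M -> {ae leb, forall x, normc (fhat x) <= M} ->
  (lic_term g fhat j k <= (M ^+ 2)%:E * orbit_energy g K j)%E.
Proof.
move=> mg mf mK fK M0 fM.
rewrite /orbit_energy -ge0_integralZl//; last 3 first.
- exact: measurable_orbit_sqr.
- by move=> x _; rewrite lee_fin sqr_ge0.
- by rewrite lee_fin sqr_ge0.
apply: (@le_trans _ _ (\int[leb]_(xi in K) (normc (fhat (xi + B ^ j *m k)) ^+ 2 *
    normc (g (B ^ (- j) *m xi)) ^+ 2)%:E)%E).
  apply: ge0_subset_integral => //.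
  - exact: measurable_fsupp.
  - exact: measurable_lic_integrand.
  - by move=> x _; rewrite lee_fin mulr_ge0 ?sqr_ge0.
apply: ae_ge0_le_integral => //.
- by move=> x _; rewrite lee_fin mulr_ge0 ?sqr_ge0.
- exact: measurable_lic_integrand.
- by move=> x _; rewrite mule_ge0 ?lee_fin ?sqr_ge0.
- by apply: measurable_funeM; exact: measurable_orbit_sqr.
- apply: filterS (ae_translate (B ^ j *m k) fM) => x xM _.
  by rewrite -EFinM lee_fin ler_wpM2r ?sqr_ge0// lerXn2r ?nnegrE ?normc_ge0.
Qed.

End conditions.

(** * The expanding dynamics and the three implications *)

Section expanding.
Variables (R : realType) (n : nat) (B : 'M[R]_n.+1).
Variables (q : 'cV[R]_n.+1 -> R) (lam : R).
Hypotheses (uB : B \in unitmx) (lam1 : 1 < lam) (q_ge0 : forall x, 0 <= q x)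
  (qD : forall x y, q (x + y) <= q x + q y)
  (qZ : forall c x, q (c *: x) = `|c| * q x)
  (qB : forall x, lam * q x <= q (B *m x))
  (qE : forall x, q x = 0 <-> central_space B x).
Local Notation E := (central_space B).
Local Notation leb := (lebesgue_cV R n.+1).
Local Notation maxdet j := (Num.max 1 (`|\det B| ^ j)).
Implicit Types (g fhat : 'cV[R]_n.+1 -> R[i]) (G K : set 'cV[R]_n.+1).

Lemma off_central_gt0 x : (~` E) x -> 0 < q x.
Proof. by move=> nEx; rewrite lt_neqAle q_ge0 andbT eq_sym; apply/eqP => /qE. Qed.

Lemma cube_off_central x : (~` E) x -> exists2 e, 0 < e & cube x e `<=` ~` E.
Proof.
move=> /off_central_gt0 qx; apply: nbhs_cubeP.
have /(seminorm_continuous q_ge0 qD qZ (x := x)) : nbhs (q x) [set t | 0 < t].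
  by apply: open_nbhs_nbhs; split => //; exact: open_gt.
by apply: (@filterS _ (nbhs x)) => y /= qy /qE qy0; move: qy; rewrite qy0 ltxx.
Qed.

(** Moving far along a direction with q > 0 leaves room for a cube of any given size
off E. *)
Lemma cube_off_central_radius (r : R) : (exists x, 0 < q x) -> 0 < r ->
  exists x, cube x r `<=` ~` E.
Proof.
move=> [x qx] r0; have [C C0 qC] := seminorm_bound q_ge0 qD qZ.
exists (((C * r + 1) / q x) *: x) => y yx /qE qy0.
have Cr : 0 <= C * r by rewrite mulr_ge0 ?ltW.
have : q (((C * r + 1) / q x) *: x) <= q y + C * r.
  rewrite -[X in q X](subrK y) addrC (le_trans (qD _ _))// lerD2l.
  by apply: qC => i; have := yx i; rewrite distrC !mxE.
rewrite qy0 add0r qZ ger0_norm ?divr_ge0 ?addr_ge0//.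
by rewrite divfK ?gt_eqF// gerDl ler10.
Qed.

(** The terms that do not vanish lie in a window of N + 1 indices.  The window is
reversed and shifted in the second case, which is that of a tent transported by
negative powers of B. *)
Lemma esum_visits (K : set 'cV[R]_n.+1) : compact K -> K `<=` ~` E ->
  exists N : nat, forall (x : 'cV[R]_n.+1) (a : int -> \bar R) (c : R) (s : int),
    0 <= c -> (forall j, (0 <= a j <= c%:E)%E) ->
    (forall j, a j != 0%E -> K (B ^ j *m x)) \/
    (forall j, a j != 0%E -> K (B ^ (- (s + j)) *m x)) ->
    (\esum_(j in [set: int]) a j <= (c * N.+1%:R)%:E)%E.
Proof.
move=> cK KE; have Kq x : K x -> 0 < q x by move=> /KE/off_central_gt0.
have [N NP] := orbit_visits q_ge0 qD qZ lam1 qB uB cK Kq.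
exists N => x a c s c0 ac [aK|aK]; have [j0 j0P] := NP x.
  by apply: (esum_window c0 ac (j0 := j0)) => j /aK/j0P.
apply: (esum_window c0 ac (j0 := - (j0 + N%:Z) - s)) => j /aK/j0P/andP[j1 j2].
rewrite lerBlDr lerNl opprD [- j - s]addrC -opprD j2/=.
by rewrite addrAC opprD subrK lerBrDl lerNr.
Qed.

(** Only the term k = 0 is used.  The tent over the cube of half-width d at x is at
least (d / 2)^(n + 1) on the half cube. *)
Lemma calderon_of_lic G (L : nat) (psihat : 'I_L -> 'cV[R]_n.+1 -> R[i]) :
  G 0 -> (forall l, cmeasurable (psihat l)) ->
  local_integrability_condition B G E psihat -> calderon_condition B E psihat.
Proof.
move=> G0 mp /licP lic; apply/calderonP => // K cK KE l.
set g := psihat l; have mg : cmeasurable g := mp l.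
have /choice[d dP] x : exists e, K x -> 0 < e /\ cube x e `<=` ~` E.
  have [Kx|nKx] := pselect (K x); last by exists 0.
  by have [e e0 eE] := cube_off_central (KE x Kx); exists e.
have d20 x : K x -> 0 < d x / 2 by move=> /dP[d0 _]; rewrite divr_gt0.
have [s sK Ks] := compact_cube_cover cK d20.
have mQ x : measurable (cube x (d x / 2)) by exact: measurable_box.
have mo j := @measurable_orbit_sqr _ _ B g j setT mg.
apply: (@le_lt_trans _ _ (\esum_(j in [set: int])
    \sum_(x <- s) orbit_energy B g (cube x (d x / 2)) j)%E).
  apply: le_esum => j _; apply: le_trans (ge0_integral_bigsetU_le _ _ mQ (mo j) _); last first.
    by move=> x; rewrite lee_fin sqr_ge0.
  apply: ge0_subset_integral => //.
  - exact: compact_measurable_cV.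
  - by apply: bigsetU_measurable => x _; exact: mQ.
  - exact: measurable_orbit_sqr.
  - by move=> x _; rewrite lee_fin sqr_ge0.
rewrite esum_sum; last by move=> *; exact: orbit_energy_ge0.
rewrite big_seq; apply: lte_sum_pinfty => x xs.
have [d0 dE] := dP x (sK x xs).
have Df := D_space_tent d0 dE.
pose c := ((d x / 2) ^+ n.+1) ^+ 2.
have c0 : 0 < c by rewrite !exprn_gt0// divr_gt0.
have := lic _ _ Df l; apply: contraTT; rewrite -!leNgt leye_eq => /eqP Ey.
have <- : (c%:E * (\esum_(j in [set: int]) orbit_energy B g (cube x (d x / 2)) j) = +oo)%E.
  by rewrite Ey gt0_muley// lte_fin.
rewrite -esumZl; [|exact: ltW|by move=> j; exact: orbit_energy_ge0].
apply: le_esum => j _.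
apply: le_trans (esum_ge1 (fun k => lic_term B g (tent_at (d x) x) j k) G0).
have half xi : cube x (d x / 2) xi -> (d x / 2) ^+ n.+1 <= normc (tent_at (d x) x xi).
  move=> xiQ; apply: le_normc_tent_at; first by rewrite divr_ge0 ?ltW.
  by rewrite [X in X - _]splitr addrK.
apply: lic_term_lower => //.
- exact: cmeasurable_tent_at.
- move=> xi /half h; apply/eqP => t0; move: h; rewrite t0 normc0.
  by rewrite leNgt exprn_gt0// divr_gt0.
- exact: ltW.
- move=> xi /half; rewrite mulmx0 addr0 => h.
  by rewrite lerXn2r ?nnegrE ?normc_ge0// exprn_ge0// divr_ge0// ltW.
Qed.

(** The change of variables xi = B^j eta absorbs the power of the determinant; then
the sum over j counts the visits of eta to K. *)
Lemma weighted_energy_lty g K : cmeasurable g -> inLp 2%:E g ->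
  compact K -> K `<=` ~` E ->
  (\esum_(j in [set: int]) ((`|\det B| ^ (- j))%:E * orbit_energy B g K j) < +oo)%E.
Proof.
move=> mg /(inL2P mg) g2 cK KE; have mK := compact_measurable_cV cK.
have [N NP] := esum_visits cK KE.
pose h xi := normc (g xi) ^+ 2.
pose v j eta := (\1_K (B ^ j *m eta) * h eta)%:E : \bar R.
have mh : measurable_fun setT (fun xi => (h xi)%:E) by exact: measurable_normc_sqr.
have m1 : measurable_fun setT (\1_K : 'cV[R]_n.+1 -> R) by exact: measurable_indic.
have mB j : measurable_fun setT (fun x : 'cV[R]_n.+1 => B ^ j *m x).
  by have := measurable_mulmxD (B ^ j) 0; under eq_fun do rewrite addr0.
have mv j : measurable_fun setT (v j).
  apply/measurable_EFinP; apply: measurable_funM; last exact/measurable_EFinP.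
  exact: (measurableT_comp m1 (mB j)).
have v0 j x : (0 <= v j x)%E by rewrite lee_fin mulr_ge0 ?sqr_ge0.
have vE j : ((`|\det B| ^ (- j))%:E * orbit_energy B g K j = \int[leb]_x v j x)%E.
  pose F xi := (\1_K xi * h (B ^ (- j) *m xi))%:E : \bar R.
  have -> : orbit_energy B g K j = (\int[leb]_xi F xi)%E.
    rewrite /orbit_energy integral_mkcond; apply: eq_integral => x _.
    by rewrite patchE /F indicE; case: (x \in K); rewrite ?mul1r ?mul0r.
  have -> : `|\det B| ^ (- j) = `|\det (B ^ j)|^-1.
    by rewrite norm_det_exprz invr_expz.
  rewrite -ge0_integral_linear ?unitmx_exprz//.
  - by apply: eq_integral => x _; rewrite /F exprzNK.
  - apply/measurable_EFinP; apply: measurable_funM => //.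
    by apply/measurable_EFinP; exact: (measurableT_comp mh (mB _)).
  - by move=> x; rewrite lee_fin mulr_ge0 ?sqr_ge0.
under eq_esum do rewrite vE.
rewrite -ge0_integral_esum_int//.
apply: (@le_lt_trans _ _ (\int[leb]_x (N.+1%:R%:E * (h x)%:E))%E).
  apply: ge0_le_integral => //.
  - by move=> x _; apply: esum_ge0 => j _.
  - exact: emeasurable_esum_int.
  - exact: measurable_funeM.
  - move=> x _; rewrite -EFinM mulrC; apply: (NP x (v^~ x) (h x) 0 (sqr_ge0 _)).
      move=> j; rewrite v0 lee_fin ler_piMl ?sqr_ge0//.
    left=> j; rewrite /v indicE; have [/set_mem//|nK] := boolP (_ \in K).
    by rewrite mul0r eqxx.
rewrite ge0_integralZl//; last by move=> x _; rewrite lee_fin sqr_ge0.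
by rewrite lte_mul_pinfty ?lee_fin.
Qed.

(** Two points of the support of fhat that differ by B^j k confine k to the image
under B^-j of a ball, where the counting estimate applies at -j. *)
Lemma lic_of_calderon G (L : nat) (psihat : 'I_L -> 'cV[R]_n.+1 -> R[i]) :
  lattice_counting_estimate B G -> (forall l, inLp 2%:E (psihat l)) ->
  calderon_condition B E psihat -> local_integrability_condition B G E psihat.
Proof.
move=> lce p2; have mp l : cmeasurable (psihat l) by case: (p2 l).
move=> /(calderonP _ _ mp) cal; apply/licP => f fhat Df l.
have [_ /[dup] -[mf _] /inLpy_ae_bounded[M M0 fM] cK KE] := Df.
set K := closure (fsupp fhat) in cK KE; set g := psihat l.
have mg : cmeasurable g := mp l; have mK := compact_measurable_cV cK.
have fK : fsupp fhat `<=` K by exact: subset_closure.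
have [s s0 Ks] := compact_sub_cube cK.
(* K - K lies in the cube of half-width 2 s *)
have [|C HC] := lce (2 * s * n.+1%:R + 1); first by rewrite ltr_wpDl ?mulr_ge0 ?ltW.
set r := 2 * s * n.+1%:R + 1 in HC.
have near_lattice j k : lic_term B g fhat j k != 0%E ->
    [set B ^ (- j) *m x | x in euclidean_ball r] k.
  move=> tk; have [[xi [xi0 xik]]|] :=
    pselect (exists xi, fsupp fhat xi /\ fsupp fhat (xi + B ^ j *m k)).
    exists (B ^ j *m k); last by rewrite exprzNK.
    apply: euclidean_ball_box => i; have := Ks _ (fK _ xi0) i; have := Ks _ (fK _ xik) i.
    rewrite !mxE !subr0 => h1 h2.
    set a := xi i ord0 in h1 h2; set b := (X in _ + X) in h1 *.
    change (`|b| <= 2 * s).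
    rewrite -[b](addKr a) (le_trans (ler_normD _ _))// normrN mulr_natl mulr2n.
    exact: lerD.
  move=> nxi; move: tk; rewrite /lic_term integral0_eq ?eqxx// => xi xi0.
  have -> : fhat (xi + B ^ j *m k) = 0.
    by apply/eqP; apply: contrapT => /negP h; apply: nxi; exists xi.
  by rewrite normc0 expr0n mul0r.
have Jfin j : exists2 J, 0 <= J & orbit_energy B g K j = J%:E.
  have Jlt : (orbit_energy B g K j < +oo)%E.
    exact: le_lt_trans (esum_ge1 (orbit_energy B g K) (I : [set: int] j)) (cal K cK KE l).
  exists (fine (orbit_energy B g K j)); first by rewrite fine_ge0 ?orbit_energy_ge0.
  by rewrite fineK// ge0_fin_numE ?orbit_energy_ge0.
pose c := M ^+ 2 * `|C|; have c0 : 0 <= c by rewrite mulr_ge0 ?sqr_ge0.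
have db0 j : 0 <= `|\det B| ^ j by rewrite exprz_ge0.
apply: (@le_lt_trans _ _ (\esum_(j in [set: int]) (c%:E * (orbit_energy B g K j +
    (`|\det B| ^ (- j))%:E * orbit_energy B g K j)))%E).
  apply: le_esum => j _; have [J J0 JE] := Jfin j.
  rewrite JE (_ : (_ * _)%E = (c * (J + `|\det B| ^ (- j) * J))%:E)//.
  apply: (@le_trans _ _ (\esum_(k in G `&` [set B ^ (- j) *m x | x in euclidean_ball r])
      (M ^+ 2 * J)%:E)%E).
    rewrite esum_mkcondr; apply: le_esum => k _; case: ifPn => [_|nk].
      by rewrite EFinM -JE; exact: lic_term_upper.
    have [->//|/near_lattice/mem_set kk] := eqVneq (lic_term B g fhat j k) 0%E.
    by rewrite kk in nk.
  rewrite esum_cst ?mulr_ge0 ?sqr_ge0//.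
  apply: (@le_trans _ _ ((M ^+ 2 * J)%:E * (C * Num.max 1 (`|\det B| ^ (- j)))%:E)%E).
    by rewrite lee_wpmul2l ?lee_fin ?mulr_ge0 ?sqr_ge0.
  rewrite -EFinM lee_fin /c.
  have -> : M ^+ 2 * `|C| * (J + `|\det B| ^ (- j) * J) =
      M ^+ 2 * J * (`|C| * (1 + `|\det B| ^ (- j))) by ring.
  rewrite ler_wpM2l ?mulr_ge0 ?sqr_ge0//.
  apply: le_trans (ler_wpM2r _ (ler_norm C)) _; first by rewrite le_max ler01.
  by rewrite ler_wpM2l// ge_max lerDl db0 lerDr ler01.
have e0 j : (0 <= orbit_energy B g K j)%E by exact: orbit_energy_ge0.
have w0 j : (0 <= (`|\det B| ^ (- j))%:E * orbit_energy B g K j)%E.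
  by rewrite mule_ge0// lee_fin.
rewrite esumZl//; last by move=> j; rewrite adde_ge0.
rewrite esumD// lte_mul_pinfty// lte_add_pinfty//; first exact: cal.
exact: weighted_energy_lty mg (p2 l) cK KE.
Qed.

Section witness.
Variables (G : set 'cV[R]_n.+1) (r : R) (scale : nat -> int) (x0 : 'cV[R]_n.+1).
Hypotheses (r0 : 0 < r) (x0E : cube x0 (4 * r) `<=` ~` E)
  (many : forall i, ((8 ^+ i * maxdet (scale i))%:E <
     counting (G `&` [set (B ^ (scale i)) *m x | x in euclidean_ball r]))%E).

(** The largest weights that satisfy the two bounds of [dilated_tents]. *)
Let b i : R := Num.sqrt (4 ^- i / maxdet (scale i)).
Let T i := B ^ (scale i).

Let maxdet_ge1 j : 1 <= maxdet j.
Proof. by rewrite le_max lexx. Qed.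

Let maxdet_gt0 j : 0 < maxdet j.
Proof. exact: lt_le_trans ltr01 (maxdet_ge1 j). Qed.

Let p4_gt0 i : 0 < 4 ^- i :> R.
Proof. by rewrite invr_gt0 exprn_gt0. Qed.

Let b_ge0 i : 0 <= b i. Proof. exact: sqrtr_ge0. Qed.

Let b_sqr i : b i ^+ 2 = 4 ^- i / maxdet (scale i).
Proof. by rewrite sqr_sqrtr// divr_ge0// ltW. Qed.

Let b1 i : b i ^+ 2 <= 4 ^- i.
Proof. by rewrite b_sqr ler_pdivrMr// ler_peMr// ltW. Qed.

Let bT i : b i ^+ 2 * `|\det (T i)| <= 4 ^- i.
Proof.
rewrite b_sqr norm_det_exprz -mulrA ler_piMr ?(ltW (p4_gt0 i))//.
by rewrite ler_pdivrMl// mulr1 le_max lexx orbT.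
Qed.

Let uT i : T i \in unitmx. Proof. exact: unitmx_exprz. Qed.

Let sub_cube : cube x0 r `<=` ~` E.
Proof.
move=> x xr; apply: x0E => i; apply: le_trans (xr i) _.
by rewrite ler_peMl ?ltW// ltr1n.
Qed.

(** For each i the bound on visits to the cube controls the sum over j of the squared
tents, and the weights 2^i b_i^2 <= 2^-i sum to at most 2. *)
Lemma superposition_calderon psihat : cmeasurable psihat ->
  (forall xi, ((normc (psihat xi) ^+ 2)%:E <=
      2%:E * \sum_(i <oo) (2 ^+ i * (b i ^+ 2 *
        product_tent r (invmx (T i) *m xi - x0) ^+ 2))%:E)%E) ->
  calderon_condition B E (fun _ : 'I_1 => psihat).
Proof.
move=> mp up; apply/calderonP => // K cK KE _; have mK := compact_measurable_cV cK.
have [N NP] := esum_visits (@compact_cube _ _ x0 r) sub_cube.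
pose t := (r ^+ n.+1) ^+ 2; have t0 : 0 <= t by rewrite sqr_ge0.
pose Th := t * N.+1%:R; have Th0 : 0 <= Th by rewrite mulr_ge0.
have visit i xi : (\esum_(j in [set: int])
    (product_tent r (invmx (T i) *m (B ^ (- j) *m xi) - x0) ^+ 2)%:E <= Th%:E)%E.
  apply: (NP xi _ t (scale i) t0) => [j|].
    rewrite !lee_fin sqr_ge0 lerXn2r ?nnegrE ?product_tent_ge0 ?exprn_ge0 ?(ltW r0)//.
    by rewrite product_tent_le ?ltW.
  right=> j pt0 k; rewrite opprD -exprzD_mulmx// -invmx_exprz.
  have : product_tent r (invmx (T i) *m (B ^ (- j) *m xi) - x0) != 0.
    by apply: contraNneq pt0 => ->; rewrite expr0n.
  by move=> /product_tent_neq0/(_ k); rewrite !mxE => /ltW.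
have pt xi : (\esum_(j in [set: int]) (normc (psihat (B ^ (- j) *m xi)) ^+ 2)%:E
    <= (4 * Th)%:E)%E.
  apply: (@le_trans _ _ (\esum_(j in [set: int]) (2%:E * \sum_(i <oo)
      (2 ^+ i * (b i ^+ 2 *
        product_tent r (invmx (T i) *m (B ^ (- j) *m xi) - x0) ^+ 2))%:E))%E).
    by apply: le_esum => j _; exact: up.
  have a0 i j : (0 <= (2 ^+ i * (b i ^+ 2 *
      product_tent r (invmx (T i) *m (B ^ (- j) *m xi) - x0) ^+ 2))%:E)%E.
    by rewrite lee_fin mulr_ge0 ?exprn_ge0// mulr_ge0 ?sqr_ge0.
  rewrite esumZl//; last by move=> j; apply: nneseries_ge0 => *; exact: a0.
  rewrite (_ : 4 * Th = 2 * (2 * Th)); last by rewrite mulrA -natrM.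
  rewrite EFinM lee_wpmul2l//.
  under eq_esum do rewrite nneseries_esumT//.
  rewrite esum_swap// -nneseries_esumT; last by move=> i; apply: esum_ge0.
  apply: nneseries_le_bound => [i|k]; first exact: esum_ge0.
  apply: (@le_trans _ _ (\sum_(0 <= i < k) (Th / 2 ^+ i)%:E)%E); last first.
    by rewrite sumEFin lee_fin sum_half_le.
  apply: lee_sum => i _.
  under eq_esum do rewrite mulrA EFinM.
  rewrite esumZl ?mulr_ge0 ?sqr_ge0 ?exprn_ge0//; last by move=> j; rewrite lee_fin sqr_ge0.
  rewrite [Th / _]mulrC [leRHS]EFinM; apply: lee_pmul; last exact: visit.
  - by rewrite lee_fin mulr_ge0 ?sqr_ge0 ?exprn_ge0.
  - by apply: esum_ge0 => j _; rewrite lee_fin sqr_ge0.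
  rewrite lee_fin -ler_pdivlMl ?exprn_gt0// (le_trans (b1 i))//.
  by rewrite -invfM -exprMn -natrM.
rewrite -integral_orbit_sum//.
apply: (@le_lt_trans _ _ (\int[leb]_(xi in K) (4 * Th)%:E)%E).
  apply: ge0_le_integral => //.
  - by move=> x _; apply: esum_ge0 => j _; rewrite lee_fin sqr_ge0.
  - apply: emeasurable_esum_int => [j x|j]; first by rewrite lee_fin sqr_ge0.
    exact: measurable_orbit_sqr.
rewrite integral_cst//; apply: lte_mul_pinfty => //; last exact: compact_lebesgue_lty.
by rewrite lee_fin mulr_ge0.
Qed.

(** For a lattice point k in the i-th set and xi in the half cube at x0, the point
xi + B^-j_i k stays within 2 r of x0 in each coordinate, so the tent of
half-width 4 r is at least 2 r in each factor there.  All those k contribute the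
same lower bound, and they outnumber 8^i m_i. *)
Lemma superposition_not_lic psihat : cmeasurable psihat ->
  (forall i xi, b i * product_tent r (invmx (T i) *m xi - x0) <= normc (psihat xi)) ->
  ~ local_integrability_condition B G E (fun _ : 'I_1 => psihat).
Proof.
move=> mp lo /licP lic; have r40 : 0 < 4 * r by rewrite mulr_gt0.
have := lic _ _ (D_space_tent r40 x0E) ord0.
set Tot := (X in (X < _)%E) => Toty.
pose Q := cube x0 (r / 2); pose e := (r / 2) ^+ n.+1; pose h := (2 * r) ^+ n.+1.
have r20 : 0 < r / 2 by rewrite divr_gt0.
have rr0 : 0 < 2 * r by rewrite mulr_gt0.
have e0 : 0 < e by rewrite exprn_gt0.
have h0 : 0 < h by rewrite exprn_gt0.
have mQ : measurable Q by exact: measurable_box.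
pose v : R := (2 * (r / 2)) ^+ n.+1.
have v0 : 0 < v by rewrite exprn_gt0// mulr_gt0.
have lebQ : leb Q = v%:E by exact: (lebesgue_box x0 r20).
pose kap := h ^+ 2 * (e ^+ 2 * v); have kap0 : 0 < kap by rewrite !mulr_gt0// exprn_gt0.
have energy i : ((b i ^+ 2 * (e ^+ 2 * v))%:E <= orbit_energy B psihat Q (- scale i))%E.
  rewrite mulrA EFinM -lebQ -integral_cst//.
  apply: ge0_le_integral => //.
  - by move=> x _; rewrite lee_fin mulr_ge0 ?sqr_ge0.
  - exact: measurable_orbit_sqr.
  move=> xi Qxi; rewrite lee_fin -exprMn opprK.
  rewrite lerXn2r ?nnegrE ?normc_ge0 ?mulr_ge0 ?(ltW e0)//.
  apply: le_trans (lo i _); rewrite ler_wpM2l// invmx_exprz exprzNK//.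
  apply: le_product_tent; first exact: ltW.
  by move=> k; have := Qxi k; rewrite !mxE [X in _ -> _ <= X - _]splitr addrK.
have term i k : [set T i *m x | x in euclidean_ball r] k ->
    ((h ^+ 2)%:E * (b i ^+ 2 * (e ^+ 2 * v))%:E <=
     lic_term B psihat (tent_at (4 * r) x0) (- scale i) k)%E.
  move=> [y yr yk].
  have val xi : Q xi -> h <= normc (tent_at (4 * r) x0 (xi + B ^ (- scale i) *m k)).
    move=> Qxi; apply: le_normc_tent_at; first exact: ltW.
    move=> m; rewrite -yk exprzNK// !mxE.
    have -> : xi m ord0 + y m ord0 - x0 m ord0 = (xi m ord0 - x0 m ord0) + y m ord0 by ring.
    apply: le_trans (ler_normD _ _) _.
    have := Qxi m; have := euclidean_ball_entry m yr; have := r0; lra.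
  have val0 xi : Q xi -> fsupp (tent_at (4 * r) x0) xi.
    move=> Qxi; apply/eqP => t0.
    have : h <= normc (tent_at (4 * r) x0 xi).
      apply: le_normc_tent_at; first exact: ltW.
      by move=> m; apply: le_trans (Qxi m) _; have := r0; lra.
    by rewrite t0 normc0 leNgt h0.
  apply: le_trans (lic_term_lower mp (cmeasurable_tent_at _ _) mQ val0 (sqr_ge0 h) _).
    by rewrite lee_wpmul2l ?lee_fin ?sqr_ge0.
  by move=> xi /val hx; rewrite lerXn2r ?nnegrE ?normc_ge0 ?(ltW h0).
have big i : ((kap * 2 ^+ i)%:E <= Tot)%E.
  apply: le_trans (esum_ge1 (fun j => \esum_(k in G)
    lic_term B psihat (tent_at (4 * r) x0) j k)%E (I : [set: int] (- scale i))).
  pose S := G `&` [set T i *m x | x in euclidean_ball r].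
  apply: (@le_trans _ _ (\esum_(k in S) (kap * b i ^+ 2)%:E)%E).
    rewrite esum_cst; last by rewrite mulr_ge0 ?sqr_ge0 ?ltW.
    apply: (@le_trans _ _ ((kap * b i ^+ 2)%:E * (8 ^+ i * maxdet (scale i))%:E)%E); last first.
      by rewrite lee_wpmul2l ?lee_fin ?mulr_ge0 ?sqr_ge0 ?(ltW kap0)// ltW// many.
    (* b_i^2 8^i m_i = 4^-i 8^i = 2^i *)
    rewrite -EFinM lee_fin -[leRHS]mulrA ler_wpM2l ?(ltW kap0)// b_sqr.
    rewrite mulrACA mulVf ?gt_eqF// mulr1.
    by rewrite (_ : 8 = 4 * 2 :> R) ?exprMn ?mulKf ?expf_neq0// -natrM.
  apply: (@le_trans _ _ (\esum_(k in S)
      lic_term B psihat (tent_at (4 * r) x0) (- scale i) k)%E).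
    apply: le_esum => k [_ /term]; apply: le_trans.
    by rewrite -EFinM lee_fin [b i ^+ 2 * _]mulrC [leRHS]mulrA.
  by apply: esum_subset => [k|k []//]; exact: lic_term_ge0.
have Tot0 : (0 <= Tot)%E by apply: le_trans (big 0); rewrite lee_fin mulr_ge0 ?ltW.
have TotE : Tot = (fine Tot)%:E by rewrite fineK// ge0_fin_numE.
have [m mP] : exists m : nat, fine Tot / kap < m%:R.
  exists (Num.bound (fine Tot / kap)).
  by rewrite archi_boundP// divr_ge0 ?fine_ge0 ?(ltW kap0).
have := big m; rewrite TotE lee_fin leNgt => /negP; apply.
rewrite mulrC -ltr_pdivrMr// (lt_trans mP)//.
by rewrite -natrX ltr_nat ltn_expl.
Qed.

Lemma superposition_witness : exists psi psihat, [/\ is_fourier psi psihat,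
    calderon_condition B E (fun _ : 'I_1 => psihat) &
    ~ local_integrability_condition B G E (fun _ : 'I_1 => psihat)].
Proof.
have [psi [psihat [pp up lo]]] := dilated_tents x0 r0 uT b_ge0 b1 bT.
have [_ [mp _] _] := pp.
exists psi, psihat; split=> //; first exact: superposition_calderon.
exact: superposition_not_lic.
Qed.

End witness.

Lemma calderon_without_lic G : (exists x, 0 < q x) ->
  ~ lattice_counting_estimate B G ->
  exists psi psihat, [/\ is_fourier psi psihat,
    calderon_condition B E (fun _ : 'I_1 => psihat) &
    ~ local_integrability_condition B G E (fun _ : 'I_1 => psihat)].
Proof.
move=> q_gt0 /existsNP[r /not_implyP[r0 /forallNP nC]].
have /choice[scale many] i : exists j : int, ((8 ^+ i * maxdet j)%:E <
    counting (G `&` [set (B ^ j) *m x | x in euclidean_ball r]))%E.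
  by have /existsNP[j /negP] := nC (8 ^+ i); rewrite -ltNge; exists j.
have [x0 x0E] := cube_off_central_radius q_gt0 (mulr_gt0 (ltr0n R 4) r0).
exact: superposition_witness r0 x0E many.
Qed.

End expanding.

Theorem theorem3p8 (R : realType) (n : nat) (A : 'M[R]_n.+1)
    (Gamma : set 'cV[R]_n.+1) :
  A \in unitmx -> 1 < `|\det A| -> full_rank_lattice Gamma ->
  let B := A^T in
  let E := central_space B in
  lattice_counting_estimate B (dual_lattice Gamma) <->
  (forall (L : nat) (psi psihat : 'I_L -> 'cV[R]_n.+1 -> R[i]),
     (forall l, inLp 2%:E (psi l)) ->
     (forall l, is_fourier (psi l) (psihat l)) ->
     (local_integrability_condition B (dual_lattice Gamma) E psihat <->
      calderon_condition B E psihat)).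
Proof.
move=> uA dA _ B E; have uB : B \in unitmx by rewrite unitmx_tr.
have dB : 1 < `|\det B| by rewrite det_tr.
have [q [lam [[lam1 q0 qD qZ] qB qE q_gt0]]] := expanding_seminorm B.
split=> [lce L psi psihat _ pp|equiv].
  have p2 l : inLp 2%:E (psihat l) by case: (pp l).
  split; last exact: lic_of_calderon uB lam1 q0 qD qZ qB qE _ _ _ lce p2.
  apply: calderon_of_lic q0 qD qZ qE _ _ _ _ _ => [y _|l]; last by case: (p2 l).
  by rewrite /dotp big1 ?rpred0// => i _; rewrite mxE mul0r.
apply: contrapT => nlce.
have [psi [psihat [pp cal]]] :=
  calderon_without_lic uB lam1 q0 qD qZ qB qE (q_gt0 dB) nlce.
apply; apply/(equiv 1%N (fun=> psi)) => // l.
by case: pp.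
Qed.
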